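(* Let $K$ be a field, $f:\mathbb Z_{\ge0}\to\mathbb R_{\ge0}$ with $\lim_{n\to\infty}f(n)/n=0$, and $B=\bigoplus_{n\ge0}B_n$ an integral graded $K$-algebra of finite type over $K$, generated as $K$-algebra by $B_1$. Suppose: (i) the Krull dimension $\dim B$ is $>0$; (ii) for every $n\ge1$, $B_n$ carries a separated, exhaustive and left continuous $\mathbb R$-filtration making $B$ an $f$-quasi-filtered graded $K$-algebra; (iii) $\limsup_{n\to\infty}\sup_{0\ne a\in B_n}\lambda(a)/n<+\infty$. For $n\ge1$ let $\nu_n=T_{1/n}\nu_{B_n}$. Then (1) $\lim_{n\to\infty}\frac1n\min_{0\ne a\in B_n}\lambda(a)$ exists in $\mathbb R$; (2) the supports of the $\nu_n$ ($n\ge1$) are contained in a common bounded interval and $(\nu_n)_{n\ge1}$ converges vaguely to a Borel probability measure on $\mathbb R$.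
   Context: Filtrations: a decreasing family $(\mathcal F_rW)_{r\in\mathbb R}$ of subspaces; separated: $\bigcap_r\mathcal F_rW=0$; exhaustive: $\bigcup_r\mathcal F_rW=W$; left continuous: $\mathcal F_rW=\bigcap_{s<r}\mathcal F_sW$. Index: $\lambda(x)=\sup\{r:x\in\mathcal F_rW\}$. For nonzero finite-dimensional $W$, $\nu_W$ is the Borel probability measure with $\nu_W([r,+\infty[)=\dim\mathcal F_rW/\dim W$. $T_\varepsilon\nu$ is the image of $\nu$ under $x\mapsto\varepsilon x$. Vague convergence: convergence of integrals of all continuous compactly supported functions. $B$ (with filtrations $(B_{n,s})_s$) is $f$-quasi-filtered if there is $n_0\ge0$ such that for all $r>0$, $(n_i)\in\mathbb Z_{\ge n_0}^r$, $(s_i)\in\mathbb R^r$: $B_{n_1,s_1}\cdots B_{n_r,s_r}\subseteq B_{N,S}$, $N=\sum n_i$, $S=\sum(s_i-f(n_i))$. *)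

(* Defs.v *)
From Stdlib Require Import Reals ClassicalDescription.
From HB Require Import structures.
From mathcomp Require Import all_boot all_order all_algebra.

Set Implicit Arguments.
Unset Strict Implicit.
Unset Printing Implicit Defensive.

Section Alg.
Local Open Scope ring_scope.
Variable K : fieldType.

Definition is_subspace (V : lmodType K) (S : V -> Prop) : Prop :=
  S 0 /\ (forall x y, S x -> S y -> S (x + y)) /\ (forall (k : K) x, S x -> S (k *: x)).

Definition in_span (V : lmodType K) (S : V -> Prop) (x : V) : Prop :=
  exists (vs : seq V) (ks : seq K),
    (forall i, (i < size vs)%N -> S vs`_i) /\ x = \sum_(i < size vs) ks`_i *: vs`_i.

Definition lin_indep (V : lmodType K) (vs : seq V) : Prop :=
  forall ks : seq K, size ks = size vs ->
    \sum_(i < size vs) ks`_i *: vs`_i = 0 -> forall i, (i < size vs)%N -> ks`_i = 0.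

Definition has_dim (V : lmodType K) (S : V -> Prop) (d : nat) : Prop :=
  is_subspace S /\
  exists vs : seq V, size vs = d /\ (forall i, (i < size vs)%N -> S vs`_i) /\
    lin_indep vs /\
    (forall x, S x -> exists ks : seq K, x = \sum_(i < size vs) ks`_i *: vs`_i).

Definition integral_domain (B : comAlgType K) : Prop :=
  (1 : B) <> 0 /\ forall a b : B, a * b = 0 -> a = 0 \/ b = 0.

Definition graded (B : comAlgType K) (Bn : nat -> B -> Prop) : Prop :=
  (forall n, is_subspace (Bn n)) /\
  (forall m n a b, Bn m a -> Bn n b -> Bn (m + n)%N (a * b)) /\
  Bn 0%N 1 /\
  (forall x : B, exists (N : nat) (c : nat -> B),
      (forall i, Bn i (c i)) /\ x = \sum_(i < N) c i) /\
  (forall (N : nat) (c : nat -> B), (forall i, Bn i (c i)) ->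
      \sum_(i < N) c i = 0 -> forall i, (i < N)%N -> c i = 0).

Inductive in_subalg (B : comAlgType K) (S : B -> Prop) : B -> Prop :=
| sa_gen x : S x -> in_subalg S x
| sa_one : in_subalg S 1
| sa_add x y : in_subalg S x -> in_subalg S y -> in_subalg S (x + y)
| sa_mul x y : in_subalg S x -> in_subalg S y -> in_subalg S (x * y)
| sa_scale (k : K) x : in_subalg S x -> in_subalg S (k *: x).

Definition finite_type (B : comAlgType K) : Prop :=
  exists s : seq B, forall x, in_subalg (fun y => y \in s) x.

Definition generated_by (B : comAlgType K) (S : B -> Prop) : Prop :=
  forall x, in_subalg S x.

Definition is_ideal (B : comAlgType K) (I : B -> Prop) : Prop :=
  I 0 /\ (forall x y, I x -> I y -> I (x + y)) /\ (forall a x, I x -> I (a * x)).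

Definition is_prime_ideal (B : comAlgType K) (I : B -> Prop) : Prop :=
  is_ideal I /\ ~ I 1 /\ (forall a b, I (a * b) -> I a \/ I b).

Definition krull_dim_pos (B : comAlgType K) : Prop :=
  exists p q : B -> Prop, is_prime_ideal p /\ is_prime_ideal q /\
    (forall x, p x -> q x) /\ (exists x, q x /\ ~ p x).

Definition filtration_on (B : comAlgType K) (W : B -> Prop) (Fr : R -> B -> Prop) : Prop :=
  (forall r, is_subspace (Fr r) /\ (forall x, Fr r x -> W x)) /\
  (forall r s, Rle r s -> forall x, Fr s x -> Fr r x) /\
  (forall x, (forall r, Fr r x) -> x = 0) /\
  (forall x, W x -> exists r, Fr r x) /\
  (forall r x, Fr r x <-> (forall s, Rlt s r -> Fr s x)).

Definition prod_set (B : comAlgType K) (F : nat -> R -> B -> Prop)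
    (l : seq (nat * R)) (y : B) : Prop :=
  exists xs : seq B, size xs = size l /\
    (forall i, (i < size l)%N -> F (nth (0%N, R0) l i).1 (nth (0%N, R0) l i).2 xs`_i) /\
    y = \prod_(i < size l) xs`_i.

Definition quasi_filtered (B : comAlgType K) (f : nat -> R)
    (F : nat -> R -> B -> Prop) : Prop :=
  exists n0 : nat, forall l : seq (nat * R), (0 < size l)%N ->
    (forall i, (i < size l)%N -> (n0 <= (nth (0%N, R0) l i).1)%N) ->
    forall x, in_span (prod_set F l) x ->
      F (sumn (map fst l))
        (foldr (fun p acc => Rplus (Rminus p.2 (f p.1)) acc) R0 l) x.

Definition lambda_is (B : comAlgType K) (Fr : R -> B -> Prop) (a : B) (l : R) : Prop :=
  is_lub (fun r => Fr r a) l.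

Definition is_min_lambda (B : comAlgType K) (Bn : nat -> B -> Prop)
    (F : nat -> R -> B -> Prop) (n : nat) (m : R) : Prop :=
  (exists a, Bn n a /\ a <> 0 /\ lambda_is (F n) a m) /\
  (forall a l, Bn n a -> a <> 0 -> lambda_is (F n) a l -> Rle m l).

Definition limsup_lambda_finite (B : comAlgType K) (Bn : nat -> B -> Prop)
    (F : nat -> R -> B -> Prop) : Prop :=
  exists (C : R) (N : nat), forall n, (N <= n)%N -> (1 <= n)%N ->
    forall a l, Bn n a -> a <> 0 -> lambda_is (F n) a l -> Rle (Rdiv l (INR n)) C.

End Alg.

Local Open Scope R_scope.

Inductive borel : (R -> Prop) -> Prop :=
| borel_open (a b : R) : borel (fun x => a < x < b)
| borel_compl (A : R -> Prop) : borel A -> borel (fun x => ~ A x)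
| borel_cunion (A : nat -> R -> Prop) : (forall k, borel (A k)) -> borel (fun x => exists k, A k x)
| borel_ext (A A' : R -> Prop) : (forall x, A x <-> A' x) -> borel A -> borel A'.

Definition prob_measure (mu : (R -> Prop) -> R) : Prop :=
  (forall A, borel A -> 0 <= mu A) /\
  mu (fun _ => True) = 1 /\
  (forall A : nat -> R -> Prop, (forall k, borel (A k)) ->
     (forall i j x, i <> j -> A i x -> A j x -> False) ->
     infinite_sum (fun k => mu (A k)) (mu (fun x => exists k, A k x))).

Definition indic (A : R -> Prop) (x : R) : R :=
  if excluded_middle_informative (A x) then 1 else 0.

Definition simple_below (mu : (R -> Prop) -> R) (h : R -> R) (v : R) : Prop :=
  exists l : seq (R * (R -> Prop)),
    (forall i, (i < size l)%nat -> 0 <= (nth (0, fun _ => False) l i).1 /\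
                                  borel (nth (0, fun _ => False) l i).2) /\
    (forall i j x, (i < j)%nat -> (j < size l)%nat ->
        (nth (0, fun _ => False) l i).2 x -> (nth (0, fun _ => False) l j).2 x -> False) /\
    (forall x, foldr (fun p acc => p.1 * indic p.2 x + acc) 0 l <= h x) /\
    v = foldr (fun p acc => p.1 * mu p.2 + acc) 0 l.

Definition integral_nonneg (mu : (R -> Prop) -> R) (h : R -> R) (I : R) : Prop :=
  is_lub (simple_below mu h) I.

Definition integral (mu : (R -> Prop) -> R) (g : R -> R) (I : R) : Prop :=
  exists I1 I2, integral_nonneg mu (fun x => Rmax (g x) 0) I1 /\
                integral_nonneg mu (fun x => Rmax (- g x) 0) I2 /\ I = I1 - I2.

Definition compact_support (g : R -> R) : Prop :=
  exists M, forall x, M < Rabs x -> g x = 0.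

Definition vague_cv (nu : nat -> (R -> Prop) -> R) (mu : (R -> Prop) -> R) : Prop :=
  forall g, continuity g -> compact_support g ->
    exists (In : nat -> R) (I : R),
      (forall n, (1 <= n)%nat -> integral (nu n) g (In n)) /\
      integral mu g I /\ Un_cv In I.

Definition in_support (mu : (R -> Prop) -> R) (x : R) : Prop :=
  forall eps, 0 < eps -> 0 < mu (fun y => x - eps < y < x + eps).

Definition pushT (eps : R) (nu : (R -> Prop) -> R) : (R -> Prop) -> R :=
  fun A => nu (fun y => A (eps * y)).

(* nu = nu_W for the filtration (F_r) of the nonzero finite-dim space W *)
Definition is_nu_W (K : fieldType) (B : comAlgType K) (W : B -> Prop)
    (Fr : R -> B -> Prop) (nu : (R -> Prop) -> R) : Prop :=
  prob_measure nu /\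
  forall r d d', has_dim (Fr r) d -> has_dim W d' ->
    nu (fun x => r <= x) = INR d / INR d'.

(* Main.v *)
(** The dimension of a filtration step of [B_n] is bounded below through [q]-th powers.  If [B]
    is a domain generated in degree one, with [d = dim B - 1], the key inequality is

      [q^d dim V <= dim (span {v^q w | v in V, w in B_(q d + c)})]   for [V] a subspace of [B_p],

    for a constant [c] and all [q] in an arithmetic progression.  To see it, choose in degree
    zero of [Frac B] algebraically independent [y_1, .., y_d] and a valuation for which the
    Laurent monomials in [y] have pairwise distinct, lexicographically ordered values.  Its
    residue field is finite over [K] and its value group contains the lattice of the
    monomials with finite index.  Pick vectors [e_i] in [V] with distinct values and a basis
    [u_j] of the residues: the products [e_i^q y^r u_j] with [0 <= r_k < q] are linearly
    independent, and [dim V] is at most the number of pairs [(i, j)].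

    Applied to [V = F_s B_p], the quasi-filtration property turns this into an asymptotic
    monotonicity of the functions [t -> nu_n [t, +oo)]: up to errors that vanish as [p] grows,
    [nu_n [t - eps, +oo) >= nu_p [t, +oo)] for all large [n].  Applied to [V = B_p] it shows
    that [dim B_n / n^d] converges to a positive limit, so that no mass is lost.  Hence the
    tails converge outside the jumps of a right-continuous function, which is the tail of the
    limit measure.  The convergence of [min lambda / n] is Fekete's lemma. *)
Require Import Defs.
From Stdlib Require Import Reals ClassicalDescription.
From HB Require Import structures.
From mathcomp Require Import all_boot all_order all_algebra fraction.
From mathcomp Require Import boolp classical_sets zify ring.
From mathcomp Require Import reals ereal topology normedtype sequences measure.
From mathcomp Require Import lebesgue_stieltjes_measure Rstruct Rstruct_topology.
Set Implicit Arguments.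
Unset Strict Implicit.
Unset Printing Implicit Defensive.
Import Order.TTheory GRing.Theory Num.Theory.
Import numFieldTopology.Exports numFieldNormedType.Exports.

(** * Linear algebra and polynomial expressions *)

Section LinearAlgebra.
Local Open Scope ring_scope.
Variables (K L : fieldType) (iota : {rmorphism K -> L}).

Definition indep (I : finType) (v : I -> L) :=
  forall c : I -> K, \sum_i iota (c i) * v i = 0 -> forall i, c i = 0.

Definition spanned (S : L -> Prop) n :=
  exists v : 'I_n -> L,
    forall x, S x -> exists c : 'I_n -> K, x = \sum_i iota (c i) * v i.

Definition subspace (S : L -> Prop) :=
  [/\ S 0, forall x y, S x -> S y -> S (x + y) & forall k x, S x -> S (iota k * x)].

Lemma subspace_sum S (I : Type) (r : seq I) (P : pred I) (F : I -> L) :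
  subspace S -> (forall i, P i -> S (F i)) -> S (\sum_(i <- r | P i) F i).
Proof. by case=> S0 SD _ SF; elim/big_ind: _. Qed.
Arguments subspace_sum {S I r P F}.

Lemma steinitz S n (I : finType) (v : I -> L) :
  spanned S n -> (forall i, S (v i)) -> indep v -> (#|I| <= n)%N.
Proof.
move=> [w Sw] Sv vi; rewrite leqNgt; apply/negP => ltnI.
have /choice[c cE] : forall i, exists c : 'I_n -> K, v i = \sum_j iota (c j) * w j.
  by move=> i; apply: Sw.
pose A : 'M[K]_(#|I|, n) := \matrix_(i, j) c (enum_val i) j.
have : kermx A != 0.
  by rewrite kermx_eq0 /row_free; apply: contraL ltnI => /eqP <-; rewrite -leqNgt rank_leq_col.
case/rowV0Pn => r /sub_kermxP rA /eqP r0; apply: r0; apply/rowP => i.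
rewrite mxE -(vi (fun i => r 0 (enum_rank i)) _ (enum_val i)) ?enum_valK //.
have E i0 : iota (r 0 (enum_rank i0)) * v i0 =
    \sum_j iota (r 0 (enum_rank i0) * c i0 j) * w j.
  by rewrite cE mulr_sumr; apply: eq_bigr => j _; rewrite rmorphM mulrA.
under eq_bigr do rewrite E.
rewrite exchange_big /= big1 // => j _.
rewrite -mulr_suml -rmorph_sum /= (_ : \sum_i0 _ = 0) ?rmorph0 ?mul0r //.
transitivity ((r *m A) 0 j); last by rewrite rA mxE.
rewrite mxE (reindex (@enum_val I xpredT)) /=; last first.
  by exists enum_rank => x _; rewrite ?enum_valK ?enum_rankK.
by apply: eq_bigr => x _; rewrite mxE enum_valK.
Qed.

Lemma spannedS (S T : L -> Prop) n :
  (forall x, S x -> T x) -> spanned T n -> spanned S n.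
Proof. by move=> ST [v Tv]; exists v => x /ST/Tv. Qed.

Lemma spanned_leq S n m : (n <= m)%N -> spanned S n -> spanned S m.
Proof.
move=> /subnKC <- [v Sv]; exists (fun i => match split i with inl j => v j | inr _ => 0 end).
move=> x /Sv[c ->]; exists (fun i => match split i with inl j => c j | inr _ => 0 end).
rewrite big_split_ord /= [X in _ + X]big1 ?addr0; last first.
  by move=> i _; rewrite (unsplitK (inr _ i)) mulr0.
by apply: eq_bigr => i _; rewrite !(unsplitK (inl _ i)).
Qed.

Lemma spannedD S T n m : spanned S n -> spanned T m ->
  spanned (fun x => exists y z, [/\ S y, T z & x = y + z]) (n + m).
Proof.
move=> [v Sv] [w Tw].
exists (fun i => match split i with inl j => v j | inr j => w j end) => x [y [z [/Sv[c ->] /Tw[d ->] ->]]].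
exists (fun i => match split i with inl j => c j | inr j => d j end).
rewrite big_split_ord /=; congr (_ + _); apply: eq_bigr => i _.
  by rewrite !(unsplitK (inl _ i)).
by rewrite !(unsplitK (inr _ i)).
Qed.

Lemma spanned_mul S n (a : L) : spanned S n ->
  spanned (fun x => exists2 y, S y & x = y * a) n.
Proof.
move=> [v Sv]; exists (fun i => v i * a) => _ [y /Sv[c ->] ->]; exists c.
by rewrite mulr_suml; apply: eq_bigr => i _; rewrite mulrA.
Qed.

Lemma spanned_div S T n (a : L) : a != 0 -> (forall x, S x -> T (a * x)) ->
  spanned T n -> spanned S n.
Proof.
move=> a0 ST /(spanned_mul a^-1); apply: spannedS => x Sx; exists (a * x); first exact: ST.
by rewrite mulrC mulKf.
Qed.

Lemma spanned_sum (S : nat -> L -> Prop) n k (a : nat -> L) :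
  (forall j, (j < k)%N -> spanned (S j) n) ->
  spanned (fun x => exists2 c : nat -> L, (forall j, (j < k)%N -> S j (c j)) &
    x = \sum_(j < k) c j * a j) (k * n).
Proof.
elim: k => [|k IHk] Sn.
  exists (fun=> 0) => x [c _ ->]; exists (fun=> 0).
  by rewrite big_ord0 big1 // => i _; rewrite mulr0.
rewrite mulSn addnC.
have := spannedD (IHk (fun j ltjk => Sn j (ltnW ltjk))) (spanned_mul (a k) (Sn k (ltnSn k))).
apply: spannedS => x [c Sc ->]; exists (\sum_(j < k) c j * a j), (c k * a k).
rewrite big_ord_recr; split => //; last by exists (c k) => //; apply: Sc.
by exists c => // j ltjk; apply/Sc/ltnW.
Qed.

(* Polynomial expressions of total degree at most [n] in the members of [s]. *)
Fixpoint Pol (s : seq L) (n : nat) (x : L) : Prop :=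
  if s is z :: s' then
    exists2 p : {poly L}, (size p <= n.+1)%N /\ (forall j, (j <= n)%N -> Pol s' (n - j) p`_j) & x = p.[z]
  else exists k, x = iota k.

Lemma Pol_subspace s n : subspace (Pol s n).
Proof.
elim: s n => [|z s IHs] n.
  split; first by exists 0; rewrite rmorph0.
    by move=> _ _ [k ->] [l ->]; exists (k + l); rewrite rmorphD.
  by move=> k _ [l ->]; exists (k * l); rewrite rmorphM.
split.
- exists 0; last by rewrite horner0.
  by rewrite size_poly0; split=> // j _; rewrite coef0; have [] := IHs (n - j)%N.
- move=> _ _ [p [sp Sp] ->] [q [sq Sq] ->]; exists (p + q); last by rewrite hornerD.
  split; first by apply: leq_trans (size_polyD _ _) _; rewrite geq_max sp.
  by move=> j jn; rewrite coefD; have [_ D _] := IHs (n - j)%N; exact: D (Sp _ jn) (Sq _ jn).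
move=> k _ [p [sp Sp] ->]; exists ((iota k) *: p); last by rewrite hornerZ.
split; first exact: leq_trans (size_scale_leq _ _) _.
by move=> j jn; rewrite coefZ; have [_ _ Z] := IHs (n - j)%N; exact: Z (Sp _ jn).
Qed.

Lemma PolN s n x : Pol s n x -> Pol s n (- x).
Proof.
by move=> Px; rewrite -mulN1r -(rmorph1 iota) -rmorphN; have [_ _] := Pol_subspace s n; apply.
Qed.

Lemma Pol_const s n k : Pol s n (iota k).
Proof.
elim: s n => [|z s IHs] n /=; first by exists k.
exists (iota k)%:P; last by rewrite hornerC.
split; first exact: leq_trans (size_polyC_leq1 _) _.
by move=> j jn; rewrite coefC; case: eqP => // _; have [] := Pol_subspace s (n - j).
Qed.

Lemma PolM s n m x y : Pol s n x -> Pol s m y -> Pol s (n + m) (x * y).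
Proof.
elim: s n m x y => [|z s IHs] n m x y /=.
  by move=> [k ->] [l ->]; exists (k * l); rewrite rmorphM.
move=> [p [sp Sp] ->] [q [sq Sq] ->]; exists (p * q); last by rewrite hornerM.
split.
  apply: leq_trans (size_polyMleq _ _) _; rewrite -subn1 leq_subLR.
  by rewrite (leq_trans (leq_add sp sq)) // addSn addnS add1n.
move=> j jn; rewrite coefM; apply: (subspace_sum (Pol_subspace _ _)) => i _.
have lij : (i <= j)%N by rewrite -ltnS.
case: (leqP i n) => [lin|ltni]; last first.
  by rewrite nth_default ?mul0r; [have [] := Pol_subspace s (n + m - j) | apply: leq_trans sp ltni].
case: (leqP (j - i) m) => [ljm|ltmj]; last first.
  by rewrite [q`__]nth_default ?mulr0; [have [] := Pol_subspace s (n + m - j) | apply: leq_trans sq ltmj].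
rewrite (_ : n + m - j = n - i + (m - (j - i)))%N; last lia.
by apply: IHs; [apply: Sp | apply: Sq].
Qed.

Lemma Pol_leq s n m x : (n <= m)%N -> Pol s n x -> Pol s m x.
Proof.
move=> /subnKC <- Px; rewrite -[x]mulr1 -(rmorph1 iota).
exact/PolM/Pol_const.
Qed.

Lemma Pol_cons z s n x : Pol s n x -> Pol (z :: s) n x.
Proof.
move=> Px; exists x%:P; last by rewrite hornerC.
split; first exact: leq_trans (size_polyC_leq1 _) _.
move=> j jn; rewrite coefC; case: eqP => [->|_]; first by rewrite subn0.
by have [] := Pol_subspace s (n - j).
Qed.

Lemma Pol_mem z s : z \in s -> Pol s 1 z.
Proof.
elim: s => // y s IHs; rewrite inE => /orP[/eqP->|/IHs]; last exact: Pol_cons.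
exists 'X; last by rewrite hornerX.
rewrite size_polyX; split=> // j _; rewrite coefX.
by rewrite -[(_ == _)%:R](rmorph_nat iota); apply: Pol_const.
Qed.

Lemma PolX s n x k : Pol s n x -> Pol s (k * n) (x ^+ k).
Proof.
move=> Px; elim: k => [|k IHk]; last by rewrite exprS mulSn; apply: PolM.
by rewrite expr0 -(rmorph1 iota); apply: Pol_const.
Qed.

Lemma PolS y s n x : (forall z, z \in y -> Pol s 1 z) -> Pol y n x -> Pol s n x.
Proof.
elim: y n x => [|z y IHy] n x ys /=; first by case=> k ->; apply: Pol_const.
move=> [p [sp Sp] ->].
rewrite (horner_coef_wide _ sp); apply: (subspace_sum (Pol_subspace _ _)) => j _.
have jn : (j <= n)%N by rewrite -ltnS.
apply: (@Pol_leq _ (n - j + j)); first by rewrite subnK.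
apply: PolM.
  apply: IHy => [t ty|]; first by apply: ys; rewrite inE ty orbT.
  exact: Sp.
by have := PolX j (ys z (mem_head _ _)); rewrite muln1.
Qed.

Definition Frac (y : seq L) (x : L) :=
  exists n p q, [/\ Pol y n p, Pol y n q, q != 0 & x = p / q].

Lemma Frac_Pol y n x : Pol y n x -> Frac y x.
Proof.
move=> Px; exists n, x, 1; split=> //; rewrite ?oner_eq0 ?divr1 //.
by rewrite -(rmorph1 iota); apply: Pol_const.
Qed.

Lemma FracM y a b : Frac y a -> Frac y b -> Frac y (a * b).
Proof.
move=> [n [p [q [Pp Pq q0 ->]]]] [m [r [s [Pr Ps s0 ->]]]].
exists (n + m)%N, (p * r), (q * s); split; rewrite ?mulf_neq0 //; try exact: PolM.
by rewrite invfM mulrACA.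
Qed.

Lemma FracV y a : Frac y a -> Frac y a^-1.
Proof.
move=> [n [p [q [Pp Pq q0 ->]]]]; case: (eqVneq p 0) => [->|p0].
  by rewrite mul0r invr0; apply: (@Frac_Pol _ 0); have [] := Pol_subspace y 0.
by exists n, q, p; split; rewrite // invfM invrK mulrC.
Qed.

Lemma FracD y a b : Frac y a -> Frac y b -> Frac y (a + b).
Proof.
move=> [n [p [q [Pp Pq q0 ->]]]] [m [r [s [Pr Ps s0 ->]]]].
exists (n + m)%N, (p * s + r * q), (q * s); split; rewrite ?mulf_neq0 //.
- by have [_ D _] := Pol_subspace y (n + m); apply: D; [exact: PolM|rewrite addnC; exact: PolM].
- exact: PolM.
- by rewrite addf_div.
Qed.

Lemma FracX y a k : Frac y a -> Frac y (a ^+ k).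
Proof.
move=> Fa; elim: k => [|k IHk]; last by rewrite exprS; apply: FracM.
by rewrite expr0 -(rmorph1 iota); apply: (@Frac_Pol _ 0); apply: Pol_const.
Qed.

Lemma FracXz y a (k : int) : Frac y a -> Frac y (a ^ k).
Proof.
by case: k => k Fa; [apply: FracX|rewrite NegzE -exprnN; apply/FracV/FracX].
Qed.

Lemma Frac_subspace y : subspace (Frac y).
Proof.
split; first by apply: (@Frac_Pol _ 0); have [] := Pol_subspace y 0.
  exact: FracD.
by move=> k x; apply: FracM; apply: (@Frac_Pol _ 0); apply: Pol_const.
Qed.

Lemma common_denominator y (I : finType) (x : I -> L) : (forall i, Frac y (x i)) ->
  exists n q, [/\ Pol y n q, q != 0 & forall i, Pol y n (q * x i)].
Proof.
move=> Fx; suff [n [q [Pq q0 H]]] : exists n q, [/\ Pol y n q, q != 0 & forall i, i \in enum I -> Pol y n (q * x i)].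
  by exists n, q; split=> // i; apply: H; rewrite mem_enum.
elim: (enum I) => [|i s [n [q [Pq q0 H]]]].
  by exists 0%N, 1; split; rewrite ?oner_eq0 // -(rmorph1 iota); apply: Pol_const.
have [m [a [b [Pa Pb b0 xiE]]]] := Fx i.
exists (n + m)%N, (q * b); split; rewrite ?mulf_neq0 //; first exact: PolM.
move=> j; rewrite inE => /orP[/eqP->|/H Hj].
  by rewrite xiE -mulrA (mulrC b) divfK //; apply: PolM.
by rewrite mulrAC; apply: PolM.
Qed.

Definition transc (y : seq L) (z : L) :=
  forall p : {poly L}, (forall j, Frac y p`_j) -> p.[z] = 0 -> p = 0.

Fixpoint alg_indep (y : seq L) :=
  if y is z :: y' then alg_indep y' /\ transc y' z else True.

Lemma nontransc_relation y z : ~ transc y z ->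
  exists n k (c : nat -> L) (D : L), [/\ Pol y n D, D != 0, (forall j, Pol y n (c j)) &
    D * z ^+ k = \sum_(j < k) c j * z ^+ j].
Proof.
move=> /existsNP[p /not_implyP[Fp /not_implyP[pz /eqP p0]]].
have [n [q [Pq q0 H]]] := @common_denominator y 'I_(size p) (fun j => p`_j) (fun j => Fp j).
have P0 : Pol y n 0 by have [] := Pol_subspace y n.
exists n, (size p).-1, (fun j => if (j < size p)%N then - (q * p`_j) else 0), (q * lead_coef p).
have s0 : (0 < size p)%N by rewrite size_poly_gt0.
split; rewrite ?mulf_neq0 ?lead_coef_eq0 //.
- by have := H (Ordinal (n:=size p) (m:=(size p).-1) ltac:(by rewrite prednK)).
- by move=> j; case: ifP => // jp; apply: PolN; apply: (H (Ordinal jp)).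
move: pz; rewrite horner_coef lead_coefE; case: (size p) s0 => // m _.
rewrite big_ord_recr /= => /(congr1 ( *%R q)); rewrite mulr0 mulrDr mulr_sumr => /eqP.
rewrite addrC addr_eq0 => /eqP E; rewrite -mulrA E -sumrN.
by apply: eq_bigr => j _; rewrite ltnS ltnW // mulNr mulrA.
Qed.

Lemma clear_powers s z e k (c : nat -> L) D n x :
  Pol s e D -> D != 0 -> (forall j, Pol s e (c j)) ->
  D * z ^+ k = \sum_(j < k) c j * z ^+ j -> Pol (z :: s) n x ->
  exists2 a : nat -> L, (forall j, (j < k)%N -> Pol s (n + n * e) (a j)) &
    D ^+ n * x = \sum_(j < k) a j * z ^+ j.
Proof.
move=> PD D0 Pc zk [p [sp Sp] ->].
pose W m x := exists2 a : nat -> L, (forall j, (j < k)%N -> Pol s m (a j)) &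
    x = \sum_(j < k) a j * z ^+ j.
have WD m u v : W m u -> W m v -> W m (u + v).
  move=> [a Pa ->] [b Pb ->]; exists (fun j => a j + b j) => [j jk|].
    by have [_ DD _] := Pol_subspace s m; apply: DD; auto.
  by rewrite -big_split; apply: eq_bigr => j _; rewrite mulrDl.
have WM m m' u v : Pol s m' u -> W m v -> W (m + m')%N (u * v).
  move=> Pu [a Pa ->]; exists (fun j => u * a j) => [j jk|].
    by rewrite addnC; apply: PolM; auto.
  by rewrite mulr_sumr; apply: eq_bigr => j _; rewrite mulrA.
have WZ m v : W m v -> W (m + e)%N (D * z * v).
  move=> [a Pa ->]; case: k zk @W WD WM Pa => [|k] zk W WD WM Pa.
    by exists (fun=> 0) => //; rewrite !big_ord0 mulr0.
  rewrite big_ord_recr /= mulrDr; apply: WD.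
    exists (fun j => if j is j'.+1 then D * a j' else 0) => [j jk|].
      case: j jk => [|j] jk; first by have [] := Pol_subspace s (m + e).
      by rewrite addnC; apply: PolM => //; apply: Pa; apply: ltnW.
    rewrite big_ord_recl mul0r add0r mulr_sumr; apply: eq_bigr => j _.
    by rewrite /= /bump /= exprS -!mulrA; congr (_ * _); rewrite mulrCA.
  rewrite mulrCA -mulrA -exprS addnC; apply: WM; first exact: Pa.
  by rewrite zk; exists c => // j _; exact: Pc.
have W1 m i : (i <= m)%N -> (0 < k)%N -> W (m * e)%N (D ^+ m * z ^+ i).
  move=> im k0; elim: m i im => [|m IHm] i im.
    move: im; rewrite leqn0 => /eqP->; rewrite mulr1 expr0.
    exists (fun j => if j is 0%N then 1 else 0) => [j jk|].
      by case: j {jk} => [|j]; [rewrite -(rmorph1 iota); apply: Pol_const|have [] := Pol_subspace s (0 * e)].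
    by case: k k0 {zk W WD WM WZ} => // k _; rewrite big_ord_recl big1 ?addr0 ?mulr1 // => j _; rewrite mul0r.
  case: i im => [|i] im.
    rewrite exprS -mulrA mulSn addnC; apply: WM => //; exact: IHm.
  rewrite !exprS mulrACA mulSn addnC; apply: WZ; exact: IHm.
have k0 : (0 < k)%N.
  case: k zk {W WD WM WZ W1} => // /eqP.
  by rewrite expr0 mulr1 big_ord0 (negPf D0).
rewrite (horner_coef_wide _ sp) mulr_sumr.
suff : W (n + n * e)%N (\sum_(i < n.+1) D ^+ n * (p`_i * z ^+ i)) by [].
elim/big_ind: _ => [||i _]; [|exact: WD|].
  exists (fun=> 0) => [j _|]; first by have [] := Pol_subspace s (n + n * e).
  by rewrite big1 // => j _; rewrite mul0r.
have le_in : (i <= n)%N by rewrite -ltnS.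
rewrite mulrCA addnC; apply: WM; last exact: W1.
by apply: Pol_leq (Sp i le_in); apply: leq_subr.
Qed.

Lemma growth (s : seq L) : exists y : seq L, [/\ {subset y <= s}, alg_indep y &
  exists M, forall n, spanned (Pol s n) (M * n.+1 ^ size y)].
Proof.
elim: s => [|z s [y [ys yi [M HM]]]].
  exists [::]; split=> //; exists 1%N => n; exists (fun=> 1) => _ [k ->].
  by exists (fun=> k); rewrite big_ord_recl big_ord0 addr0 mulr1.
have Pys : forall t, t \in y -> Pol s 1 t by move=> t /ys/Pol_mem.
have [tz|/nontransc_relation] := pselect (transc y z).
  exists (z :: y); split=> //.
    by move=> t; rewrite !inE => /orP[->//|/ys->]; rewrite orbT.
  exists M => n /=; rewrite expnS mulnCA.
  have H j : (j < n.+1)%N -> spanned (Pol s (n - j)) (M * n.+1 ^ size y).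
    move=> _; apply: spanned_leq (HM _); rewrite leq_mul2l; apply/orP; right.
    by case: (posnP (size y)) => [->//|y0]; rewrite leq_exp2r // ltnS leq_subr.
  apply: spannedS (spanned_sum (fun j => z ^+ j) H) => x [p [sp Sp] ->].
  by exists (fun j => p`_j); rewrite ?(horner_coef_wide _ sp).
move=> [e [k [c [D [PD D0 Pc zk]]]]].
exists y; split=> //; first by move=> t /ys ts; rewrite inE ts orbT.
exists (k * (M * e.+1 ^ size y))%N => n.
apply: (@spanned_leq _ (k * (M * (n + n * e).+1 ^ size y))).
  rewrite -!mulnA !leq_mul2l -expnMn; apply/orP; right; apply/orP; right.
  by case: (posnP (size y)) => [->//|y0]; rewrite leq_exp2r //; lia.
apply: (@spanned_div _ _ _ (D ^+ n)); [by rewrite expf_neq0| |exact: (spanned_sum (fun j => z ^+ j) (fun j _ => HM (n + n * e)%N))].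
move=> x Px /=.
by have [a Pa E] := clear_powers (PolS Pys PD) D0 (fun j => PolS Pys (Pc j)) zk Px; exists a.
Qed.
End LinearAlgebra.

(** * Extension of valuations *)

Section Chevalley.
Local Open Scope ring_scope.
Variables (K L : fieldType) (iota : {rmorphism K -> L}).
Local Notation subspace := (subspace iota).

Definition mul_closed (J : L -> Prop) := forall x y, J x -> J y -> J (x * y).

Lemma subspaceN S x : subspace S -> S x -> S (- x).
Proof. by case=> _ _ SZ Sx; rewrite -mulN1r -(rmorph1 iota) -rmorphN; exact: SZ Sx. Qed.

Lemma subspaceB S x y : subspace S -> S x -> S y -> S (x - y).
Proof. by move=> Ss Sx Sy; have [_ SD _] := Ss; exact: SD Sx (subspaceN Ss Sy). Qed.

Lemma exists_maximal_nonunital (J0 : L -> Prop) :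
  subspace J0 -> mul_closed J0 -> ~ J0 1 ->
  exists J : L -> Prop, [/\ subspace J, mul_closed J, ~ J 1, forall x, J0 x -> J x &
    forall J' : L -> Prop, subspace J' -> mul_closed J' -> ~ J' 1 ->
      (forall x, J x -> J' x) -> forall x, J' x -> J x].
Proof.
move=> J0s J0M J01.
pose good J := [/\ subspace J, mul_closed J, ~ J 1 & forall x, J0 x -> J x].
have g0 : good J0 by [].
pose R (a b : {J | good J}) := `[< forall x, sval a x -> sval b x >].
have [||A Atot|[J [Js JM J1 JJ]] Jmax] := @ZL_preorder _ (exist good J0 g0) R.
- by move=> t; apply/asboolP.
- by move=> a b c /asboolP ab /asboolP bc; apply/asboolP => x /ab/bc.
- have [[a0 Aa0]|nA] := pselect (exists a, A a); last first.
    by exists (exist good J0 g0) => s As; case: nA; exists s.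
  pose U x := exists2 a, A a & sval a x.
  have cmp a b x y : A a -> A b -> sval a x -> sval b y -> exists2 c, A c & sval c x /\ sval c y.
    move=> Aa Ab ax bby; have [/asboolP ab|/asboolP ba] := Atot a b Aa Ab.
      by exists b => //; split=> //; apply: ab.
    by exists a => //; split=> //; apply: ba.
  have gU : good U.
    split.
    - split.
      + by exists a0 => //; have [[]] := svalP a0.
      + move=> x y [a Aa ax] [b Ab bby]; have [c Ac [cx cy]] := cmp _ _ _ _ Aa Ab ax bby.
        by exists c => //; have [[_ cD _] _ _ _] := svalP c; apply: cD.
      + by move=> k x [a Aa ax]; exists a => //; have [[_ _ aZ] _ _ _] := svalP a; apply: aZ.
    - move=> x y [a Aa ax] [b Ab bby]; have [c Ac [cx cy]] := cmp _ _ _ _ Aa Ab ax bby.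
      by exists c => //; have [_ cM _ _] := svalP c; apply: cM.
    - by move=> [a _]; have [_ _ a1 _] := svalP a.
    - by move=> x J0x; exists a0 => //; have [_ _ _] := svalP a0; apply.
  by exists (exist good U gU) => s As; apply/asboolP => x sx; exists s.
exists J; split=> // J' J's J'M J'1 JJ'.
have gJ' : good J' by split=> // x /JJ/JJ'.
by have /asboolP := Jmax (exist good J' gJ') (introT (asboolP _) JJ').
Qed.

Definition over (J : L -> Prop) (p : {poly L}) := forall j, J p`_j.

Lemma over_subspaceD J p q : subspace J -> over J p -> over J q -> over J (p + q).
Proof. by case=> _ JD _ Jp Jq j; rewrite coefD; apply: JD. Qed.

Lemma overM J p q : subspace J -> mul_closed J -> over J p -> over J q -> over J (p * q).
Proof. move=> Js JM Jp Jq j; rewrite coefM; apply: (@subspace_sum _ _ iota J) => // i _; exact: JM (Jp _) (Jq _). Qed.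

(* The exchange argument behind Chevalley's theorem: if [1 = p(x) = r(1/x)] with coefficients
   in [J], the leading term of the longer relation can be removed with the other one. *)
Lemma nonunital_inverse_relations J (x : L) (p r : {poly L}) : subspace J -> mul_closed J ->
  ~ J 1 -> x != 0 -> over J p -> over J r -> p.[x] = 1 -> r.[x^-1] = 1 -> False.
Proof.
move=> Js JM J1; have [N] := ubnP (size p + size r); elim: N x p r => // N IHN x p r.
wlog le_rp : x p r / (size r <= size p)%N.
  move=> W sN x0 Jp Jr px rx; case: (leqP (size r) (size p)) => [le|/ltnW le].
    exact: (W x p r).
  by apply: (W x^-1 r p) => //; rewrite ?invr_eq0 ?invrK // addnC.
move=> sN x0 Jp Jr px rx.
have [JZ JD _] := Js.
case: (leqP (size r) 1) => [|r1].
  move=> /size1_polyC rE; apply: J1.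
  by rewrite -rx rE hornerC; apply: Jr.
pose n := (size p).-1; pose m := (size r).-1.
have mn : (m <= n)%N by rewrite /m /n -!subn1 leq_sub2r.
have pn : size p = n.+1 by rewrite prednK //; apply: leq_trans le_rp; apply: ltnW.
have rm : size r = m.+1 by rewrite prednK //; apply: ltnW.
have m0 : (0 < m)%N by rewrite -ltnS -rm.
pose g := \poly_(i < m) r`_(m - i).
have gx : (1 - r`_0) * x ^+ m = g.[x].
  rewrite horner_poly.
  have : r.[x^-1] * x ^+ m = x ^+ m by rewrite rx mul1r.
  rewrite horner_coef rm big_ord_recl expr0 mulr1 mulrDl mulr_suml => E.
  rewrite mulrBl mul1r -{1}E addrC addKr.
  rewrite (reindex_inj rev_ord_inj) /=; apply: eq_bigr => i _.
  have im := ltn_ord i.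
  have -> : bump 0 (m - i.+1) = (m - i)%N by rewrite /bump; lia.
  rewrite -mulrA; congr (_ * _).
  have -> : x ^+ m = x ^+ (m - i) * x ^+ i by rewrite -exprD subnK // ltnW.
  by rewrite exprVn mulKf // expf_neq0.
have Jg : over J g.
  by move=> j; rewrite coef_poly; case: ifP => // _; apply: Jr.
pose p0 := \poly_(i < n) p`_i.
have Jp0 : over J p0 by move=> j; rewrite coef_poly; case: ifP => // _; apply: Jp.
have pE : p = p0 + p`_n *: 'X^n.
  apply/polyP => j; rewrite coefD coefZ coefXn coef_poly.
  case: (ltngtP j n) => [_|jn|->]; rewrite ?mulr0 ?mulr1 ?addr0 ?add0r //.
  by rewrite nth_default // pn.
pose q := (r`_0)%:P + ((p0 - r`_0 *: p0) + p`_n *: ('X^(n - m) * g)).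
have Jq : over J q.
  apply: over_subspaceD => //; first by move=> j; rewrite coefC; case: ifP => // _; apply: Jr.
  apply: over_subspaceD => //.
    by move=> j; rewrite coefB coefZ; apply: subspaceB => //; apply: JM; [apply: Jr|apply: Jp0].
  by move=> j; rewrite coefZ coefXnM; apply: JM; [apply: Jp|case: ifP].
have sq : (size q <= n)%N.
  apply/leq_sizeP => j nj; rewrite !(coefD, coefN, coefZ, coefXnM, coef_poly, coefC).
  have n0 : (0 < n)%N by apply: leq_trans mn.
  rewrite (gtn_eqF (leq_trans n0 nj)) ltnNge nj /= mulr0 oppr0 !add0r.
  by case: ifP => _; rewrite ?mulr0 //; case: ifP => //; rewrite ?mulr0 //; lia.
apply: (IHN x q r) => //; first by lia.
rewrite !(hornerD, hornerN, hornerZ, hornerM, hornerXn, hornerC) -gx.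
have -> : x ^+ (n - m) * ((1 - r`_0) * x ^+ m) = (1 - r`_0) * x ^+ n.
  by rewrite mulrCA -exprD subnK.
have := px; rewrite {1}pE hornerD hornerZ hornerXn => E.
transitivity (r`_0 + (1 - r`_0) * (p0.[x] + p`_n * x ^+ n)); first by ring.
by rewrite E; ring.
Qed.

Record valuation_ring (O : L -> Prop) := ValuationRing {
  vr_const : forall k, O (iota k);
  vrD : forall x y, O x -> O y -> O (x + y);
  vrM : forall x y, O x -> O y -> O (x * y);
  vr_total : forall x, O x \/ O x^-1 }.

Definition nonunit (O : L -> Prop) x := x = 0 \/ ~ O x^-1.

Lemma chevalley (J0 : L -> Prop) : subspace J0 -> mul_closed J0 -> ~ J0 1 ->
  exists O, valuation_ring O /\ forall x, J0 x -> nonunit O x.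
Proof.
move=> J0s J0M J01; have [J [Js JM J1 J0J Jmax]] := exists_maximal_nonunital J0s J0M J01.
have [Jz JD JZ] := Js.
exists (fun x => forall j, J j -> J (x * j)); split; last first.
  move=> x /J0J Jx; have [->|/eqP x0] := eqVneq x 0; first by left.
  by right=> /(_ x Jx); rewrite mulVf //; apply/eqP.
have adjoin x : ~ (exists2 p, over J p & p.[x] = 1) -> forall j, J j -> J (x * j).
  move=> nx j Jj; pose J' y := exists2 p, over J p & y = p.[x].
  have J's : subspace J'.
    split; first by exists 0; rewrite ?horner0 // => i; rewrite coef0.
      move=> _ _ [p Jp ->] [q Jq ->]; exists (p + q); rewrite ?hornerD //.
      exact: over_subspaceD.
    move=> k _ [p Jp ->]; exists (iota k *: p); rewrite ?hornerZ // => i.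
    by rewrite coefZ; apply: JZ.
  have J'M : mul_closed J'.
    by move=> _ _ [p Jp ->] [q Jq ->]; exists (p * q); rewrite ?hornerM //; apply: overM.
  apply: (Jmax J') => //.
  - by move=> [p Jp p1]; apply: nx; exists p.
  - by move=> y Jy; exists y%:P; rewrite ?hornerC // => i; rewrite coefC; case: ifP.
  exists (j *: 'X); rewrite ?hornerZ ?hornerX 1?mulrC // => i.
  by rewrite coefZ coefX; case: (i == 1); rewrite ?mulr1 ?mulr0.
split.
- by move=> k j; apply: JZ.
- by move=> x y Ox Oy j Jj; rewrite mulrDl; apply: JD; auto.
- by move=> x y Ox Oy j Jj; rewrite -mulrA; auto.
move=> x; have [->|x0] := eqVneq x 0; first by left=> j _; rewrite mul0r.
have [[p Jp px]|] := pselect (exists2 p, over J p & p.[x] = 1); last by move/adjoin; left.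
right; apply: adjoin => -[r Jr rx].
exact: (nonunital_inverse_relations Js JM J1 x0 Jp Jr px rx).
Qed.

Section ValuationRing.
Variables (O : L -> Prop) (Ov : valuation_ring O).
Let m := nonunit O.

Lemma vr1 : O 1. Proof. by rewrite -(rmorph1 iota); apply: vr_const. Qed.
Lemma vr0 : O 0. Proof. by rewrite -(rmorph0 iota); apply: vr_const. Qed.
Lemma vrN x : O x -> O (- x).
Proof.
by move=> Ox; rewrite -mulN1r -(rmorph1 iota) -rmorphN; apply: vrM => //; apply: vr_const.
Qed.

Lemma vrX x n : O x -> O (x ^+ n).
Proof. by move=> Ox; elim: n => [|n IHn]; [exact: vr1|rewrite exprS; apply: vrM]. Qed.

Lemma nonunit_vr x : m x -> O x.
Proof. by case=> [->|nx]; [exact: vr0|have [] := vr_total Ov x]. Qed.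

Lemma nonunit1 : ~ m 1.
Proof. by case=> [/eqP|]; [rewrite oner_eq0|rewrite invr1; apply; exact: vr1]. Qed.

Lemma nonunitM a x : O a -> m x -> m (a * x).
Proof.
move=> Oa [->|nx]; first by left; rewrite mulr0.
have [->|a0] := eqVneq a 0; first by left; rewrite mul0r.
right=> Oax; apply: nx.
have -> : x^-1 = a * (a * x)^-1 by rewrite invfM mulVKf.
exact: vrM.
Qed.

Lemma nonunitD x y : m x -> m y -> m (x + y).
Proof.
have W u v : u != 0 -> v != 0 -> O (u / v) -> m v -> m (u + v).
  move=> u0 v0 Ouv mv.
  have -> : u + v = (u / v + 1) * v by rewrite mulrDl divfK ?mul1r.
  by apply: nonunitM => //; apply: vrD => //; exact: vr1.
have [->|x0] := eqVneq x 0; first by rewrite add0r.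
have [->|y0] := eqVneq y 0; first by rewrite addr0.
move=> mx my; have [Oxy|] := vr_total Ov (x / y); first exact: W.
by rewrite invf_div => Oyx; rewrite addrC; apply: W.
Qed.

Lemma nonunit_subspace : subspace m.
Proof.
split; [by left|exact: nonunitD|move=> k x; apply: nonunitM; exact: vr_const].
Qed.

Lemma nonunit_const k : m (iota k) -> k = 0.
Proof.
move=> mk; apply/eqP/negPn/negP => k0; apply: nonunit1.
by rewrite -(rmorph1 iota) -(mulVf k0) rmorphM; apply: nonunitM => //; apply: vr_const.
Qed.

Lemma nonunitV x : x != 0 -> m x \/ O x^-1.
Proof. by move=> x0; have [Ox|] := pselect (O x^-1); [right|left; right]. Qed.

Lemma exists_min_value (I : eqType) (g : I -> L) (s : seq I) : (exists i, i \in s) ->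
  (forall i, i \in s -> g i != 0) ->
  exists2 i, i \in s & forall j, j \in s -> O (g j / g i).
Proof.
case=> i0; elim: s i0 => // i s IHs _ _ g0.
have Oii j : g j != 0 -> O (g j / g j) by move=> /divff->; exact: vr1.
have gs j : j \in s -> g j != 0 by move=> js; apply: g0; rewrite inE js orbT.
case: s IHs gs g0 => [_ _ g0|j0 s IHs gs g0].
  by exists i => [|j]; rewrite inE // => /eqP->; apply/Oii/g0/mem_head.
have [j js Oj] := IHs j0 (mem_head _ _) gs.
have [Oij|] := vr_total Ov (g i / g j).
  by exists j => [|k]; rewrite inE ?js ?orbT // => /orP[/eqP->//|/Oj].
rewrite invf_div => Oji; exists i => [|k]; first exact: mem_head.
rewrite inE => /orP[/eqP->|ks]; first exact/Oii/g0/mem_head.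
have -> : g k / g i = (g k / g j) * (g j / g i).
  by rewrite mulrA divfK // gs.
by apply: vrM => //; apply: Oj.
Qed.
End ValuationRing.
End Chevalley.

(** * Laurent monomials and the lexicographic order *)

Section LexMonomials.
Local Open Scope ring_scope.
Variables (K L : fieldType) (iota : {rmorphism K -> L}).
Local Notation subspace := (subspace iota).
Local Notation Pol := (Pol iota).
Local Notation Frac := (Frac iota).
Local Notation alg_indep := (alg_indep iota).
Local Notation valuation_ring := (valuation_ring iota).

Definition mon (y : seq L) (a : nat -> int) := \prod_(i < size y) y`_i ^ a i.

Definition lexpos d (a : nat -> int) :=
  exists2 i, (i < d)%N & 0 < a i /\ forall j, (j < i)%N -> a j = 0.

Lemma lexpos_total d a : lexpos d a \/ lexpos d (fun i => - a i) \/ forall i, (i < d)%N -> a i = 0.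
Proof.
have [H|] := pselect (exists i, (i < d)%N && (a i != 0)); last first.
  move=> H; right; right=> i id; apply/eqP/negPn/negP => ai; apply: H; exists i.
  by rewrite id.
case: (ex_minnP H) => i /andP[id ai] imin.
have a0 j : (j < i)%N -> a j = 0.
  move=> ji; apply/eqP/negPn/negP => aj.
  by have := imin j; rewrite (ltn_trans ji id) aj leqNgt ji => /(_ isT).
case: (ltgtP 0 (a i)) => [ap|an|E]; last by rewrite -E eqxx in ai.
  by left; exists i.
by right; left; exists i => //; rewrite oppr_gt0; split=> // j /a0 ->; rewrite oppr0.
Qed.

Lemma lexposD d a b : lexpos d a -> lexpos d b -> lexpos d (fun i => a i + b i).
Proof.
move=> [i id [ai aj]] [k kd [bk bj]]; case: (ltngtP i k) => ik.
- exists i => //; rewrite (bj _ ik) addr0; split=> // j ji.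
  by rewrite aj // bj ?addr0 // (ltn_trans ji).
- exists k => //; rewrite (aj _ ik) add0r; split=> // j jk.
  by rewrite bj // aj ?addr0 // (ltn_trans jk).
exists k => //; rewrite -{1}ik; split; first by rewrite addr_gt0 // -ik.
by move=> j jk; rewrite aj ?ik // bj // addr0.
Qed.

Lemma mon_cons z y a : mon (z :: y) a = z ^ a 0 * mon y (fun i => a i.+1).
Proof. by rewrite /mon big_ord_recl. Qed.

Lemma eq_mon y a b : (forall i, (i < size y)%N -> a i = b i) -> mon y a = mon y b.
Proof. by move=> ab; apply: eq_bigr => i _; rewrite ab. Qed.

Lemma mon0 y : mon y (fun=> 0) = 1.
Proof. by rewrite /mon big1. Qed.

Lemma monN y a : mon y (fun i => - a i) = (mon y a)^-1.
Proof. by rewrite /mon -prodfV; apply: eq_bigr => i _; rewrite -invr_expz. Qed.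

Lemma mon_expz y a (n : int) : mon y (fun i => n * a i) = mon y a ^ n.
Proof.
elim: y a => [|z y IHy] a; first by rewrite /mon !big_ord0 exp1rz.
by rewrite !mon_cons IHy expfzMl exprzAC exprz_exp mulrC.
Qed.

Section Monomials.
Variable y : seq L.
Hypothesis yi : alg_indep y.

Lemma alg_indep_neq0 i : (i < size y)%N -> y`_i != 0.
Proof.
elim: y yi i => // z y' IHy [y'i tz] [|i] /=; last exact: IHy.
move=> _; apply/eqP => z0; have : 'X = 0 :> {poly L}.
  apply: tz; last by rewrite hornerX.
  move=> j; rewrite coefX -[_%:R](rmorph_nat iota).
  by apply: (@Frac_Pol _ _ _ _ 0); apply: Pol_const.
by move/eqP; rewrite polyX_eq0.
Qed.

Lemma mon_neq0 a : mon y a != 0.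
Proof. by apply/prodf_neq0 => i _; rewrite expfz_neq0 // alg_indep_neq0. Qed.

Lemma monD a b : mon y (fun i => a i + b i) = mon y a * mon y b.
Proof.
rewrite /mon -big_split; apply: eq_bigr => i _.
by rewrite expfzDr // alg_indep_neq0.
Qed.

Lemma monB a b : mon y (fun i => a i - b i) = mon y a / mon y b.
Proof. by rewrite monD monN. Qed.
End Monomials.

Lemma Frac_mon y a : Frac y (mon y a).
Proof.
rewrite /mon; elim/big_ind: _ => [||i _]; last first.
- by apply: FracXz; apply: (@Frac_Pol _ _ _ _ 1); apply: Pol_mem; apply: mem_nth.
- exact: FracM.
by rewrite -(rmorph1 iota); apply: (@Frac_Pol _ _ _ _ 0); apply: Pol_const.
Qed.

Inductive lexspan (y : seq L) : L -> Prop :=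
| lexspan0 : lexspan y 0
| lexspan_add k a x : lexpos (size y) a -> lexspan y x -> lexspan y (iota k * mon y a + x).

Lemma lexspan_subspace y : subspace (lexspan y).
Proof.
split; first exact: lexspan0.
  move=> x z; elim=> [|k a {}x la _ IH] lz; first by rewrite add0r.
  by rewrite -addrA; apply: lexspan_add la (IH lz).
move=> k x; elim=> [|l a {}x la _ IH]; first by rewrite mulr0; apply: lexspan0.
by rewrite mulrDr mulrA -rmorphM; apply: lexspan_add la IH.
Qed.

Lemma lexspan_mul_closed y : alg_indep y -> mul_closed (lexspan y).
Proof.
move=> yi x z lx; have [_ D _] := lexspan_subspace y.
elim: lx => [|k a {}x la _ IH] lz; first by rewrite mul0r; apply: lexspan0.
rewrite mulrDl; apply: D (IH lz).
elim: lz {IH x} => [|l b z' lb _ IH]; first by rewrite mulr0; apply: lexspan0.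
rewrite mulrDr mulrACA -rmorphM -monD //.
by apply: lexspan_add IH; apply: lexposD.
Qed.

Lemma lexspan_mon y a : lexpos (size y) a -> lexspan y (mon y a).
Proof.
move=> la; rewrite -[mon y a]addr0 -[mon y a]mul1r -(rmorph1 iota).
exact: lexspan_add la (lexspan0 _).
Qed.

Lemma lexspan_cons z y x : lexspan (z :: y) x ->
  exists p : {poly L}, [/\ forall j, Frac y p`_j, lexspan y p`_0 & x = p.[z]].
Proof.
have [F0 FD _] := Frac_subspace iota y; have [_ SD SZ] := lexspan_subspace y.
elim=> [|k a {}x la _ [p [Fp Sp ->]]].
  by exists 0; rewrite horner0 coef0; split=> // [j|]; [rewrite coef0|apply: lexspan0].
pose b i := a i.+1; rewrite mon_cons -/b.
have Fkb : Frac y (iota k * mon y b).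
  by apply: FracM; [apply: (@Frac_Pol _ _ _ _ 0); apply: Pol_const|apply: Frac_mon].
have a0 : 0 <= a 0%N.
  by case: la => -[_ [/ltW]|i _ [_ /(_ 0%N isT) ->]].
exists ((iota k * mon y b) *: 'X^(`|a 0%N|) + p); split.
- move=> j; rewrite coefD coefZ coefXn; case: (j == _); rewrite ?mulr1 ?mulr0 ?add0r.
    exact: FD Fkb (Fp j).
  exact: Fp.
- rewrite coefD coefZ coefXn; case: eqP => [E|_]; last by rewrite mulr0 add0r.
  rewrite mulr1; apply: lexspan_add Sp.
  case: la E => -[|i]; first by move=> _ [+ _] /esym/eqP; rewrite absz_eq0 => + /eqP a00; rewrite a00.
  rewrite ltnS => iy [ai aj] _; exists i => //; split=> // j ji; exact: aj.
rewrite hornerD hornerZ hornerXn; congr (_ + _).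
by case: (a 0%N) a0 => // n _; rewrite mulrA mulrAC.
Qed.

Lemma lexspan1 y : alg_indep y -> ~ lexspan y 1.
Proof.
elim: y => [_|z y IHy [yi tz]] /=.
  suff H x : lexspan [::] x -> x = 0 by move/H/eqP; rewrite oner_eq0.
  by elim=> // k a {}x [].
move=> /lexspan_cons[p [Fp Sp px]]; apply: IHy => //.
have [F0 FD _] := Frac_subspace iota y.
have := tz (p - 1); rewrite hornerD hornerN hornerC -px subrr => /(_ _ erefl) p1.
suff -> : 1 = p`_0 by [].
have /eqP : p - 1 = 0.
  apply: p1 => j; rewrite coefB; apply: (subspaceB (Frac_subspace iota y) (Fp j)).
  rewrite coef1 -[_%:R](rmorph_nat iota).
  by apply: (@Frac_Pol _ _ _ _ 0); apply: Pol_const.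
by rewrite subr_eq0 => /eqP->; rewrite coef1.
Qed.

Lemma exists_lex_valuation y : alg_indep y ->
  exists O, valuation_ring O /\ forall a, lexpos (size y) a -> nonunit O (mon y a).
Proof.
move=> yi; have [O [Ov OJ]] := chevalley (lexspan_subspace y) (lexspan_mul_closed yi) (lexspan1 yi).
by exists O; split=> // a /lexspan_mon/OJ.
Qed.

Lemma Pol_mon_nat s y (a : nat -> int) (n : nat) : {subset y <= s} ->
  (forall i, (i < size y)%N -> 0 <= a i <= n%:Z) -> Pol s (size y * n) (mon y a).
Proof.
elim: y a => [|z y IHy] a ys an.
  by rewrite /mon big_ord0 -(rmorph1 iota); apply: Pol_const.
rewrite mon_cons mulSn; apply: PolM.
  have := an 0%N isT; case: (a 0%N) => // k /andP[_ kn].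
  apply: (@Pol_leq _ _ _ _ k) => //.
  by rewrite -[k in Pol s k _]muln1; apply/PolX/Pol_mem/ys/mem_head.
apply: IHy => [t ty|i iy]; last exact: an.
by apply: ys; rewrite inE ty orbT.
Qed.
End LexMonomials.

(** * Values and residues *)

Section ValuedBases.
Local Open Scope ring_scope.
Variables (K L : fieldType) (iota : {rmorphism K -> L}).
Local Notation subspace := (subspace iota).
Local Notation Pol := (Pol iota).
Local Notation Frac := (Frac iota).
Local Notation alg_indep := (alg_indep iota).
Local Notation indep := (indep iota).
Local Notation spanned := (spanned iota).
Local Notation valuation_ring := (valuation_ring iota).

Section Abhyankar.
Variables (s y : seq L) (M : nat) (O : L -> Prop).
Hypotheses (ys : {subset y <= s}) (yi : alg_indep y).
Let d := size y.
Hypothesis HM : forall n, spanned (Pol s n) (M * n.+1 ^ d).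
Hypothesis Ov : valuation_ring O.
Hypothesis Oy : forall a, lexpos d a -> nonunit O (mon y a).
Let m := nonunit O.
Let bound := (M * d.+1 ^ d)%N.

Definition vunit u := [/\ u != 0, O u & O u^-1].

Lemma vunitM u v : vunit u -> vunit v -> vunit (u * v).
Proof.
by move=> [u0 Ou OuV] [v0 Ovv OvV]; split; rewrite ?mulf_neq0 // ?invfM; apply: (vrM Ov).
Qed.

Lemma vunitV u : vunit u -> vunit u^-1.
Proof. by case=> u0 Ou OuV; split; rewrite ?invr_eq0 ?invrK. Qed.

Lemma vunitX u n : vunit u -> vunit (u ^+ n).
Proof.
by move=> [u0 Ou OuV]; split; rewrite ?expf_neq0 // -?exprVn; apply: (vrX Ov).
Qed.

Lemma vunit1 : vunit 1.
Proof. by split; rewrite ?oner_eq0 // ?invr1; apply: (vr1 Ov). Qed.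

Lemma nonunit_or_vunit u : O u -> m u \/ vunit u.
Proof.
by move=> Ou; have [->|u0] := eqVneq u 0; [left; left|have [] := nonunitV O u0; [left|right]].
Qed.

Lemma vunit_nonunit u : vunit u -> ~ m u.
Proof. by move=> [u0 _ OuV] [u00|]; [rewrite u00 eqxx in u0|]. Qed.

Lemma vunit_mon a : vunit (mon y a) -> forall i, (i < d)%N -> a i = 0.
Proof.
move=> ua; have [/Oy/vunit_nonunit[]//|[/Oy ma|//]] := lexpos_total d a.
by case: (@vunit_nonunit (mon y a)^-1); [exact: vunitV|rewrite -monN].
Qed.

Lemma vunit_mon0 a : (forall i, (i < d)%N -> a i = 0) -> vunit (mon y a).
Proof. by move/eq_mon->; rewrite mon0; apply: vunit1. Qed.

Lemma sum_distinct_values (A : finType) (P : pred A) (g w : A -> L) :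
  (forall i, P i -> g i != 0) -> (forall i, P i -> O (w i)) ->
  (forall i j, P i -> P j -> vunit (g i / g j) -> i = j) ->
  \sum_(i | P i) g i * w i = 0 -> (exists i, P i) -> exists2 i, P i & m (w i).
Proof.
move=> g0 Ow gne sum0 [i0 Pi0].
have [||i] := @exists_min_value _ _ iota O Ov A g (enum P).
- by exists i0; rewrite mem_enum.
- by move=> i; rewrite mem_enum; apply: g0.
rewrite mem_enum => Pi imin; exists i => //.
move: sum0; rewrite (bigD1 i) //= => /(congr1 (fun x => - x / g i)).
rewrite oppr0 mul0r opprD mulrBl mulNr mulrAC divff ?g0 // mul1r mulr_suml.
move=> /eqP; rewrite subr_eq0 => /eqP/(congr1 -%R); rewrite opprK => ->.
apply: (subspaceN (nonunit_subspace Ov)).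
apply: (@subspace_sum _ _ iota m) => [|j]; first exact: nonunit_subspace.
move=> /andP[Pj ji].
rewrite mulrAC mulrC; apply: (nonunitM Ov (Ow j Pj)).
have Oji : O (g j / g i) by apply: imin; rewrite mem_enum.
have [//|/(gne _ _ Pj Pi)/eqP] := nonunit_or_vunit Oji.
by rewrite (negPf ji).
Qed.

Lemma leading_monomial (J T : finType) (e : T -> nat -> int) (c : J -> T -> K) :
  (forall t t', (forall i, (i < d)%N -> e t i = e t' i) -> t = t') ->
  (exists j t, c j t <> 0) ->
  exists t0, (exists j, c j t0 <> 0) /\ forall j, exists u, m u /\
    \sum_t iota (c j t) * mon y (e t) = mon y (e t0) * (iota (c j t0) + u).
Proof.
move=> einj [j0 [t1 /eqP c0]].
have [||t0] := @exists_min_value _ _ iota O Ov T (fun t => mon y (e t)) (enum [pred t | [exists j, c j t != 0]]).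
- by exists t1; rewrite mem_enum inE; apply/existsP; exists j0.
- by move=> t _; apply: (mon_neq0 yi).
rewrite mem_enum inE => /existsP[j /eqP cj] tmin; exists t0; split; first by exists j.
move=> {cj} j1; exists (\sum_(t | t != t0) iota (c j1 t) * (mon y (e t) / mon y (e t0))); split.
  apply: (@subspace_sum _ _ iota m) => [|t tt0]; first exact: nonunit_subspace.
  have [->|cjt] := eqVneq (c j1 t) 0; first by left; rewrite rmorph0 mul0r.
  apply: (nonunitM Ov); first exact: vr_const.
  have Ot : O (mon y (e t) / mon y (e t0)).
    by apply: tmin; rewrite mem_enum inE; apply/existsP; exists j1.
  have [//|] := nonunit_or_vunit Ot; rewrite -(monB yi) => /vunit_mon E.
  by case/eqP: tt0; apply: einj => i /E/eqP; rewrite subr_eq0 => /eqP.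
rewrite (bigD1 t0) //= mulrDr mulrC; congr (_ + _).
rewrite mulr_sumr; apply: eq_bigr => t _.
by rewrite mulrCA; congr (_ * _); rewrite mulrCA divff ?mulr1 // (mon_neq0 yi).
Qed.

Definition box_exp t (b : {ffun 'I_d -> 'I_t}) (i : nat) : int :=
  if insub i is Some j then (b j : nat)%:Z else 0.

Lemma box_expE t (b : {ffun 'I_d -> 'I_t}) i (id : (i < d)%N) :
  box_exp b i = (b (Ordinal id) : nat)%:Z.
Proof. by rewrite /box_exp insubT. Qed.

Lemma box_exp_inj t (b b' : {ffun 'I_d -> 'I_t}) :
  (forall i, (i < d)%N -> box_exp b i = box_exp b' i) -> b = b'.
Proof.
move=> E; apply/ffunP => -[i id]; have := E i id; rewrite !box_expE => -[]; exact: val_inj.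
Qed.

Lemma box_mon_relation (I : finType) (x : I -> L) : (forall i, Frac s (x i)) ->
  (bound < #|I|)%N -> exists t (c : I -> {ffun 'I_d -> 'I_t} -> K),
    (exists i b, c i b <> 0) /\
    \sum_i x i * (\sum_b iota (c i b) * mon y (box_exp b)) = 0.
Proof.
move=> Fx ltI; have [n [q [Pq q0 Pqx]]] := common_denominator Fx; exists n.+1.
pose v (p : I * {ffun 'I_d -> 'I_n.+1}) := q * x p.1 * mon y (box_exp p.2).
have Pv p : Pol s (n + d * n) (v p).
  apply: PolM; first exact: Pqx.
  apply: Pol_mon_nat => // i id; rewrite box_expE lez_nat /=.
  by rewrite -ltnS ltn_ord.
have nv : ~ indep v.
  move=> /(steinitz (HM (n + d * n)) Pv).
  rewrite card_prod card_ffun !card_ord leqNgt => /negP; apply.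
  apply: (@leq_ltn_trans (bound * n.+1 ^ d)).
    rewrite -mulnA leq_mul2l -expnMn; apply/orP; right.
    by case: (posnP d) => [->//|d0]; rewrite leq_exp2r //; lia.
  by rewrite ltn_pmul2r // expn_gt0.
move/existsNP: nv => [c /not_implyP[c0 /existsNP[[i b] cib]]].
exists (fun i b => c (i, b)); split; first by exists i, b.
apply: (mulfI q0); rewrite mulr0 -[RHS]c0 mulr_sumr.
transitivity (\sum_i \sum_b iota (c (i, b)) * v (i, b)); last first.
  by rewrite pair_bigA /=; apply: eq_bigr => -[].
apply: eq_bigr => j _; rewrite !mulr_sumr; apply: eq_bigr => b' _.
by rewrite /v /=; ring.
Qed.

Definition res_indep (I : finType) (u : I -> L) :=
  forall c : I -> K, m (\sum_i iota (c i) * u i) -> forall i, c i = 0.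

Lemma res_indep_bound (I : finType) (u : I -> L) : (forall i, O (u i)) ->
  (forall i, Frac s (u i)) -> res_indep u -> (#|I| <= bound)%N.
Proof.
move=> Ou Fu ui; rewrite leqNgt; apply/negP => /(box_mon_relation Fu)[t [c [cn0 c0]]].
have [b [[i cib] /choice[w wE]]] := leading_monomial (@box_exp_inj t) cn0.
apply: cib; apply: (ui (fun i => c i b)).
have -> : \sum_i iota (c i b) * u i = \sum_i (- u i) * w i.
  apply: (mulfI (mon_neq0 yi (box_exp b))); apply/eqP; rewrite -subr_eq0; apply/eqP.
  rewrite -mulrBr -sumrB mulr_sumr -[RHS]c0; apply: eq_bigr => j _.
  by have [_ ->] := wE j; ring.
apply: (@subspace_sum _ _ iota m) => [|j _]; first exact: nonunit_subspace.
by apply: (nonunitM Ov); [apply: (vrN Ov)|have [] := wE j].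
Qed.

Lemma value_torsion x : Frac s x -> x != 0 ->
  exists l a, [/\ (0 < l)%N, (l <= bound)%N & vunit (x ^+ l / mon y a)].
Proof.
move=> Fx x0; pose X (i : 'I_bound.+1) := x ^+ i.
have [|t [c [[i0 [b0 /eqP cib]] c0]]] := @box_mon_relation _ X (fun i => FracX i Fx).
  by rewrite card_ord.
pose P i := [exists b, c i b != 0].
have /choice[p pE] : forall i, exists p : {ffun 'I_d -> 'I_t} * L, P i -> [/\ c i p.1 <> 0, m p.2 &
    \sum_b iota (c i b) * mon y (box_exp b) = mon y (box_exp p.1) * (iota (c i p.1) + p.2)].
  move=> i; have [/existsP[b /eqP cb]|nP] := boolP (P i); last by exists (b0, 0).
  have [|b1 [[_ c1] /(_ tt)[u [mu uE]]]] := @leading_monomial _ _ (@box_exp t) (fun (_ : unit) => c i) (@box_exp_inj t).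
    by exists tt, b.
  by exists (b1, u).
pose g i := X i * mon y (box_exp (p i).1).
pose w i := iota (c i (p i).1) + (p i).2.
have [//|H] := pselect (exists l a, [/\ (0 < l)%N, (l <= bound)%N & vunit (x ^+ l / mon y a)]).
have gE (i j : 'I_bound.+1) : (j < i)%N -> ~ vunit (g i / g j).
  move=> ji ug; apply: H; exists (i - j)%N, (fun k => box_exp (p j).1 k - box_exp (p i).1 k).
  split; rewrite ?subn_gt0 //; first by rewrite (leq_trans (leq_subr _ _)) // -ltnS.
  rewrite (monB yi) invf_div.
  have -> // : x ^+ (i - j) * (mon y (box_exp (p i).1) / mon y (box_exp (p j).1)) = g i / g j.
  rewrite /g /X invfM mulrACA; congr (_ * _).
  by rewrite -[in RHS](subnK (ltnW ji)) exprD mulfK // expf_neq0.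
have [|||||i Pi] := @sum_distinct_values _ P g w.
- by move=> i _; rewrite mulf_neq0 ?expf_neq0 // (mon_neq0 yi).
- move=> i /pE[_ mp _]; apply: (vrD Ov); first exact: vr_const.
  exact: (nonunit_vr Ov).
- move=> i j _ _ ug; case: (ltngtP i j) => [ij|ij|/val_inj //].
    by case: (gE _ _ ij); rewrite -invf_div; apply: vunitV.
  by case: (gE _ _ ij).
- rewrite -[RHS]c0 [RHS](bigID P) /= [X in _ + X]big1 ?addr0.
    by apply: eq_bigr => i /pE[_ _ ->]; rewrite /g mulrA.
  move=> i; rewrite negb_exists => /forallP nc; rewrite big1 ?mulr0 // => b _.
  by have := nc b; rewrite negbK => /eqP->; rewrite rmorph0 mul0r.
- by exists i0; apply/existsP; exists b0.
have [ci mp _] := pE _ Pi; rewrite /w => mw; case: ci.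
apply: (nonunit_const Ov); rewrite -[iota _](addrK (p i).2).
exact: (subspaceB (nonunit_subspace Ov)).
Qed.

Lemma value_exponent x : Frac s x -> x != 0 -> exists a, vunit (x ^+ bound`! / mon y a).
Proof.
move=> Fx /(value_torsion Fx)[l [a [l0 lb u]]].
have /dvdnP[k kE] : (l %| bound`!)%N by apply: dvdn_fact; rewrite l0.
exists (fun i => k%:Z * a i); rewrite mon_expz kE mulnC exprM -exprnP.
by rewrite -expr_div_n; apply: vunitX.
Qed.

(* Since [q = 1] modulo the exponent of the value group modulo the lattice of the
   monomial values, the values [q v(e) + r] with [0 <= r < q] determine [v(e)] and [r]. *)
Lemma power_values_distinct e e' (r r' : nat -> int) k :
  let q := (bound`! * k).+1 in
  Frac s e -> Frac s e' -> e != 0 -> e' != 0 ->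
  (forall i, (i < d)%N -> `|r i - r' i| < q%:Z) ->
  vunit (e ^+ q * mon y r / (e' ^+ q * mon y r')) ->
  vunit (e / e') /\ forall i, (i < d)%N -> r i = r' i.
Proof.
move=> q Fe Fe' e0 e'0 rr' u.
have x0 : e / e' != 0 by rewrite mulf_neq0 ?invr_eq0.
have [a ua] := value_exponent (FracM Fe (FracV Fe')) x0.
set x := e / e' in x0 ua *.
pose c i := r i - r' i.
have u1 : vunit (x ^+ q * mon y c).
  by rewrite (monB yi) expr_div_n mulf_div.
clearbody x.
have q0 : (0 < q)%N by [].
pose g i := - (c i) - k%:Z * a i.
have u2 : vunit (x / mon y g).
  have -> : x / mon y g = (x ^+ q * mon y c) * ((x ^+ bound`! / mon y a) ^+ k)^-1.
    rewrite /g (monB yi) monN mon_expz -exprnP /q exprS exprM expr_div_n.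
    have C0 := mon_neq0 yi c.
    have A0 : mon y a ^+ k != 0 by rewrite expf_neq0 // (mon_neq0 yi).
    have X0 : (x ^+ bound`!) ^+ k != 0 by rewrite !expf_neq0.
    move: (mon y a ^+ k) (mon y c) ((x ^+ bound`!) ^+ k) A0 C0 X0 => A D X A0 D0 X0.
    by field; rewrite ?A0 ?D0 ?X0 oner_eq0.
  by apply: (vunitM u1); apply/vunitV/vunitX.
have cg : forall i, (i < d)%N -> q%:Z * g i + c i = 0.
  apply: vunit_mon; rewrite (monD yi) mon_expz -exprnP.
  have -> : mon y g ^+ q * mon y c = (x ^+ q * mon y c) * ((x / mon y g) ^+ q)^-1.
    rewrite expr_div_n invfM invrK.
    have : x ^+ q != 0 by rewrite expf_neq0.
    by move: (x ^+ q) (mon y g ^+ q) (mon y c) => X G C X0; field.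
  by apply: (vunitM u1); apply/vunitV/vunitX.
have g0 i : (i < d)%N -> g i = 0.
  move=> id; have E := cg i id; have R := rr' i id; rewrite -/(c i) in R.
  apply/eqP/negPn/negP => gi.
  have : q%:Z <= `|c i|.
    have -> : c i = - (q%:Z * g i) by apply/eqP; rewrite -addr_eq0 addrC E.
    rewrite normrN normrM ler_peMr //.
    by rewrite -gtz0_ge1 normr_gt0.
  by rewrite leNgt R.
split.
  rewrite -[x](divfK (mon_neq0 yi g)); apply: (vunitM u2); exact: vunit_mon0.
move=> i id; have := cg i id; rewrite g0 // mulr0 add0r => /eqP.
by rewrite subr_eq0 => /eqP.
Qed.

Lemma exists_residue_basis : exists f (u : 'I_f -> L),
  [/\ forall i, O (u i), forall i, Frac s (u i), res_indep u &
    forall (I : finType) (u' : I -> L), (forall i, O (u' i)) -> (forall i, Frac s (u' i)) ->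
      res_indep u' -> (#|I| <= f)%N].
Proof.
pose Q f := `[< exists u : 'I_f -> L, [/\ forall i, O (u i), forall i, Frac s (u i) & res_indep u] >].
have exQ : exists f, Q f.
  by exists 0%N; apply/asboolP; exists (fun=> 0); split=> // [[]|[]|c _ []].
have Qb f : Q f -> (f <= bound)%N.
  by move/asboolP => [u [Ou Fu ui]]; have := res_indep_bound Ou Fu ui; rewrite card_ord.
case: (ex_maxnP exQ Qb) => f /asboolP[u [Ou Fu ui]] fmax; exists f, u; split=> //.
move=> I u' Ou' Fu' ui'; apply/fmax/asboolP; exists (fun i => u' (enum_val i)); split=> //.
move=> c mc i; rewrite -[i]enum_valK; apply: (ui' (fun j => c (enum_rank j))).
move: mc; congr m; rewrite [RHS](reindex (@enum_val I xpredT)) /=; last first.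
  by exists enum_rank => z _; rewrite ?enum_valK ?enum_rankK.
by apply: eq_bigr => j _; rewrite enum_valK.
Qed.

Lemma indep_enum_val (I : finType) (v : I -> L) (A : {set I}) :
  (forall c : I -> K, \sum_(i in A) iota (c i) * v i = 0 -> forall i, i \in A -> c i = 0) ->
  indep (fun i : 'I_#|A| => v (enum_val i)).
Proof.
move=> vi c; case: (posnP #|A|) => [A0 _ i|A0 c0 i].
  by have : (i < 0)%N by rewrite -A0 ltn_ord.
have [a aA] : exists a, a \in A by apply/set0Pn; rewrite -card_gt0.
rewrite -[i](enum_valK_in aA); apply: (vi (fun j => c (enum_rank_in aA j))); last exact: enum_valP.
rewrite -[RHS]c0 big_enum_val /=; apply: eq_bigr => j _.
by rewrite enum_valK_in.
Qed.

Lemma res_indep_enum_val (I : finType) (v : I -> L) (A : {set I}) :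
  (forall c : I -> K, m (\sum_(i in A) iota (c i) * v i) -> forall i, i \in A -> c i = 0) ->
  res_indep (fun i : 'I_#|A| => v (enum_val i)).
Proof.
move=> vi c; case: (posnP #|A|) => [A0 _ i|A0 c0 i].
  by have : (i < 0)%N by rewrite -A0 ltn_ord.
have [a aA] : exists a, a \in A by apply/set0Pn; rewrite -card_gt0.
rewrite -[i](enum_valK_in aA); apply: (vi (fun j => c (enum_rank_in aA j))); last exact: enum_valP.
have -> // : \sum_(j in A) iota (c (enum_rank_in aA j)) * v j =
    \sum_j iota (c j) * v (enum_val j).
by rewrite big_enum_val; apply: eq_bigr => j _; rewrite enum_valK_in.
Qed.

Lemma leq_dim_values f (V : L -> Prop) n (v : 'I_n -> L) :
  (forall (I : finType) (u : I -> L), (forall i, O (u i)) -> (forall i, Frac s (u i)) ->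
      res_indep u -> (#|I| <= f)%N) ->
  subspace V -> (forall x, V x -> Frac s x) -> (forall i, V (v i)) -> indep v ->
  exists e : seq L, [/\ forall i, (i < size e)%N -> V e`_i /\ e`_i != 0,
    forall i j, (i < j)%N -> (j < size e)%N -> m (e`_j / e`_i) & (n <= f * size e)%N].
Proof.
move=> fmax; have [N] := ubnP n; elim: N n V v => // N IHN n V v nN Vs VF Vv vi.
case: (posnP n) => [->|n0]; first by exists [::].
have v0 i : v i != 0.
  apply/eqP => vi0; have /eqP : (1 : K) = 0; last by rewrite oner_eq0.
  rewrite -(vi (fun j => (j == i)%:R) _ i) ?eqxx // (bigD1 i) //= vi0 mulr0 add0r.
  by rewrite big1 // => j /negPf ->; rewrite rmorph0 mul0r.
have [||i0 _ imin] := @exists_min_value _ _ iota O Ov _ v (enum 'I_n).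
- by exists (Ordinal n0); rewrite mem_enum.
- by move=> i _; apply: v0.
have {}imin i : O (v i / v i0) by apply: imin; rewrite mem_enum.
pose ri (A : {set 'I_n}) := `[< forall c : 'I_n -> K,
  m (\sum_(i in A) iota (c i) * (v i / v i0)) -> forall i, i \in A -> c i = 0 >].
have ri0 : ri [set i0].
  apply/asboolP => c; rewrite big_set1 divff // mulr1 => /(nonunit_const Ov) c0 i.
  by rewrite inE => /eqP->.
case: (@arg_maxnP _ [set i0] ri (fun A => #|A|) ri0) => T /asboolP riT Tmax.
have T0 : (0 < #|T|)%N by apply: leq_trans (Tmax _ ri0); rewrite cards1.
have Tf : (#|T| <= f)%N.
  have := fmax _ (fun i : 'I_#|T| => v (enum_val i) / v i0); rewrite card_ord; apply.
  - by move=> i; apply: imin.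
  - by move=> i; apply: FracM; [apply/VF/Vv|apply/FracV/VF/Vv].
  exact: (@res_indep_enum_val _ (fun i => v i / v i0)).
have /choice[a aP] : forall i, exists a : 'I_n -> K, i \notin T ->
    m ((v i + \sum_(j in T) iota (a j) * v j) / v i0).
  move=> i; have [iT|iT] := boolP (i \in T); first by exists (fun=> 0).
  have : ~~ ri (i |: T).
    by apply/negP => /Tmax; rewrite cardsU1 iT /= ltnn.
  move/asboolP/existsNP => [c /not_implyP[mc /existsNP[j /not_implyP[jT /eqP cj]]]].
  rewrite big_setU1 //= in mc.
  have ci : c i != 0.
    apply/eqP => ci; move: mc; rewrite ci rmorph0 mul0r add0r => /riT cT.
    by move: jT cj; rewrite !inE => /orP[/eqP->|/cT->]; rewrite ?ci eqxx.
  exists (fun j => c j / c i) => _.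
  have -> : (v i + \sum_(j in T) iota (c j / c i) * v j) / v i0 =
      iota (c i)^-1 * (iota (c i) * (v i / v i0) + \sum_(j in T) iota (c j) * (v j / v i0)).
    rewrite mulrDr mulrA -rmorphM mulVf // rmorph1 mul1r mulrDl; congr (_ + _).
    rewrite mulr_sumr mulr_suml; apply: eq_bigr => k _.
    by rewrite rmorphM mulrA mulrA (mulrC (iota (c k))).
  apply: (nonunitM Ov) => //; exact: vr_const.
pose V' x := V x /\ m (x / v i0).
have [VZ VD VS] := Vs.
have V's : subspace V'.
  split; first by split=> //; left; rewrite mul0r.
    move=> x z [Vx mx] [Vz mz]; split; first exact: VD.
    by rewrite mulrDl; apply: (nonunitD Ov).
  move=> k x [Vx mx]; split; first exact: VS.
  by rewrite -mulrA; apply: (nonunitM Ov) => //; apply: vr_const.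
pose w i := v i + \sum_(j in T) iota (a i j) * v j.
have cT : (#|~: T| + #|T| = n)%N by rewrite addnC cardsC card_ord.
have [|||||e [eV em ne]] := IHN #|~: T| V' (fun i => w (enum_val i)).
- have : (#|~: T| < #|~: T| + #|T|)%N by rewrite -{1}[#|~: T|]addn0 ltn_add2l.
  by rewrite cT => /leq_trans; apply; rewrite -ltnS.
- exact: V's.
- by move=> x [/VF].
- move=> i; have := enum_valP i; rewrite inE => iT; split; last exact: aP.
  apply: VD; first exact: Vv.
  by apply: (@subspace_sum _ _ iota V) => // j _; apply: VS; apply: Vv.
- apply: (@indep_enum_val _ w) => c.
  rewrite /w; under eq_bigr do rewrite mulrDr.
  rewrite big_split /=; under [X in _ + X]eq_bigr do rewrite mulr_sumr.
  rewrite exchange_big /= => c0.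
  pose b i := if i \in T then \sum_(j in ~: T) c j * a j i else c i.
  have b0 : \sum_i iota (b i) * v i = 0.
    rewrite -[RHS]c0 (bigID (fun i => i \in ~: T)) /=; congr (_ + _).
      by apply: eq_bigr => i; rewrite inE /b => /negPf ->.
    rewrite (eq_bigl (fun i => i \in T)); last by move=> i; rewrite inE negbK.
    apply: eq_bigr => i iT; rewrite /b iT rmorph_sum mulr_suml.
    by apply: eq_bigr => j _; rewrite rmorphM mulrA.
  by move=> i; rewrite inE => iT; have := vi b b0 i; rewrite /b (negPf iT).
exists (v i0 :: e); split.
- by case=> [_|i ie] //=; have [[]] := eV i ie.
- case=> [|i] [|j] //= ij je; last exact: em.
  by have [[_]] := eV j je.
by rewrite /= mulnS -cT addnC leq_add.
Qed.
End Abhyankar.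

(* The count [q^d h] is what remains of the semigroup structure of an Okounkov body: the
   products [e^q y^r u] have pairwise distinct values for distinct [(e, r)], and the residues
   of the [u] are independent. *)
Theorem power_products_indep (s : seq L) : exists d M N c0, [/\ (0 < N)%N,
  forall n, spanned (Pol s n) (M * n.+1 ^ d) &
  forall p (V : L -> Prop) h (v : 'I_h -> L) q c, subspace V -> (forall x, V x -> Pol s p x) ->
    (forall i, V (v i)) -> indep v -> (c0 <= c)%N -> (exists k, q = (N * k).+1) ->
    exists (I : finType) (e w : I -> L), [/\ (q ^ d * h <= #|I|)%N, forall i, V (e i),
      forall i, Pol s (q * d + c) (w i) & indep (fun i => e i ^+ q * w i)]].
Proof.
have [y [ys yi [M HM]]] := growth iota s.
have [O [Ov Oy]] := exists_lex_valuation yi.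
have [f [u [Ou Fu ui fmax]]] := exists_residue_basis ys yi HM Ov Oy.
have [c0 [D [PD D0 Pu]]] := common_denominator Fu.
exists (size y), M, (M * (size y).+1 ^ size y)`!, c0; split=> //; first exact: fact_gt0.
move=> p V h v q c Vs VP Vv vi c0c [k qE].
have VF x : V x -> Frac s x by move/VP/Frac_Pol.
have [e [eV em he]] := leq_dim_values Ov fmax Vs VF Vv vi.
pose r (b : {ffun 'I_(size y) -> 'I_q}) := mon y (box_exp b).
pose I := (('I_(size e) * {ffun 'I_(size y) -> 'I_q}) * 'I_f)%type.
exists (I : finType), (fun i : I => e`_i.1.1), (fun i : I => r i.1.2 * (D * u i.2)); split.
- by rewrite !card_prod card_ffun !card_ord (mulnC (size e)) -mulnA leq_mul2l (mulnC _ f) he orbT.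
- by move=> i; have [] := eV i.1.1 (ltn_ord _).
- move=> i; apply: PolM; last exact: Pol_leq (Pu _).
  rewrite mulnC; apply: Pol_mon_nat => // j jy; rewrite box_expE lez_nat /=.
  exact/ltnW/ltn_ord.
have e0 (i : 'I_(size e)) : e`_i != 0 by have [] := eV i (ltn_ord _).
move=> a a0 [[i b] j].
pose g (t : 'I_(size e) * {ffun 'I_(size y) -> 'I_q}) := e`_t.1 ^+ q * r t.2.
pose w t := \sum_l iota (a (t, l)) * u l.
apply: contrapT => /eqP aij.
have [|||||t /existsP[l at0] /ui] := @sum_distinct_values O Ov _ (fun t => [exists l, a (t, l) != 0]) g w.
- by move=> t _; rewrite mulf_neq0 ?expf_neq0 // (mon_neq0 yi).
- move=> t _; rewrite /w; elim/big_ind: _ => [||l _]; first exact: (vr0 Ov).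
    exact: (vrD Ov).
  by apply: (vrM Ov) => //; apply: vr_const.
- move=> [i1 b1] [i2 b2] _ _ ug.
  have [i1i2 b1b2] : vunit O (e`_i1 / e`_i2) /\ forall t, (t < size y)%N -> box_exp b1 t = box_exp b2 t.
    apply: (power_values_distinct ys yi HM Ov Oy (k := k)); rewrite -?qE //.
    - by have [/VF] := eV i1 (ltn_ord _).
    - by have [/VF] := eV i2 (ltn_ord _).
    move=> t ty; rewrite !box_expE; have := ltn_ord (b1 (Ordinal ty)).
    have := ltn_ord (b2 (Ordinal ty)); rewrite ltr_norml => lt2 lt1.
    move: lt1 lt2; move: (b1 _ : nat) (b2 _ : nat) => r1 r2 lt1 lt2.
    by apply/andP; split; lia.
  rewrite (box_exp_inj b1b2); congr (_, _); apply/val_inj.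
  case: (ltngtP i1 i2) => // ij.
    case: (vunit_nonunit (vunitV i1i2)); rewrite invf_div; exact: em.
  by case: (vunit_nonunit i1i2); apply: em.
- pose G t l := iota (a (t, l)) * (e`_t.1 ^+ q * (r t.2 * (D * u l))).
  have G0 : \sum_t \sum_l G t l = 0.
    by rewrite pair_bigA -[RHS]a0; apply: eq_bigr => -[].
  transitivity (D^-1 * \sum_t \sum_l G t l); last by rewrite G0 mulr0.
  rewrite big_mkcond /= mulr_sumr; apply: eq_bigr => t _.
  rewrite mulr_sumr; case: ifP => [_|].
    by rewrite mulr_sumr; apply: eq_bigr => l _; rewrite /G /g; field.
  move=> /negbT; rewrite negb_exists => /forallP at0; rewrite big1 ?mulr0 // => l _.
  by have := at0 l; rewrite negbK /G => /eqP->; rewrite rmorph0 mul0r.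
- by exists (i, b); apply/existsP; exists j.
by move=> /(_ l)/eqP; rewrite (negPf at0).
Qed.
End ValuedBases.

(** * Graded domains generated in degree one *)

Section FractionField.
Local Open Scope ring_scope.

Section Inverse.
Variables (A : comNzRingType).
Hypothesis Adom : forall a b : A, a * b = 0 -> a = 0 \/ b = 0.

Definition classical_unit : pred A := fun x => `[< exists y, y * x = 1 >].
Definition classical_inv (x : A) : A :=
  if pselect (exists y, y * x = 1) is left e then projT1 (cid e) else x.

Lemma classical_mulVx : {in classical_unit, left_inverse 1 classical_inv *%R}.
Proof.
move=> x /asboolP ux; rewrite /classical_inv; case: pselect => // e.
by case: (cid e).
Qed.

Lemma classical_unitPl x y : y * x = 1 -> classical_unit x.
Proof. by move=> yx; apply/asboolP; exists y. Qed.

Lemma classical_invr_out : {in [predC classical_unit], classical_inv =1 id}.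
Proof.
move=> x; rewrite inE /= => /asboolP nx; rewrite /classical_inv.
by case: pselect.
Qed.

Lemma classical_integral (x y : A) : x * y = 0 -> (x == 0) || (y == 0).
Proof. by case/Adom=> ->; rewrite eqxx ?orbT. Qed.

Lemma embeds_in_field : exists (L : fieldType) (tau : {rmorphism A -> L}), injective tau.
Proof.
pose U := GRing.ComNzRing_hasMulInverse.Build A classical_mulVx classical_unitPl classical_invr_out.
pose AU : comUnitRingType := HB.pack (GRing.ComNzRing.sort A) U.
pose AI : idomainType := HB.pack (GRing.ComUnitRing.sort AU) (GRing.ComUnitRing_isIntegral.Build AU classical_integral).
exists ({fraction AI} : fieldType), (@tofrac AI : {rmorphism _ -> _}).
by move=> x y /eqP; rewrite tofrac_eq => /eqP.
Qed.
End Inverse.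
End FractionField.

Section Graded.
Local Open Scope ring_scope.
Variables (K : fieldType) (B : comAlgType K) (Bn : nat -> B -> Prop).
Hypotheses (Bdom : integral_domain B) (Bgr : graded Bn).

Lemma in_subalg_sub (S T : B -> Prop) x : (forall y, S y -> T y) -> in_subalg S x -> in_subalg T x.
Proof.
move=> ST; elim=> {x} [x /ST| |x y _ Sx _ Sy|x y _ Sx _ Sy|k x _ Sx].
- exact: sa_gen.
- exact: sa_one.
- exact: sa_add.
- exact: sa_mul.
exact: sa_scale.
Qed.

Lemma in_subalg_trans (S T : B -> Prop) x : (forall y, S y -> in_subalg T y) ->
  in_subalg S x -> in_subalg T x.
Proof.
move=> ST; elim=> {x} [x /ST//| |x y _ Sx _ Sy|x y _ Sx _ Sy|k x _ Sx].
- exact: sa_one.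
- exact: sa_add.
- exact: sa_mul.
exact: sa_scale.
Qed.

Lemma in_subalg_finite (S : B -> Prop) x : in_subalg S x ->
  exists2 l : seq B, (forall y, y \in l -> S y) & in_subalg (fun y => y \in l) x.
Proof.
have catS l l' y (T : B -> Prop) : (forall z, z \in l -> T z) -> (forall z, z \in l' -> T z) ->
    y \in l ++ l' -> T y.
  by move=> Tl Tl'; rewrite mem_cat => /orP[/Tl|/Tl'].
elim=> {x} [x Sx| |x y _ [l lS lx] _ [l' lS' ly]|x y _ [l lS lx] _ [l' lS' ly]|k x _ [l lS lx]].
- exists [:: x] => [y|]; first by rewrite inE => /eqP->.
  by apply: sa_gen; rewrite inE.
- by exists [::] => //; apply: sa_one.
- exists (l ++ l') => [z|]; first exact: catS.
  by apply: sa_add; [apply: in_subalg_sub lx|apply: in_subalg_sub ly] => z zl; rewrite mem_cat zl ?orbT.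
- exists (l ++ l') => [z|]; first exact: catS.
  by apply: sa_mul; [apply: in_subalg_sub lx|apply: in_subalg_sub ly] => z zl; rewrite mem_cat zl ?orbT.
by exists l => //; apply: sa_scale.
Qed.

Lemma finite_homogeneous_generators : finite_type B -> generated_by (Bn 1%N) ->
  exists2 l : seq B, (forall y, y \in l -> Bn 1%N y) & forall x, in_subalg (fun y => y \in l) x.
Proof.
move=> [s gs] g1.
suff [l l1 ls] : exists2 l : seq B, (forall y, y \in l -> Bn 1%N y) &
    forall x, x \in s -> in_subalg (fun y => y \in l) x.
  by exists l => // x; apply: in_subalg_trans (gs x).
elim: s {gs} => [|a s [l l1 ls]]; first by exists [::].
have [l' l'1 l'a] := in_subalg_finite (g1 a).
exists (l' ++ l) => [y|x]; first by rewrite mem_cat => /orP[/l'1|/l1].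
rewrite inE => /orP[/eqP->|/ls lx].
  by apply: in_subalg_sub l'a => z zl; rewrite mem_cat zl.
by apply: in_subalg_sub lx => z zl; rewrite mem_cat zl orbT.
Qed.

Lemma degree1_nonzero : generated_by (Bn 1%N) -> krull_dim_pos B -> exists2 x, Bn 1%N x & x != 0.
Proof.
move=> g1 [p [q [[[p0 _] _] [[[_ [_ qM]] [q1 _]] [_ [x [qx px]]]]]]].
apply: contrapT => H.
have const (y : B) : exists k : K, y = k%:A.
  elim: (g1 y) => {y} [y y1| |y z _ [k ->] _ [l ->]|y z _ [k ->] _ [l ->]|k y _ [l ->]].
  - exists 0; rewrite scale0r; apply/eqP/negPn/negP => y0; apply: H; by exists y.
  - by exists 1; rewrite scale1r.
  - by exists (k + l); rewrite scalerDl.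
  - by exists (k * l); rewrite -scalerAl mul1r scalerA.
  - by exists (k * l); rewrite scalerA.
have [k xk] := const x; have [k0|k0] := eqVneq k 0.
  by apply: px; rewrite xk k0 scale0r.
apply: q1; have -> : 1 = k^-1%:A * x by rewrite xk -scalerAl mul1r scalerA mulVf // scale1r.
exact: qM.
Qed.

Lemma graded_sum n (I : Type) (r : seq I) (P : pred I) (c : I -> B) :
  (forall i, P i -> Bn n (c i)) -> Bn n (\sum_(i <- r | P i) c i).
Proof.
by have [/(_ n)[B0 [BD _]] _] := Bgr => Pc; elim/big_ind: _.
Qed.

Fixpoint Hom (l : seq B) (n : nat) (b : B) : Prop :=
  if n is n'.+1 then exists2 c : nat -> B, (forall i, Hom l n' (c i)) & b = \sum_(i < size l) l`_i * c i
  else exists k : K, b = k%:A.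

Section Homogeneous.
Variable l : seq B.
Hypotheses (l1 : forall y, y \in l -> Bn 1%N y) (lgen : forall x, in_subalg (fun y => y \in l) x).

Lemma Hom_subspace n : is_subspace (Hom l n).
Proof.
elim: n => [|n [H0 [HD HZ]]].
  split; first by exists 0; rewrite scale0r.
  split=> [_ _ [k ->] [m ->]|k _ [m ->]]; first by exists (k + m); rewrite scalerDl.
  by exists (k * m); rewrite scalerA.
split; first by exists (fun=> 0) => //; rewrite big1 // => i _; rewrite mulr0.
split=> [_ _ [c Hc ->] [e He ->]|k _ [c Hc ->]].
  exists (fun i => c i + e i) => [i|]; first exact: HD (Hc i) (He i).
  by rewrite -big_split; apply: eq_bigr => i _; rewrite mulrDr.
exists (fun i => k *: c i) => [i|]; first exact: HZ (Hc i).
by rewrite scaler_sumr; apply: eq_bigr => i _; rewrite scalerAr.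
Qed.

Lemma HomSl n x b : x \in l -> Hom l n b -> Hom l n.+1 (x * b).
Proof.
move=> xl Hb; exists (fun i => if i == index x l then b else 0) => [i|].
  by case: eqP => // _; have [] := Hom_subspace n.
have il : (index x l < size l)%N by rewrite index_mem.
rewrite (bigD1 (Ordinal il)) //= eqxx nth_index // big1 ?addr0 // => i /eqP ni.
by case: eqP => [E|_]; rewrite ?mulr0 //; case: ni; apply: val_inj.
Qed.

Lemma HomM n m a b : Hom l n a -> Hom l m b -> Hom l (n + m) (a * b).
Proof.
elim: n a => [|n IHn] a /=.
  by move=> [k ->] Hb; rewrite -scalerAl mul1r; have [_ [_]] := Hom_subspace m; apply.
move=> [c Hc ->] Hb; exists (fun i => c i * b) => [i|]; first exact: IHn.
by rewrite mulr_suml; apply: eq_bigr => i _; rewrite mulrA.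
Qed.

Lemma Hom_Bn n b : Hom l n b -> Bn n b.
Proof.
have [Bs [BM [B1 _]]] := Bgr.
elim: n b => [|n IHn] b /=; first by move=> [k ->]; have [_ [_]] := Bs 0%N; apply.
move=> [c Hc ->]; apply: graded_sum => i _; rewrite -add1n; apply: BM; last exact: IHn.
by apply: l1; apply: mem_nth.
Qed.

Lemma Bn_Hom n b : Bn n b -> Hom l n b.
Proof.
pose S x := exists (N : nat) (c : nat -> B), (forall i, Hom l i (c i)) /\ x = \sum_(i < N) c i.
have S1 i x : Hom l i x -> S x.
  move=> Hx; exists i.+1, (fun j => if j == i then x else 0); split=> [j|].
    by case: eqP => [->//|_]; have [] := Hom_subspace j.
  by rewrite big_ord_recr /= eqxx big1 ?add0r // => j _; rewrite ltn_eqF.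
have S0 : S 0 by exists 0%N, (fun=> 0); split=> [i|]; [have [] := Hom_subspace i|rewrite big_ord0].
have SD x y : S x -> S y -> S (x + y).
  move=> [N [c [Hc ->]]] [M [e [He ->]]].
  exists (maxn N M), (fun i => (if (i < N)%N then c i else 0) + (if (i < M)%N then e i else 0)); split.
    move=> i; have [H0 [HD _]] := Hom_subspace i; apply: HD; by case: ifP.
  rewrite big_split /= -!big_mkcond /=; congr (_ + _).
    rewrite (big_ord_widen_cond (maxn N M) xpredT c) ?leq_maxl //; exact: eq_bigl.
  rewrite (big_ord_widen_cond (maxn N M) xpredT e) ?leq_maxr //; exact: eq_bigl.
have Ssum (I : Type) (r : seq I) (F : I -> B) : (forall i, S (F i)) -> S (\sum_(i <- r) F i).
  by move=> SF; elim/big_ind: _.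
have Sall x : S x.
  elim: (lgen x) => {x} [x xl| |x y _ Sx _ Sy|x y _ [N [c [Hc ->]]] _ [M [e [He ->]]]|k x _ [N [c [Hc ->]]]].
  - apply: (S1 1%N); rewrite -[x]mulr1; apply: HomSl => //; by exists 1; rewrite scale1r.
  - by apply: (S1 0%N); exists 1; rewrite scale1r.
  - exact: SD.
  - rewrite mulr_suml; apply: (Ssum) => i; rewrite mulr_sumr; apply: Ssum => j.
    exact/S1/HomM.
  rewrite scaler_sumr; apply: Ssum => i; apply: (S1 i).
  by have [_ [_]] := Hom_subspace i; apply.
move=> Bb; have [N [c [Hc bE]]] := Sall b.
have [Bs [_ [_ [_ Buniq]]]] := Bgr.
pose c' i := (if (i < N)%N then c i else 0) - (if i == n then b else 0).
have Bc' i : Bn i (c' i).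
  have [B0 [BD BZ]] := Bs i; rewrite /c' -scaleN1r; apply: BD.
    by case: ifP => // _; apply: Hom_Bn.
  by apply: BZ; case: eqP => // ->.
have sum0 : \sum_(i < maxn N n.+1) c' i = 0.
  rewrite sumrB -!big_mkcond /= [X in _ - X](_ : _ = b).
    rewrite -(big_ord_widen_cond (maxn N n.+1) xpredT c) ?leq_maxl // -bE.
    exact: subrr.
  by rewrite (big_pred1 (Ordinal (leq_maxr N n.+1))).
have := Buniq _ _ Bc' sum0 n (leq_maxr _ _); rewrite /c' eqxx => /eqP; rewrite subr_eq0 => /eqP <-.
by case: ifP => // _; have [] := Hom_subspace n.
Qed.

Lemma Bn_mul_ind m n (P : B -> Prop) : P 0 -> (forall x y, P x -> P y -> P (x + y)) ->
  (forall a b, Bn m a -> Bn n b -> P (a * b)) -> forall x, Bn (m + n) x -> P x.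
Proof.
move=> P0 PD; elim: m P P0 PD => [|m IHm] P P0 PD PM x.
  by move=> Bx; rewrite -[x]mul1r; apply: PM Bx; have [_ [_ []]] := Bgr.
move/Bn_Hom => [c Hc ->].
elim/big_ind: _ => // i _; move: (c i) (Hom_Bn (Hc i)) => y; apply: (IHm (fun y => P (l`_i * y))).
- by rewrite mulr0.
- by move=> u v; rewrite mulrDr; apply: PD.
move=> a b Ba Bb; rewrite mulrA; apply: PM => //.
have [_ [BM _]] := Bgr; rewrite -add1n; apply: BM => //; exact/l1/mem_nth.
Qed.

Section Embedding.
Variables (L : fieldType) (tau : {rmorphism B -> L}).
Hypothesis tau_inj : injective tau.
Variable x0 : B.
Hypotheses (x0l : Bn 1%N x0) (x00 : x0 != 0).
Let t0 := tau x0.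
Let iota : {rmorphism K -> L} := tau \o in_alg B.

Lemma t0_neq0 n : t0 ^+ n != 0.
Proof. by rewrite expf_neq0 // -(rmorph0 tau) (inj_eq tau_inj). Qed.

Lemma tauZ k b : tau (k *: b) = iota k * tau b.
Proof. by rewrite /= -rmorphM -scalerAl mul1r. Qed.

Lemma BnX n k b : Bn n b -> Bn (k * n) (b ^+ k).
Proof.
have [_ [BM [B1 _]]] := Bgr; move=> Bb; elim: k => [|k IHk]; first by rewrite expr0.
by rewrite exprS mulSn; apply: BM.
Qed.

Definition dehom := [seq tau x / t0 | x <- l].

Lemma Bn_Pol n b : Bn n b -> Pol iota dehom n (tau b / t0 ^+ n).
Proof.
move/Bn_Hom; elim: n b => [|n IHn] b /=.
  move=> [k ->]; rewrite expr0 divr1 tauZ rmorph1 mulr1; exact: Pol_const.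
move=> [c Hc ->]; rewrite rmorph_sum mulr_suml.
apply: (@subspace_sum _ _ iota) => [|i _]; first exact: Pol_subspace.
rewrite rmorphM exprS invfM mulrACA -add1n; apply: PolM; last exact: IHn.
apply: Pol_mem; apply: (map_f (fun x => tau x / t0)); exact: mem_nth.
Qed.

Lemma Pol_Bn n p : Pol iota dehom n p -> exists2 b, Bn n b & tau b = t0 ^+ n * p.
Proof.
have [Bs [BM [B1 _]]] := Bgr.
rewrite /dehom; elim: l l1 n p => [|x s IHs] s1 n p /=.
  move=> [k ->]; exists (k *: x0 ^+ n).
    by have [_ [_ BZ]] := Bs n; apply: BZ; rewrite -[n in Bn n _]muln1; apply: BnX.
  by rewrite tauZ rmorphXn mulrC.
move=> [P [sP SP] ->].
have /choice[b bP] : forall j, exists b, (j <= n)%N -> Bn (n - j) b /\ tau b = t0 ^+ (n - j) * P`_j.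
  move=> j; have [jn|nj] := boolP (j <= n)%N; last by exists 0.
  have [|b Bb bE] := IHs _ _ _ (SP j jn); last by exists b.
  by move=> y ys; apply: s1; rewrite inE ys orbT.
exists (\sum_(j < n.+1) b j * x ^+ j).
  apply: graded_sum => j _; have jn : (j <= n)%N by rewrite -ltnS.
  have Bxj : Bn j (x ^+ j) by rewrite -[X in Bn X _]muln1; apply/BnX/s1/mem_head.
  by have [Bb _] := bP j jn; have := BM _ _ _ _ Bb Bxj; rewrite subnK.
rewrite (horner_coef_wide _ sP) rmorph_sum mulr_sumr; apply: eq_bigr => j _.
have jn : (j <= n)%N by rewrite -ltnS.
have [_ bE] := bP j jn; rewrite rmorphM rmorphXn bE expr_div_n.
rewrite [t0 ^+ n](_ : _ = t0 ^+ (n - j) * t0 ^+ j); last by rewrite -exprD subnK.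
by have := t0_neq0 j; move: (t0 ^+ j) => T T0; field.
Qed.

Lemma lin_indepP (vs : seq B) : lin_indep vs <-> indep iota (fun i : 'I_(size vs) => tau vs`_i).
Proof.
split=> [vi c c0 i|vi ks sks ks0 i ivs].
  pose f j := if insub j is Some j' then c j' else 0.
  have fE (j : 'I_(size vs)) : f j = c j by rewrite /f valK.
  have := vi (mkseq f (size vs)) (size_mkseq _ _) _ i (ltn_ord i).
  rewrite nth_mkseq // fE; apply; apply: tau_inj; rewrite rmorph0 -[RHS]c0 rmorph_sum.
  by apply: eq_bigr => j _; rewrite nth_mkseq // fE tauZ.
apply: (vi (fun i => ks`_i) _ (Ordinal ivs)).
transitivity (tau (\sum_(i0 < size vs) ks`_i0 *: vs`_i0)); last by rewrite ks0 rmorph0.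
by rewrite rmorph_sum; apply: eq_bigr => j _; rewrite tauZ.
Qed.

Lemma has_dim_spanned (V : B -> Prop) h a : has_dim V h ->
  spanned iota (fun x => exists2 v, V v & x = tau v * a) h.
Proof.
move=> [_ [vs [<- [_ [_ gen]]]]]; exists (fun i => tau vs`_i * a) => _ [v /gen[ks ->] ->].
exists (fun i => ks`_i); rewrite rmorph_sum mulr_suml.
by apply: eq_bigr => j _; rewrite tauZ mulrA.
Qed.

Lemma lin_indep_bound n M (vs : seq B) : spanned iota (Pol iota dehom n) M ->
  (forall i, (i < size vs)%N -> Bn n vs`_i) -> lin_indep vs -> (size vs <= M)%N.
Proof.
move=> sM vB /lin_indepP vi.
have := @steinitz _ _ iota _ _ _ (fun i : 'I_(size vs) => tau vs`_i / t0 ^+ n) sM.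
rewrite card_ord; apply=> [i|c c0 i]; first exact/Bn_Pol/vB.
apply: vi i; apply: (mulIf (invr_neq0 (t0_neq0 n))); rewrite mul0r mulr_suml -[RHS]c0.
by apply: eq_bigr => j _; rewrite mulrA.
Qed.

Lemma size_lin_indep_leq_dim (V : B -> Prop) h (vs : seq B) : has_dim V h ->
  (forall i, (i < size vs)%N -> V vs`_i) -> lin_indep vs -> (size vs <= h)%N.
Proof.
move=> /(has_dim_spanned 1) sV vV /lin_indepP vi.
have := steinitz sV _ vi; rewrite card_ord; apply=> i.
by exists vs`_i; rewrite ?mulr1 //; apply: vV.
Qed.
End Embedding.
End Homogeneous.

Lemma lin_indep_max_spans (V : B -> Prop) (vs : seq B) x : is_subspace V -> lin_indep vs ->
  ~ lin_indep (x :: vs) -> exists ks : seq K, x = \sum_(i < size vs) ks`_i *: vs`_i.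
Proof.
move=> Vs vi /existsNP[ks /not_implyP[sks /not_implyP[ks0 nks]]].
case: ks sks ks0 nks => // k ks /= [sks]; rewrite big_ord_recl /= => ks0 nks.
have [k0|k0] := eqVneq k 0; last first.
  exists [seq - k^-1 * a | a <- ks]; apply: (scalerI k0); rewrite scaler_sumr.
  have /eqP := ks0; rewrite addr_eq0 => /eqP->; rewrite -sumrN; apply: eq_bigr => i _.
  by rewrite (nth_map 0) ?sks // scalerA mulrA mulrN mulfV // mulN1r scaleNr.
case: nks => -[_ //|i]; rewrite ltnS => ivs; apply: (vi ks sks) => //.
by move: ks0; rewrite k0 scale0r add0r.
Qed.

Section FiniteType.
Hypotheses (ft : finite_type B) (g1 : generated_by (Bn 1%N)) (kd : krull_dim_pos B).

Lemma leq_dim (V : B -> Prop) h (vs : seq B) : has_dim V h ->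
  (forall i, (i < size vs)%N -> V vs`_i) -> lin_indep vs -> (size vs <= h)%N.
Proof.
have [L [tau tau_inj]] := embeds_in_field Bdom.2.
exact: (size_lin_indep_leq_dim tau_inj).
Qed.

Lemma graded_mul_ind m n (P : B -> Prop) : P 0 -> (forall x y, P x -> P y -> P (x + y)) ->
  (forall a b, Bn m a -> Bn n b -> P (a * b)) -> forall x, Bn (m + n) x -> P x.
Proof.
by have [l l1 lg] := finite_homogeneous_generators ft g1; apply: (Bn_mul_ind l1 lg).
Qed.

Lemma exists_has_dim n (V : B -> Prop) : is_subspace V -> (forall x, V x -> Bn n x) ->
  exists h, has_dim V h.
Proof.
move=> Vs VB.
have [L [tau tau_inj]] := embeds_in_field Bdom.2.
have [l l1 lg] := finite_homogeneous_generators ft g1.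
have [x0 x01 x00] := degree1_nonzero g1 kd.
have [y [_ _ [M /(_ n) HM]]] := growth (tau \o in_alg B) (dehom l tau x0).
pose Q h := `[< exists vs : seq B, [/\ size vs = h, forall i, (i < size vs)%N -> V vs`_i & lin_indep vs] >].
have exQ : exists h, Q h by exists 0%N; apply/asboolP; exists [::]; split.
have Qb h : Q h -> (h <= M * n.+1 ^ size y)%N.
  move=> /asboolP[vs [<- vV vi]].
  apply: (lin_indep_bound l1 lg tau_inj x00 HM) => // i ivs; exact/VB/vV.
case: (ex_maxnP exQ Qb) => h /asboolP[vs [sv vV vi]] hmax; exists h; split=> //.
exists vs; split=> //; split=> //; split=> // x Vx; apply: (lin_indep_max_spans Vs vi) => xvi.
have : Q h.+1.
  by apply/asboolP; exists (x :: vs); split=> //=; [rewrite sv|case=> // i; exact: vV].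
by move/hmax; rewrite ltnn.
Qed.

Theorem graded_power_growth : exists d M N c0, [/\ (0 < N)%N,
  forall n h, has_dim (Bn n) h -> (h <= M * n.+1 ^ d)%N &
  forall p (V W : B -> Prop) h h' q c, is_subspace V -> (forall x, V x -> Bn p x) ->
    has_dim V h -> has_dim W h' -> (c0 <= c)%N -> (exists k, q = (N * k).+1) ->
    (forall v b, V v -> Bn (q * d + c) b -> W (v ^+ q * b)) -> (q ^ d * h <= h')%N].
Proof.
have [L [tau tau_inj]] := embeds_in_field Bdom.2.
have [l l1 lg] := finite_homogeneous_generators ft g1.
have [x0 x01 x00] := degree1_nonzero g1 kd.
pose iota : {rmorphism K -> L} := tau \o in_alg B.
have t0n n := t0_neq0 tau_inj x00 n.
have [d [M [N [c0 [N0 HM key]]]]] := power_products_indep iota (dehom l tau x0).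
exists d, M, N, c0; split=> // [n h [_ [vs [<- [vB [vi _]]]]]|].
  exact: (lin_indep_bound l1 lg tau_inj x00 (HM n)).
move=> p V W h h' q c [V0 [VD VZ]] VB [_ [vs [sv [vV [/(lin_indepP tau_inj) vi _]]]]] Wh' c0c qN VW.
pose T n x := exists2 v, V v & x = tau v / tau x0 ^+ n.
have Ts : subspace iota (T p).
  split; first by exists 0; rewrite // rmorph0 mul0r.
    move=> _ _ [v Vv ->] [w Vw ->]; exists (v + w); first exact: VD.
    by rewrite rmorphD mulrDl.
  move=> k _ [v Vv ->]; exists (k *: v); first exact: VZ.
  by rewrite (tauZ tau) mulrA.
have [|||I [e [w [leI eV wP ei]]]] := key p (T p) (size vs) (fun i => tau vs`_i / tau x0 ^+ p) q c Ts _ _ _ c0c qN.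
- by move=> _ [v Vv ->]; apply: (Bn_Pol l1 lg); apply: VB.
- by move=> i; exists vs`_i => //; apply: vV.
- move=> a a0; apply: vi; apply: (mulIf (invr_neq0 (t0n p))); rewrite mul0r mulr_suml -[RHS]a0.
  by apply: eq_bigr => j _; rewrite mulrA.
rewrite -sv; apply: leq_trans leI _.
apply: (steinitz (has_dim_spanned tau (1 / tau x0 ^+ (p * q + (q * d + c))) Wh') _ ei) => i.
have [v Vv ->] := eV i.
have [b Bb bE] := Pol_Bn l1 tau_inj x01 x00 (wP i).
exists (v ^+ q * b); first exact: VW.
rewrite rmorphM rmorphXn bE [tau x0 ^+ (p * q + _)]exprD exprM expr_div_n.
have := t0n (q * d + c)%N; have := expf_neq0 q (t0n p).
move: ((tau x0 ^+ p) ^+ q) (tau v ^+ q) (tau x0 ^+ (q * d + c)) => P V' X P0 X0.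
by field; rewrite P0 X0.
Qed.

Lemma has_dim_Bn_gt0 n h : has_dim (Bn n) h -> (0 < h)%N.
Proof.
have [x0 x01 x00] := degree1_nonzero g1 kd.
have [Bs [BM [B1 _]]] := Bgr.
move=> /leq_dim H; apply: (H [:: x0 ^+ n]).
  by case=> // _ /=; rewrite -[X in Bn X _]muln1; exact: BnX.
have x0n : x0 ^+ n <> 0.
  elim: (n) => [|k IHk]; first by rewrite expr0; case: Bdom.
  by rewrite exprS => /(proj2 Bdom)[/eqP|//]; rewrite (negPf x00).
case=> // k [] // _; rewrite big_ord_recl big_ord0 /= addr0 => k0 [|//] _ /=.
apply/eqP/negPn/negP => kn0; apply: x0n.
by rewrite -[_ ^+ n]scale1r -(mulVf kn0) -scalerA k0 scaler0.
Qed.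
End FiniteType.
End Graded.

From Stdlib Require Import Lra Ring Field.

(** * Dimensions of filtration steps *)

Section Filtrations.
Variables (K : fieldType) (B : comAlgType K) (f : nat -> R).
Variables (Bn : nat -> B -> Prop) (F : nat -> R -> B -> Prop).
Hypotheses (Bdom : integral_domain B) (Bgr : graded Bn) (ft : finite_type B).
Hypotheses (g1 : generated_by (Bn 1%N)) (kd : krull_dim_pos B).
Hypothesis Ffil : forall n, (1 <= n)%N -> filtration_on (Bn n) (F n).
Hypothesis Fqf : quasi_filtered f F.
Hypothesis Flim : limsup_lambda_finite Bn F.
Local Open Scope R_scope.

Lemma INRD m n : INR (m + n)%N = INR m + INR n.
Proof. by rewrite -plusE plus_INR. Qed.

Lemma INRM m n : INR (m * n)%N = INR m * INR n.
Proof. by rewrite -multE mult_INR. Qed.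

Lemma leq_INR m n : (m <= n)%N -> INR m <= INR n.
Proof. by move=> /ssrnat.leP; apply: le_INR. Qed.

Lemma INR_gt0 n : (0 < n)%N -> 0 < INR n.
Proof. by move=> /ssrnat.ltP; apply: lt_0_INR. Qed.

Lemma in_span_subspace (V : lmodType K) (S : V -> Prop) : is_subspace (in_span S).
Proof.
split; first by exists [::], [::]; rewrite big_ord0; split=> // i.
split=> [_ _ [vs [ks [vS ->]]] [ws [ls [wS ->]]]|k _ [vs [ks [vS ->]]]]; last first.
  exists vs, [seq (k * a)%R | a <- ks]; split=> //; rewrite scaler_sumr; apply: eq_bigr => i _.
  rewrite scalerA; congr (_ *: _)%R; case: (ltnP i (size ks)) => iks; first by rewrite (nth_map 0%R).
  by rewrite !nth_default ?size_map ?mulr0.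
exists (vs ++ ws), (mkseq (fun i => nth 0%R ks i) (size vs) ++ ls); split.
  move=> i; rewrite size_cat nth_cat => ilt; case: ltnP => ivs; first exact: vS.
  by apply: wS; rewrite ltn_subLR.
rewrite size_cat big_split_ord /=; congr (_ + _)%R; apply: eq_bigr => i _.
  by rewrite !nth_cat size_mkseq ltn_ord nth_mkseq.
by rewrite !nth_cat size_mkseq ltnNge leq_addr /= addKn.
Qed.

Lemma in_span_gen (V : lmodType K) (S : V -> Prop) x : S x -> in_span S x.
Proof.
move=> Sx; exists [:: x], [:: 1%R]; split; first by case.
by rewrite big_ord_recl big_ord0 addr0 scale1r.
Qed.

Lemma in_span_map (S T : B -> Prop) a x : (forall y, S y -> T (a * y)%R) ->
  in_span S x -> in_span T (a * x)%R.
Proof.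
move=> ST [vs [ks [vS ->]]]; rewrite mulr_sumr.
have [T0 [TD TZ]] := in_span_subspace T.
elim/big_ind: _ => // i _; rewrite -scalerAr; apply: TZ; apply: in_span_gen; exact/ST/vS.
Qed.

Lemma prod_set_cons n s (l : seq (nat * R)) a y :
  F n s a -> prod_set F l y -> prod_set F ((n, s) :: l) (a * y)%R.
Proof.
move=> Fa [xs [sxs [xsF ->]]]; exists (a :: xs); split; first by rewrite /= sxs.
by rewrite big_ord_recl; split=> // -[|i] //= il; apply: xsF.
Qed.

Lemma prod_set1 n s a : F n s a -> prod_set F [:: (n, s)] a.
Proof.
by move=> Fa; rewrite -[a]mulr1; apply: prod_set_cons => //; exists [::]; rewrite big_ord0.
Qed.

Lemma Bn_in_span_prod (t : nat -> R) n ns :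
  (forall k x, k \in n :: ns -> Bn k x -> F k (t k) x) -> forall x,
  Bn (sumn (n :: ns)) x -> in_span (prod_set F [seq (k, t k) | k <- n :: ns]) x.
Proof.
elim: ns n => [|m ns IHns] n Ft x.
  by rewrite /= addn0 => Bx; apply/in_span_gen/prod_set1/Ft; rewrite ?mem_head.
have [S0 [SD _]] := in_span_subspace (prod_set F [seq (k, t k) | k <- n :: m :: ns]).
apply: (graded_mul_ind Bgr ft g1 (m := n) (n := sumn (m :: ns)) S0 SD) => a b Ba Bb.
apply: (@in_span_map (prod_set F [seq (k, t k) | k <- m :: ns])).
  by move=> y; apply: prod_set_cons; apply: Ft; rewrite ?mem_head.
apply: IHns => // k z kns; apply: Ft; by rewrite inE kns orbT.
Qed.

Lemma F_sub n r x : (1 <= n)%N -> F n r x -> Bn n x.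
Proof. by move=> /Ffil[/(_ r)[_ H] _]; apply: H. Qed.

Lemma F_subspace n r : (1 <= n)%N -> is_subspace (F n r).
Proof. by move=> /Ffil[/(_ r)[H _] _]. Qed.

Lemma F_leq n r s x : (1 <= n)%N -> r <= s -> F n s x -> F n r x.
Proof. by move=> /Ffil[_ [H _]] rs; apply: H. Qed.

Lemma exists_lambda n a : (1 <= n)%N -> Bn n a -> a <> 0%R ->
  exists l, lambda_is (F n) a l /\ F n l a.
Proof.
move=> n1 Ba a0; have [_ [Fle [sep [exh lc]]]] := Ffil n1.
have [r nr] : exists r, ~ F n r a by apply/existsNP => /sep.
have [r0 Fr0] := exh a Ba.
have [| |l ll] := completeness (fun r => F n r a).
- exists r => s Fs; apply: Rnot_lt_le => rs; apply: nr.
  by apply: Fle Fs; apply: Rlt_le.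
- by exists r0.
exists l; split=> //; apply/lc => s sl.
apply: contrapT => nFs; have [_ /(_ s)] := ll; move=> H.
have : l <= s; last by lra.
apply: H => q Fq; apply: Rnot_lt_le => sq; apply: nFs.
by apply: Fle Fq; apply: Rlt_le.
Qed.

Lemma exists_least_lambda n (vs : seq B) : (1 <= n)%N -> (0 < size vs)%N ->
  (forall i, (i < size vs)%N -> Bn n (nth 0%R vs i) /\ nth 0%R vs i <> 0%R) ->
  exists i m, [/\ (i < size vs)%N, lambda_is (F n) (nth 0%R vs i) m &
    forall j, (j < size vs)%N -> F n m (nth 0%R vs j)].
Proof.
move=> n1; elim: vs => // v vs IHvs _ vB.
have [/= Bv v0] := vB 0%N isT; have [l [ll Fl]] := exists_lambda n1 Bv v0.
case: vs IHvs vB => [_ _|w vs IHvs vB].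
  by exists 0%N, l; split=> // -[].
have [| |i [m [im ml mF]]] := IHvs => //; first by move=> j; apply: (vB j.+1).
have [lm|/Rlt_le ml'] := Rle_lt_dec l m.
  exists 0%N, l; split=> // -[//|j] js; apply: F_leq lm _ => //; exact: mF.
exists i.+1, m; split=> // -[_|j js]; [exact: F_leq ml' _|exact: mF].
Qed.

Lemma exists_min_lambda n : (1 <= n)%N ->
  exists m, is_min_lambda Bn F n m /\ forall x, Bn n x -> F n m x.
Proof.
move=> n1; have [|h Bh] := @exists_has_dim _ _ Bn Bdom Bgr ft g1 kd n (Bn n) _ (fun _ H => H).
  by have [Bs _] := Bgr; apply: Bs.
have h0 := has_dim_Bn_gt0 Bdom Bgr g1 kd Bh.
have [Bs [vs [sv [vB [vi gen]]]]] := Bh.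
have v0 i : (i < size vs)%N -> nth 0%R vs i <> 0%R.
  move=> ivs vi0; have := vi (mkseq (fun j => (j == i)%:R%R) (size vs)) (size_mkseq _ _).
  move=> /(_ _ i ivs); rewrite nth_mkseq // eqxx => H; have /eqP := oner_neq0 K; apply; apply: H.
  rewrite (bigD1 (Ordinal ivs)) //= vi0 scaler0 add0r big1 // => j ji.
  by rewrite nth_mkseq // (_ : (nat_of_ord j == i) = false) ?scale0r //; apply/negbTE.
have [|i [m [im lm mF]]] := exists_least_lambda n1 _ (fun i im => conj (vB i im) (v0 i im)).
  by rewrite sv.
have BF x : Bn n x -> F n m x.
  move=> /gen[ks ->]; have [S0 [SD SZ]] := F_subspace m n1.
  by elim/big_ind: _ => // j _; apply: SZ; apply: mF.
exists m; split=> //; split.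
  by exists (nth 0%R vs i); split; [apply: vB|split=> //; apply: v0].
by move=> a l Ba a0 [ub _]; apply: ub; apply: BF.
Qed.

Lemma quasi_filtered_power : exists n1, (1 <= n1)%N /\ forall q p s n t x,
  (n1 <= p)%N -> (n1 <= n)%N ->
  in_span (prod_set F (nseq q (p, s) ++ [:: (n, t)])) x ->
  F (q * p + n)%N (INR q * (s - f p) + (t - f n)) x.
Proof.
have [n0 Fn0] := Fqf; exists (maxn 1 n0); rewrite leq_maxl; split=> // q p s n t x.
rewrite !geq_max => /andP[_ np] /andP[_ nn] xl.
have := Fn0 (nseq q (p, s) ++ [:: (n, t)]) _ _ x xl.
rewrite size_cat addn1 map_cat map_nseq sumn_cat sumn_nseq /= addn0 (mulnC p).
have -> : foldr (fun (p : nat * R) acc => (p.2 - f p.1) + acc) 0 (nseq q (p, s) ++ [:: (n, t)]) =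
    INR q * (s - f p) + (t - f n).
  elim: q {xl} => [|q IHq] /=; first by ring.
  by rewrite IHq; case: q {IHq} => [|q]; rewrite /=; ring.
apply=> // i; rewrite ltnS nth_cat size_nseq nth_nseq => iq.
by case: ltnP => // qi; rewrite (_ : i - q = 0)%N //; apply/eqP.
Qed.

Lemma prod_set_power q p s n t v w : F p s v -> F n t w ->
  prod_set F (nseq q (p, s) ++ [:: (n, t)]) (v ^+ q * w)%R.
Proof.
move=> Fv Fw; elim: q => [|q IHq]; first by rewrite expr0 mul1r; apply: prod_set1.
by rewrite exprS -mulrA; apply: prod_set_cons.
Qed.

Lemma has_dim_uniq (V : B -> Prop) h h' : has_dim V h -> has_dim V h' -> h = h'.
Proof.
move=> Vh Vh'; have [_ [vs [sv [vV [vi _]]]]] := Vh; have [_ [ws [sw [wV [wi _]]]]] := Vh'.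
apply/eqP; rewrite eqn_leq -{1}sv -{2}sw.
by rewrite (leq_dim Bdom Vh') ?(leq_dim Bdom Vh).
Qed.

Lemma leq_has_dim (V W : B -> Prop) h h' : (forall x, V x -> W x) ->
  has_dim V h -> has_dim W h' -> (h <= h')%N.
Proof.
move=> VW [_ [vs [<- [vV [vi _]]]]] Wh'; apply: (leq_dim Bdom Wh') => // i im; exact/VW/vV.
Qed.

Lemma has_dim_eq (V W : B -> Prop) h : (forall x, V x -> W x) ->
  has_dim V h -> has_dim W h -> forall x, W x -> V x.
Proof.
move=> VW [Vs [vs [sv [vV [vi gen]]]]] Wh x Wx.
have [|ks ->] := @lin_indep_max_spans _ _ V vs x Vs vi.
  move=> xi; have := leq_dim Bdom Wh _ xi; rewrite /= sv ltnn => H; have : false; last by [].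
  by apply: H => -[|i] im //=; apply/VW/vV; rewrite sv.
have [V0 [VD VZ]] := Vs.
by elim/big_ind: _ => // i _; apply: VZ; apply: vV.
Qed.

Lemma has_dim_ext (V W : B -> Prop) h : (forall x, V x <-> W x) -> has_dim V h -> has_dim W h.
Proof.
by move=> VW; have -> : V = W by apply/funext => x; apply/propext.
Qed.

Lemma has_dim0 (V : B -> Prop) : V 0%R -> (forall x, V x -> x = 0%R) -> has_dim V 0.
Proof.
move=> V0 Vx; split.
  split=> //; split=> [x y /Vx-> /Vx->|k x /Vx->]; first by rewrite addr0.
  by rewrite scaler0.
exists [::]; split=> //; split=> //; split=> // x /Vx ->; exists [::].
by rewrite big_ord0.
Qed.

Lemma filtration_vanishes n (h : R -> nat) : (1 <= n)%N ->
  (forall r, has_dim (F n r) (h r)) -> exists r0, forall r, r0 < r -> h r = 0%N.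
Proof.
move=> n1 hF; have [_ [Fle [sep _]]] := Ffil n1.
have hle r s : r <= s -> (h s <= h r)%N.
  by move=> rs; apply: (leq_has_dim _ (hF s) (hF r)) => x; apply: Fle.
have exm : exists k, `[< exists r, h r = k >] by exists (h 0); apply/asboolP; exists 0.
case: (ex_minnP exm) => k /asboolP[r0 hr0] kmin; exists r0 => r rr0.
have hk s : r0 <= s -> h s = k.
  move=> rs; apply/eqP; rewrite eqn_leq -{1}hr0 hle //=.
  by apply: kmin; apply/asboolP; exists s.
have F0 x : F n r0 x -> x = 0%R.
  move=> Fx; apply: sep => s; have [sr|/Rlt_le rs] := Rle_lt_dec s r0; first exact: Fle Fx.
  have := hF s; rewrite hk // => hs; have := hF r0; rewrite hr0 => h0.
  by apply: (has_dim_eq _ hs h0 Fx) => y; apply: Fle.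
have := has_dim0 (proj1 (F_subspace r0 n1)) F0 => /has_dim_uniq/(_ (hF r0)) h0.
by have := hle r0 r (Rlt_le _ _ rr0); rewrite -h0 leqn0 => /eqP.
Qed.

Record dimension_estimates (u : nat -> R) (b : nat -> nat) (h : nat -> R -> nat) : Prop := {
  de_min : forall n, (1 <= n)%N -> is_min_lambda Bn F n (u n);
  de_dimB : forall n, has_dim (Bn n) (b n);
  de_dimF : forall n r, (1 <= n)%N -> has_dim (F n r) (h n r);
  de_gt0 : forall n, (0 < b n)%N;
  de_anti : forall n r s, (1 <= n)%N -> r <= s -> (h n s <= h n r)%N;
  de_full : forall n r, (1 <= n)%N -> r <= u n -> h n r = b n;
  de_zero : exists C, forall n r, (1 <= n)%N -> C * INR n < r -> h n r = 0%N;
  de_growth : exists n1 d M N, [/\ (1 <= n1)%N, (1 <= N)%N,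
    forall n, (b n <= M * n.+1 ^ d)%N,
    forall q p r, (n1 <= p)%N -> (n1 <= r)%N ->
      INR q * (u p - f p) + (u r - f r) <= u (q * p + r)%N &
    forall k p c, (n1 <= p)%N -> (n1 <= c)%N -> let q := (N * k).+1 in
      let n := (q * d + c)%N in
      (q ^ d * b p <= b (q * p + n)%N)%N /\ forall s t, t = INR q * (s - f p) + (u n - f n) ->
      (q ^ d * h p s <= h (q * p + n) t)%N] }.

Lemma exists_dimension_estimates : exists u b h, dimension_estimates u b h.
Proof.
have Bs := proj1 Bgr.
have /choice[u uP] : forall n, exists m, (1 <= n)%N ->
    is_min_lambda Bn F n m /\ forall x, Bn n x -> F n m x.
  move=> n; have [n1|n0] := boolP (1 <= n)%N; last by exists 0.
  by have [m mP] := exists_min_lambda n1; exists m.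
have /choice[b bP] : forall n, exists d, has_dim (Bn n) d.
  by move=> n; exact: (exists_has_dim Bdom Bgr ft g1 kd (Bs n) (fun x H => H)).
have /choice[h' hP'] : forall p : nat * R, exists d, (1 <= p.1)%N -> has_dim (F p.1 p.2) d.
  case=> n r /=; have [n1|n0] := boolP (1 <= n)%N; last by exists 0%N.
  have [d dP] := exists_has_dim Bdom Bgr ft g1 kd (F_subspace r n1) (fun x => F_sub n1).
  by exists d.
pose h n r := h' (n, r).
have hP n r : (1 <= n)%N -> has_dim (F n r) (h n r) by move=> n1; apply: (hP' (n, r)).
have b0 n : (0 < b n)%N := has_dim_Bn_gt0 Bdom Bgr g1 kd (bP n).
have hle n r s : (1 <= n)%N -> r <= s -> (h n s <= h n r)%N.
  move=> n1 rs; apply: (leq_has_dim _ (hP n s n1) (hP n r n1)) => x; exact: F_leq.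
exists u, b, h; split=> //.
- by move=> n /uP[].
- move=> n r n1 ru; apply: (has_dim_uniq (hP n r n1)).
  have [_ uF] := uP n n1; apply: has_dim_ext (bP n) => x.
  by split=> [/uF|/(F_sub n1)//]; apply: F_leq.
- have [C [N HC]] := Flim.
  have /choice[r0 r0P] : forall n, exists r0, (1 <= n)%N -> forall r, r0 < r -> h n r = 0%N.
    move=> n; have [n1|n0] := boolP (1 <= n)%N; last by exists 0.
    by have [r0 r0P] := filtration_vanishes n1 (fun r => hP n r n1); exists r0.
  have [C' HC'] : exists C', forall n, (n < N)%N -> (1 <= n)%N -> r0 n <= C' * INR n.
    elim: N {HC} => [|N [C' HC']]; first by exists 0.
    exists (Rmax C' (r0 N / INR N)) => n; rewrite ltnS leq_eqVlt => /orP[/eqP->|nN] n1.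
      have N0 := INR_gt0 n1; have E : r0 N = r0 N / INR N * INR N by field; lra.
      rewrite {1}E; apply: Rmult_le_compat_r; [lra|exact: Rmax_r].
    apply: Rle_trans (HC' n nN n1) _; apply: Rmult_le_compat_r (Rmax_l _ _).
    by have := INR_gt0 n1; lra.
  exists (Rmax C C') => n r n1 Cr; have n0 := INR_gt0 n1.
  case: (ltnP n N) => nN.
    apply: r0P => //; apply: Rle_lt_trans (HC' n nN n1) _; apply: Rle_lt_trans Cr.
    by apply: Rmult_le_compat_r (Rmax_r _ _); lra.
  have F0 x : F n r x -> x = 0%R.
    move=> Fx; apply: contrapT => x0.
    have [l [ll _]] := exists_lambda n1 (F_sub n1 Fx) x0.
    have lC := HC n nN n1 x l (F_sub n1 Fx) x0 ll.
    have rl : r <= l by have [ub _] := ll; apply: ub.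
    have : C * INR n <= Rmax C C' * INR n by apply: Rmult_le_compat_r (Rmax_l _ _); lra.
    have : l <= C * INR n.
      have -> : l = l / INR n * INR n by field; lra.
      by apply: Rmult_le_compat_r => //; lra.
    by lra.
  exact: (has_dim_uniq (hP n r n1) (has_dim0 (proj1 (F_subspace r n1)) F0)).
have [n1 [n11 qf]] := quasi_filtered_power.
have [d [M [N [c0 [N0 Hb Hkey]]]]] := graded_power_growth Bdom Bgr ft g1 kd.
exists (maxn n1 c0), d, M, N; split=> //.
- by rewrite leq_max n11.
- by move=> n; apply: Hb.
- move=> q p r; rewrite !geq_max => /andP[pn1 _] /andP[rn1 _].
  have n0 : (1 <= q * p + r)%N by rewrite addn_gt0 (leq_trans n11 rn1) orbT.
  have [[[a [Ba [a0 [ub _]]]] _] _] := uP _ n0.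
  have p1 := leq_trans n11 pn1; have r1 := leq_trans n11 rn1.
  apply: ub; apply: qf => //.
  have -> : nseq q (p, u p) ++ [:: (r, u r)] = [seq (k, u k) | k <- nseq q p ++ [:: r]].
    by rewrite map_cat map_nseq.
  have ns_in k : k \in nseq q p ++ [:: r] -> k = p \/ k = r.
    by rewrite mem_cat mem_nseq !inE => /orP[/andP[_ /eqP]|/eqP]; [left|right].
  have ns_sum : sumn (nseq q p ++ [:: r]) = (q * p + r)%N.
    by rewrite sumn_cat sumn_nseq /= addn0 mulnC.
  case nsE : (nseq q p ++ [:: r]) ns_in ns_sum => [|m ns] ns_in ns_sum; first by case: (q) nsE.
  apply: Bn_in_span_prod; last by rewrite ns_sum.
  by move=> k x /ns_in[->|->] Bx; [have [_] := uP p p1|have [_] := uP r r1]; apply.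
move=> k p c; rewrite !geq_max => /andP[pn1 _] /andP[cn1 cc0] q n.
have p1 := leq_trans n11 pn1.
have nn1 : (n1 <= n)%N by rewrite (leq_trans cn1) // leq_addl.
have n_gt0 := leq_trans n11 nn1.
have N1 : (1 <= q * p + n)%N by rewrite addn_gt0 n_gt0 orbT.
have qN : exists k, q = (N * k).+1 by exists k.
have [_ [BM _]] := Bgr.
split=> [|s t ->].
  apply: (Hkey p _ _ _ _ q c (Bs p) _ (bP p) (bP (q * p + n)%N)) => // v w Bv Bw.
  by apply: BM => //; apply: (BnX Bgr).
apply: (Hkey p _ _ _ _ q c (F_subspace s p1) _ (hP p s p1) (hP _ _ N1)) => // [x|v w Fv Bw].
  exact: F_sub.
apply: qf => //; apply/in_span_gen/prod_set_power => //.
by have [_] := uP n n_gt0; apply.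
Qed.
End Filtrations.

(** * Asymptotics of the dimensions *)

Section Asymptotics.
Local Open Scope R_scope.

Lemma finite_seq_bounded (g : nat -> R) N : exists D, 0 <= D /\ forall r, (r < N)%N -> Rabs (g r) <= D.
Proof.
elim: N => [|N [D [D0 HD]]]; first by exists 0; split=> //; lra.
exists (Rmax D (Rabs (g N))); split; first exact: Rle_trans D0 (Rmax_l _ _).
move=> r; rewrite ltnS leq_eqVlt => /orP[/eqP->|/HD H]; first exact: Rmax_r.
exact: Rle_trans H (Rmax_l _ _).
Qed.

Lemma exists_nat_gt (x : R) : exists n : nat, x < INR n.
Proof.
have [n nx] := INR_unbounded x; by exists n.
Qed.

Lemma cv_eventually (w : nat -> R) l eps : Un_cv w l -> 0 < eps ->
  exists N, forall n, (N <= n)%N -> l - eps < w n < l + eps.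
Proof.
move=> wl /wl[N HN]; exists N => n /ssrnat.leP Nn; have := HN n Nn.
by rewrite /Rdist => /Rabs_def2; lra.
Qed.

Lemma eventually_cv (w : nat -> R) l :
  (forall eps, 0 < eps -> exists N, forall n, (N <= n)%N -> l - eps <= w n <= l + eps) -> Un_cv w l.
Proof.
move=> H eps e0; have [|N HN] := H (eps / 2); first by lra.
exists N => n /ssrnat.leP Nn; have := HN n Nn; rewrite /Rdist => ?.
by apply: Rabs_def1; lra.
Qed.

Lemma exists_INR_ge (x : R) : exists N, forall n, (N <= n)%N -> x <= INR n.
Proof.
have [N HN] := exists_nat_gt x; exists N => n /leq_INR; lra.
Qed.

Lemma bernoulli_sub (z : R) d : 0 <= z <= 1 -> 1 - INR d * z <= (1 - z) ^ d.
Proof.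
move=> z01; elim: d => [|d IHd]; first by rewrite /=; lra.
rewrite S_INR /=; have d0 := pos_INR d.
have := pow_le (1 - z) d; nra.
Qed.

Lemma INRX m d : INR (m ^ d)%N = INR m ^ d.
Proof. by elim: d => [|d IHd] //; rewrite expnS INRM IHd. Qed.

Lemma Rabs_le_inv (a b : R) : Rabs a <= b -> - b <= a <= b.
Proof. by move=> H; have := Rle_abs a; have := Rle_abs (- a); rewrite Rabs_Ropp; lra. Qed.

Lemma quotient_ge (X x y : R) : 0 < x -> y * x <= X -> y <= X / x.
Proof.
move=> x0 H; apply: (Rmult_le_reg_r x) => //.
by rewrite /Rdiv Rmult_assoc Rinv_l ?Rmult_1_r //; lra.
Qed.

Section Fekete.
Variables (u f : nat -> R) (n1 : nat) (C : R).
Hypotheses (fn : Un_cv (fun n => f n / INR n) 0) (n10 : (1 <= n1)%N).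
Hypothesis uC : forall n, (1 <= n)%N -> u n <= C * INR n.
Hypothesis usup : forall q p r, (n1 <= p)%N -> (n1 <= r)%N ->
      INR q * (u p - f p) + (u r - f r) <= u (q * p + r)%N.

Lemma fekete_lower p eps : (n1 <= p)%N -> 0 < eps ->
  exists N, forall n, (N <= n)%N -> (u p - f p) / INR p - eps <= u n / INR n.
Proof.
move=> pn1 e0; have p0 := leq_trans n10 pn1; have P0 := INR_gt0 p0.
have [D [D0 HD]] := finite_seq_bounded (fun r => u r - f r) (n1 + p).
set X := u p - f p.
have [N HN] := exists_INR_ge ((INR (n1 + p) * Rabs (X / INR p) + D) / eps).
exists (maxn N n1) => n; rewrite geq_max => /andP[Nn n1n].
have n0 := INR_gt0 (leq_trans n10 n1n).
pose q := ((n - n1) %/ p)%N; pose r := (n1 + (n - n1) %% p)%N.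
have nE : n = (q * p + r)%N by rewrite /r addnCA -divn_eq subnKC.
have rlt : (r < n1 + p)%N by rewrite ltn_add2l ltn_mod.
have := usup q pn1 (leq_addr _ _ : n1 <= r)%N; rewrite -nE -/X => H.
have := HD r rlt => /Rabs_le_inv HDr.
have nER : INR n = INR q * INR p + INR r by rewrite {1}nE INRD INRM.
have rltR : INR r <= INR (n1 + p) by apply/leq_INR/ltnW.
have qE : INR q * X = INR n * (X / INR p) - INR r * (X / INR p) by rewrite nER; field; lra.
have Xr : INR r * (X / INR p) <= INR (n1 + p) * Rabs (X / INR p).
  have := Rle_abs (X / INR p); have := Rabs_pos (X / INR p); have := pos_INR r; nra.
have : INR (n1 + p) * Rabs (X / INR p) + D <= eps * INR n.
  have := HN n Nn; move: (_ + D) => Y HY.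
  have -> : Y = Y / eps * eps by field; lra.
  by rewrite Rmult_comm; apply: Rmult_le_compat_l; lra.
move=> HY; apply: quotient_ge => //; nra.
Qed.

Lemma fekete_cv : exists l, Un_cv (fun n => u n / INR n) l.
Proof.
pose S x := exists N, forall n, (N <= n)%N -> x <= u n / INR n.
have Sp p eps : (n1 <= p)%N -> 0 < eps -> S ((u p - f p) / INR p - eps).
  by move=> pn1 /(fekete_lower pn1).
have SC x : S x -> x <= C.
  move=> [N HN]; have := HN (maxn N 1) (leq_maxl _ _).
  have n0 : (1 <= maxn N 1)%N by apply: leq_maxr.
  have := uC n0; have := INR_gt0 n0; move: (maxn N 1) => n In un xn.
  have : u n / INR n <= C; last by lra.
  apply: (Rmult_le_reg_r (INR n)) => //.
  by rewrite /Rdiv Rmult_assoc Rinv_l ?Rmult_1_r //; lra.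
have [||l [lub ll]] := completeness S.
- by exists C => x /SC.
- by exists ((u n1 - f n1) / INR n1 - 1); apply: Sp => //; lra.
exists l; apply: eventually_cv => eps e0.
have [x [[N HN] lx]] : exists x, S x /\ l - eps < x.
  apply: contrapT => /forallNP H; suff : l <= l - eps by lra.
  by apply: ll => x Sx; have := H x => /not_andP[//|]; lra.
have [|N' HN'] := cv_eventually fn (_ : 0 < eps / 2); first by lra.
exists (maxn N (maxn N' n1)) => n; rewrite !geq_max => /and3P[Nn N'n n1n]; split.
  by have := HN n Nn; lra.
have e2 : 0 < eps / 2 by lra.
have := lub _ (Sp n _ n1n e2); have := HN' n N'n; rewrite /Rdiv; nra.
Qed.
End Fekete.

Section Dimensions.
Variables (u f : nat -> R) (b : nat -> nat) (h : nat -> R -> nat) (n1 d M N : nat) (C : R).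
Hypotheses (fC : forall n, (1 <= n)%N -> f n <= C * INR n).
Hypotheses (fn : Un_cv (fun n => f n / INR n) 0) (n10 : (1 <= n1)%N) (N0 : (1 <= N)%N).
Hypotheses (C0 : 0 < C) (b0 : forall n, (0 < b n)%N).
Hypothesis (bM : forall n, (b n <= M * n.+1 ^ d)%N).
Hypothesis uC : forall n, (1 <= n)%N -> - C * INR n <= u n.
Hypothesis hanti : forall n r s, (1 <= n)%N -> r <= s -> (h n s <= h n r)%N.
Hypothesis hfull : forall n r, (1 <= n)%N -> r <= - C * INR n -> h n r = b n.
Hypothesis hzero : forall n r, (1 <= n)%N -> C * INR n < r -> h n r = 0%N.
Hypothesis key : forall k p c, (n1 <= p)%N -> (n1 <= c)%N -> let q := (N * k).+1 in
      let n := (q * d + c)%N in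
      (q ^ d * b p <= b (q * p + n)%N)%N /\ forall s t, t = INR q * (s - f p) + (u n - f n) ->
      (q ^ d * h p s <= h (q * p + n) t)%N.

Lemma degree_decomposition p n : (n1 <= p)%N -> (p + d + n1 <= n)%N ->
  exists k c, [/\ (n1 <= c)%N, (c <= n1 + N * (p + d))%N &
    n = ((N * k).+1 * p + ((N * k).+1 * d + c))%N].
Proof.
move=> pn1 pn; have w0 : (0 < N * (p + d))%N.
  by rewrite muln_gt0 N0 addn_gt0 (leq_trans n10 pn1).
pose m := (n - (p + d + n1))%N; exists (m %/ (N * (p + d)))%N, (n1 + m %% (N * (p + d)))%N.
split; first exact: leq_addr.
  by rewrite leq_add2l ltnW // ltn_mod.
have mE := divn_eq m (N * (p + d)).
have nE : n = (p + d + n1 + m)%N by rewrite /m subnKC.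
by rewrite {1}nE {1}mE; move: (m %/ _)%N (m %% _)%N => k r; nia.
Qed.

Lemma INR_b_gt0 n : 0 < INR (b n). Proof. exact/INR_gt0. Qed.

Definition density n := INR (b n) / INR n ^ d.

Lemma density_bounds n : (1 <= n)%N -> 0 < density n <= INR M * 2 ^ d.
Proof.
move=> n_gt0; have n0 := INR_gt0 n_gt0; have nd := pow_lt _ d n0.
split; first by apply: Rdiv_lt_0_compat => //; exact: INR_b_gt0.
apply: (Rmult_le_reg_r (INR n ^ d)) => //.
rewrite /density /Rdiv Rmult_assoc Rinv_l ?Rmult_1_r; last by lra.
have := leq_INR (bM n); rewrite INRM INRX => H; apply: Rle_trans H _.
rewrite Rmult_assoc -Rpow_mult_distr; apply: Rmult_le_compat_l; first exact: pos_INR.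
apply: pow_incr; split; first exact: pos_INR.
have : 1 <= INR n := leq_INR n_gt0.
by rewrite S_INR; lra.
Qed.

Lemma density_power_lower p eps : (n1 <= p)%N -> 0 < eps -> exists N1, forall n, (N1 <= n)%N ->
  INR (b p) / INR (p + d) ^ d - eps <= density n.
Proof.
move=> pn1 e0; have p1 := leq_trans n10 pn1.
have P0 : 0 < INR (p + d) by apply: INR_gt0; rewrite addn_gt0 p1.
set g := INR (b p) / _; have g0 : 0 < g.
  by apply: Rdiv_lt_0_compat; [exact: INR_b_gt0|exact: pow_lt].
pose w := INR (n1 + N * (p + d)).
have w0 : 0 <= w by exact: pos_INR.
have d0 := pos_INR d.
have [N1 HN1] := exists_INR_ge (g * INR d * w / eps + w).
exists (maxn (p + d + n1) N1) => n; rewrite geq_max => /andP[np Nn].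
have [k [c [cn1 cw nE]]] := degree_decomposition pn1 np.
have n_gt0 : (1 <= n)%N by apply: leq_trans np; rewrite !addn_gt0 p1.
have I0 := INR_gt0 n_gt0; have nd := pow_lt _ d I0.
have [bn _] := key k pn1 cn1; rewrite -nE in bn.
move: (N * k).+1 nE bn => q nE bn.
have cwR : INR c <= w by apply: leq_INR.
have nER : INR n = INR q * INR (p + d) + INR c by rewrite {1}nE !INRD !INRM; ring.
have Iw : g * INR d * w / eps + w <= INR n by apply: HN1.
have gw : 0 <= g * INR d * w / eps.
  apply: Rmult_le_pos; last by apply/Rlt_le/Rinv_0_lt_compat.
  by apply: Rmult_le_pos => //; apply: Rmult_le_pos => //; lra.
apply: quotient_ge => //; apply: Rle_trans (leq_INR bn); rewrite INRM INRX.
have -> : INR (b p) = g * INR (p + d) ^ d.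
  by rewrite /g; field; apply: pow_nonzero; lra.
have z01 : 0 <= w / INR n <= 1.
  split; first by apply: Rmult_le_pos => //; apply/Rlt_le/Rinv_0_lt_compat.
  by apply: (Rmult_le_reg_r (INR n)) => //; rewrite /Rdiv Rmult_assoc Rinv_l; lra.
have := bernoulli_sub d z01 => B1.
have qpn : ((1 - w / INR n) * INR n) ^ d <= (INR q * INR (p + d)) ^ d.
  apply: pow_incr; split; first by apply: Rmult_le_pos; lra.
  have -> : (1 - w / INR n) * INR n = INR n - w by field; lra.
  by lra.
rewrite !Rpow_mult_distr in qpn.
have dw : g * (INR d * (w / INR n)) <= eps.
  have -> : g * (INR d * (w / INR n)) = (g * INR d * w / eps) * eps / INR n by field; lra.
  apply: (Rmult_le_reg_r (INR n)) => //; rewrite /Rdiv Rmult_assoc Rinv_l ?Rmult_1_r; last by lra.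
  by rewrite (Rmult_comm eps); apply: Rmult_le_compat_r; lra.
have A1 : (g - eps) <= g * (1 - w / INR n) ^ d by nra.
have A2 : (g - eps) * INR n ^ d <= g * (1 - w / INR n) ^ d * INR n ^ d.
  by apply: Rmult_le_compat_r => //; lra.
by apply: Rle_trans A2 _; nra.
Qed.

Lemma density_limit : exists beta, [/\ 0 < beta,
  forall n, (n1 <= n)%N -> INR (b n) <= beta * INR (n + d) ^ d &
  forall eps, 0 < eps -> exists N1, forall n, (N1 <= n)%N -> beta - eps <= density n].
Proof.
pose S x := exists N1, forall n, (N1 <= n)%N -> x <= density n.
have Sp p eps : (n1 <= p)%N -> 0 < eps -> S (INR (b p) / INR (p + d) ^ d - eps).
  by move=> pn1 /(density_power_lower pn1).
have [||l [lub ll]] := completeness S.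
- exists (INR M * 2 ^ d) => x [N1 HN1]; apply: Rle_trans (HN1 (maxn N1 1) (leq_maxl _ _)) _.
  by have [] := density_bounds (leq_maxr N1 1).
- by exists (INR (b n1) / INR (n1 + d) ^ d - 1); apply: Sp => //; lra.
have lp p : (n1 <= p)%N -> INR (b p) / INR (p + d) ^ d <= l.
  move=> pn1; apply: le_epsilon => e e0; have := lub _ (Sp p e pn1 e0); lra.
have pd p : (n1 <= p)%N -> 0 < INR (p + d) ^ d.
  by move=> pn1; apply/pow_lt/INR_gt0; rewrite addn_gt0 (leq_trans n10 pn1).
exists l; split.
- apply: Rlt_le_trans (lp n1 (leqnn _)); apply: Rdiv_lt_0_compat; first exact: INR_b_gt0.
  exact: pd.
- move=> n nn1; have := lp n nn1; have := pd n nn1; move: (INR (n + d) ^ d) => P P0 H.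
  have -> : INR (b n) = INR (b n) / P * P by field; lra.
  by apply: Rmult_le_compat_r; lra.
move=> eps e0; apply: contrapT => nS; suff : l <= l - eps by lra.
apply: ll => x [N1 HN1]; apply: Rnot_lt_le => lx; apply: nS; exists N1 => n /HN1; lra.
Qed.

Lemma power_ratio eta : 0 < eta < 1 -> exists p0, forall p, (p0 <= p)%N -> (n1 <= p)%N ->
  exists N1, forall n k c, (N1 <= n)%N -> (c <= n1 + N * (p + d))%N ->
    n = ((N * k).+1 * p + ((N * k).+1 * d + c))%N ->
    (1 - eta) * INR (b n) <= INR (N * k).+1 ^ d * INR (b p).
Proof.
move=> eta01; have [beta [beta0 bup blow]] := density_limit.
have d0 := pos_INR d.
pose z := eta / 2 / (INR d + 1).
have z0 : 0 < z by apply: Rdiv_lt_0_compat; lra.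
have zd : INR d * z <= eta / 2.
  have -> : eta / 2 = z * (INR d + 1) by rewrite /z; field; lra.
  by nra.
have z1 : z < 1.
  have : z * (INR d + 1) = eta / 2 by rewrite /z; field; lra.
  by nra.
have [|p1 Hp1] := blow (beta * (eta / 2)); first by nra.
have [p2 Hp2] := exists_INR_ge (2 * INR d / z).
exists (maxn p1 p2) => p; rewrite geq_max => /andP[pp1 pp2] pn1.
have p_gt0 := leq_trans n10 pn1; have P0 := INR_gt0 p_gt0.
pose w := INR (n1 + N * (p + d)) + INR d.
have w0 : 0 <= w by rewrite /w; have := pos_INR (n1 + N * (p + d)); lra.
have [N1 HN1] := exists_INR_ge (2 * w / z).
exists (maxn N1 n1) => n k c; rewrite geq_max => /andP[Nn n1n] cw nE.
have Q0 : 0 < INR (N * k).+1 by apply: INR_gt0.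
move: (N * k).+1 nE Q0 => q nE Q0.
have n0 := INR_gt0 (leq_trans n10 n1n).
have nER : INR n = INR q * (INR p + INR d) + INR c by rewrite {1}nE !INRD !INRM; ring.
have cwR : INR c + INR d <= w.
  by rewrite /w; have := leq_INR cw; lra.
(* [q p >= (1 - z) (n + d)] because [d q <= (z/2) q p] and [c + d <= (z/2) n] *)
have dq : INR q * INR d <= z / 2 * (INR q * INR p).
  have : 2 * INR d / z <= INR p by apply: Hp2.
  move=> H; have : 2 * INR d <= z * INR p.
    have -> : 2 * INR d = 2 * INR d / z * z by field; lra.
    by rewrite (Rmult_comm z); apply: Rmult_le_compat_r; lra.
  by nra.
have wn : w <= z / 2 * INR n.
  have H : 2 * w / z <= INR n by apply: HN1.
  have -> : w = 2 * w / z * (z / 2) by field; lra.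
  by rewrite (Rmult_comm (z / 2)); apply: Rmult_le_compat_r; lra.
have qp : (1 - z) * INR (n + d) <= INR q * INR p.
  rewrite INRD; rewrite Rmult_plus_distr_l in nER.
  move: (INR q * INR p) (INR q * INR d) dq nER => X Y dq nER.
  have zd0 : 0 <= z * INR d by apply: Rmult_le_pos; lra.
  have A1 : (INR n + INR d) * (1 - z / 2) <= X * (1 + z / 2) by lra.
  have z2 : 0 <= z * z * (INR n + INR d) by apply: Rmult_le_pos; [nra|lra].
  apply: (Rmult_le_reg_r (1 + z / 2)); first by lra.
  have -> : (1 - z) * (INR n + INR d) * (1 + z / 2) =
      (INR n + INR d) * (1 - z / 2) - z * z * (INR n + INR d) / 2 by field.
  by lra.
have T0 : 0 <= (1 - z) * INR (n + d) by apply: Rmult_le_pos; [lra|exact: pos_INR].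
have := pow_incr _ _ d (conj T0 qp); rewrite !Rpow_mult_distr.
have Bz : 1 - eta / 2 <= (1 - z) ^ d.
  by have := bernoulli_sub d (conj (Rlt_le _ _ z0) (Rlt_le _ _ z1)); lra.
have bp : (beta - beta * (eta / 2)) * INR p ^ d <= INR (b p).
  have pd := pow_lt _ d P0; have := Hp1 p pp1; rewrite /density => H.
  have -> : INR (b p) = INR (b p) / INR p ^ d * INR p ^ d by field; lra.
  by apply: Rmult_le_compat_r; lra.
have bn := bup n n1n.
have W0 : 0 <= INR (n + d) ^ d by apply/pow_le/pos_INR.
have qd := pow_lt _ d Q0; have pd := pow_lt _ d P0.
move: ((1 - z) ^ d) (INR (n + d) ^ d) (INR q ^ d) (INR p ^ d) Bz bp bn W0 qd pd => Z W Qd Pd Bz bp bn W0 Qd0 Pd0 H.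
apply: Rle_trans (_ : Qd * ((beta - beta * (eta / 2)) * Pd) <= _); last first.
  by apply: Rmult_le_compat_l; lra.
have -> : Qd * ((beta - beta * (eta / 2)) * Pd) = beta * (1 - eta / 2) * (Qd * Pd) by ring.
have e2 : 0 <= beta * (1 - eta / 2) by nra.
apply: Rle_trans (Rmult_le_compat_l _ _ _ e2 H).
apply: Rle_trans (_ : (1 - eta) * (beta * W) <= _); first by apply: Rmult_le_compat_l; lra.
have -> : (1 - eta) * (beta * W) = beta * W * (1 - eta) by ring.
have -> : beta * (1 - eta / 2) * (Z * W) = beta * W * ((1 - eta / 2) * Z) by ring.
apply: Rmult_le_compat_l; first by apply: Rmult_le_pos; lra.
by nra.
Qed.

Definition level n t := INR (h n (INR n * t)) / INR (b n).

Lemma level_bounds n t : (1 <= n)%N -> 0 <= level n t <= 1.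
Proof.
move=> n_gt0; have bn := INR_b_gt0 n; split.
  by apply: Rmult_le_pos; [exact: pos_INR|apply/Rlt_le/Rinv_0_lt_compat].
apply: (Rmult_le_reg_r (INR (b n))) => //.
rewrite /level /Rdiv Rmult_assoc Rinv_l ?Rmult_1_r ?Rmult_1_l; last by lra.
apply: leq_INR; rewrite -(hfull n_gt0 (Rmin_r (INR n * t) _)).
by apply: hanti => //; apply: Rmin_l.
Qed.

Lemma level_full n t : (1 <= n)%N -> t <= - C -> level n t = 1.
Proof.
move=> n_gt0 tC; rewrite /level hfull //; first by apply: Rinv_r; have := INR_b_gt0 n; lra.
by rewrite Rmult_comm; apply: Rmult_le_compat_r => //; apply: pos_INR.
Qed.

Lemma level_zero n t : (1 <= n)%N -> C < t -> level n t = 0.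
Proof.
move=> n_gt0 tC; rewrite /level hzero //; first by rewrite /Rdiv Rmult_0_l.
by rewrite Rmult_comm; apply: Rmult_lt_compat_l => //; apply: INR_gt0.
Qed.

Lemma level_quasi_increasing t eps eta : 0 < eps -> 0 < eta < 1 ->
  exists p0, forall p, (p0 <= p)%N ->
  exists N1, forall n, (N1 <= n)%N -> level p t - eta <= level n (t - eps).
Proof.
move=> e0 eta01; have [p1 Hp1] := power_ratio eta01.
have d0 := pos_INR d.
have [|p2 Hp2] := cv_eventually fn (_ : 0 < eps / 2); first by lra.
have [p3 Hp3] := exists_INR_ge ((2 * C * INR d + INR d * Rabs t + 1) / (eps / 2)).
exists (maxn n1 (maxn p1 (maxn p2 p3))) => p; rewrite !geq_max => /and4P[pn1 pp1 pp2 pp3].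
have p_gt0 := leq_trans n10 pn1; have P0 := INR_gt0 p_gt0.
have [N1 HN1] := Hp1 p pp1 pn1.
have w0 := pos_INR (n1 + N * (p + d)); set w := INR (n1 + N * (p + d)) in w0.
have [N2 HN2] := exists_INR_ge ((INR p + INR d) * (w * (2 * C + Rabs t + eps)) + w).
exists (maxn (p + d + n1) (maxn N1 N2)) => n; rewrite !geq_max => /and3P[np nN1 nN2].
have [k [c [cn1 cw nE]]] := degree_decomposition pn1 np.
have n_gt0 : (1 <= n)%N by apply: leq_trans np; rewrite !addn_gt0 p_gt0.
have ratio := HN1 n k c nN1 cw nE.
have [_ /(_ (INR p * t) _ erefl)] := key k pn1 cn1; rewrite -nE.
have Q0 : 0 < INR (N * k).+1 by apply: INR_gt0.
move: (N * k).+1 nE Q0 ratio => q nE Q0 ratio.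
have nn0 : (1 <= q * d + c)%N by apply: leq_trans n10 (leq_trans cn1 (leq_addl _ _)).
have vb : - 2 * C * (INR q * INR d + INR c) <= u (q * d + c)%N - f (q * d + c)%N.
  by have := uC nn0; have := fC nn0; rewrite INRD INRM; lra.
move: (u _ - f _) vb => v vb Hkey.
have cwR : INR c <= w by apply: leq_INR.
have c0 := pos_INR c.
have nER : INR n = INR q * (INR p + INR d) + INR c by rewrite {1}nE !INRD !INRM; ring.
have tA := Rle_abs t; have tA' := Rle_abs (- t); rewrite Rabs_Ropp in tA'.
have fp : f p <= eps / 2 * INR p.
  have [_] := Hp2 p pp2; rewrite Rplus_0_l => H.
  have -> : f p = f p / INR p * INR p by field; lra.
  by apply: Rmult_le_compat_r; lra.
have pbig : 2 * C * INR d + INR d * Rabs t + 1 <= eps / 2 * INR p.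
  have := Hp3 p pp3; move: (_ + 1) => X H.
  have -> : X = X / (eps / 2) * (eps / 2) by field; lra.
  by rewrite (Rmult_comm (eps / 2)); apply: Rmult_le_compat_r; lra.
have qbig : w * (2 * C + Rabs t + eps) <= INR q.
  have := HN2 n nN2; rewrite nER => H.
  apply: (Rmult_le_reg_l (INR p + INR d)); first by lra.
  by lra.
have S : INR n * (t - eps) <= INR q * (INR p * t - f p) + v.
  have A1 : INR c * (2 * C + Rabs t + eps) <= w * (2 * C + Rabs t + eps).
    by apply: Rmult_le_compat_r => //; have := Rabs_pos t; lra.
  have A2 : 1 <= (INR p + INR d) * eps - f p - 2 * C * INR d - INR d * t.
    have : INR d * t <= INR d * Rabs t by apply: Rmult_le_compat_l.
    have : 0 <= INR d * eps by apply: Rmult_le_pos; lra.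
    by lra.
  have A3 : INR q * 1 <= INR q * ((INR p + INR d) * eps - f p - 2 * C * INR d - INR d * t).
    by apply: Rmult_le_compat_l => //; lra.
  have A4 : INR c * (2 * C + t - eps) <= INR c * (2 * C + Rabs t + eps).
    by apply: Rmult_le_compat_l => //; lra.
  by rewrite nER; lra.
have hh : INR q ^ d * INR (h p (INR p * t)) <= INR (h n (INR n * (t - eps))).
  by rewrite -INRX -INRM; apply: leq_INR; apply: leq_trans Hkey _; apply: hanti.
have [lp0 lp1] := level_bounds t p_gt0.
have bp := INR_b_gt0 p; have bn := INR_b_gt0 n.
have hE : INR (h p (INR p * t)) = level p t * INR (b p) by rewrite /level; field; lra.
rewrite hE in hh; rewrite {2}/level; apply: quotient_ge => //; apply: Rle_trans hh.
apply: Rle_trans (_ : level p t * ((1 - eta) * INR (b n)) <= _); last first.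
  have -> : INR q ^ d * (level p t * INR (b p)) = level p t * (INR q ^ d * INR (b p)) by ring.
  exact: Rmult_le_compat_l.
have : level p t * eta <= eta by nra.
by nra.
Qed.

Definition tail_witness x y := exists t, x < t /\ exists n0, forall n, (n0 <= n)%N -> (1 <= n)%N -> y <= level n t.

Lemma exists_limit_tail : exists D : R -> R, [/\
  (forall x y, x <= y -> D y <= D x) /\ (forall x, 0 <= D x <= 1),
  (forall x, x < - C -> D x = 1) /\ (forall x, C <= x -> D x = 0),
  (forall x eps, 0 < eps -> exists2 delta, 0 < delta & D x - eps <= D (x + delta)),
  (forall x eps, 0 < eps -> exists t n0, x < t /\ forall n, (n0 <= n)%N -> (1 <= n)%N -> D x - eps <= level n t) &
  (forall x t eps, 0 < eps -> x < t -> exists n0, forall n, (n0 <= n)%N -> (1 <= n)%N -> level n t <= D x + eps)].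
Proof.
have ub x y : tail_witness x y -> y <= 1.
  move=> [t [_ [n0 H]]]; apply: Rle_trans (H (maxn n0 1) (leq_maxl _ _) (leq_maxr _ _)) _.
  by have [] := level_bounds t (leq_maxr n0 1).
have lb x : tail_witness x 0.
  exists (x + 1); split; first by lra.
  by exists 0%N => n _ n_gt0; have [] := level_bounds (x + 1) n_gt0.
have /choice[D DP] : forall x, exists l, is_lub (tail_witness x) l.
  move=> x; have [||l ll] := completeness (tail_witness x); last by exists l.
    by exists 1 => y /ub.
  by exists 0.
have near x eps : 0 < eps -> exists y, tail_witness x y /\ D x - eps < y.
  move=> e0; apply: contrapT => /forallNP H; suff : D x <= D x - eps by lra.
  by apply: (proj2 (DP x)) => y wy; have := H y => /not_andP[//|]; lra.
have D01 x : 0 <= D x <= 1.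
  split; first by apply: (proj1 (DP x)).
  by apply: (proj2 (DP x)) => y /ub.
exists D; split.
- split=> // x y xy; apply: (proj2 (DP y)) => z [t [yt H]]; apply: (proj1 (DP x)).
  by exists t; split=> //; lra.
- split=> x xC.
    apply: Rle_antisym; first by have [] := D01 x.
    apply: (proj1 (DP x)); exists (- C); split=> //; exists 0%N => n _ n_gt0.
    by rewrite level_full //; lra.
  apply: Rle_antisym; last by have [] := D01 x.
  apply: (proj2 (DP x)) => y [t [xt [n0 H]]].
  have := H (maxn n0 1) (leq_maxl _ _) (leq_maxr _ _); rewrite level_zero //; first exact: leq_maxr.
  by lra.
- move=> x eps e0; have [y [[t [xt H]] Dy]] := near x eps e0.
  exists ((t - x) / 2); first by lra.
  apply: Rle_trans (_ : y <= _); first by lra.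
  by apply: (proj1 (DP _)); exists t; split=> //; lra.
- move=> x eps e0; have [y [[t [xt [n0 H]]] Dy]] := near x eps e0.
  by exists t, n0; split=> // n nn0 n_gt0; have := H n nn0 n_gt0; lra.
move=> x t eps e0 xt; pose eta := Rmin (eps / 2) (1 / 2).
have eta0 : 0 < eta by apply: Rmin_glb_lt; lra.
have eta_eps : eta <= eps / 2 := Rmin_l _ _.
have eta1 : eta < 1 by have := Rmin_r (eps / 2) (1 / 2); rewrite -/eta; lra.
have [|p0 Hp0] := @level_quasi_increasing t ((t - x) / 2) eta _ (conj eta0 eta1); first by lra.
exists p0 => n nn0 n_gt0; have [N1 HN1] := Hp0 n nn0.
suff : level n t - eta <= D x by lra.
apply: (proj1 (DP x)); exists (t - (t - x) / 2); split; first by lra.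
by exists N1 => m mN _; apply: HN1.
Qed.
End Dimensions.
End Asymptotics.

(** * Integrals against probability measures *)

Section Measures.
Local Open Scope R_scope.

Lemma eq_set (P Q : R -> Prop) : (forall x, P x <-> Q x) -> P = Q.
Proof. by move=> PQ; apply/funext => x; apply/propext. Qed.

Lemma indicT (A : R -> Prop) x : A x -> indic A x = 1.
Proof. by rewrite /indic; case: excluded_middle_informative. Qed.

Lemma indicF (A : R -> Prop) x : ~ A x -> indic A x = 0.
Proof. by rewrite /indic; case: excluded_middle_informative. Qed.

Lemma indic_ge0 A x : 0 <= indic A x.
Proof. by have [Ax|nA] := pselect (A x); [rewrite indicT //|rewrite indicF //]; lra. Qed.

Lemma borel_false : borel (fun=> False).
Proof. by apply: borel_ext (borel_open 1 0) => x; split=> //; lra. Qed.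

Lemma borel_or A B : borel A -> borel B -> borel (fun x => A x \/ B x).
Proof.
move=> bA bB; apply: (@borel_ext (fun x => exists k, (if k is 0%N then A else B) x)).
  by move=> x; split=> [[[|k] H]|[H|H]]; [left|right|exists 0%N|exists 1%N].
by apply: borel_cunion => -[|k].
Qed.

Lemma borel_and A B : borel A -> borel B -> borel (fun x => A x /\ B x).
Proof.
move=> bA bB; apply: (@borel_ext (fun x => ~ (~ A x \/ ~ B x))); last first.
  by apply/borel_compl/borel_or; apply: borel_compl.
by move=> x; split=> [/not_orP[/contrapT ? /contrapT ?]|[Ax Bx] []].
Qed.

Lemma borel_gt t : borel (fun x => t < x).
Proof.
apply: (@borel_ext (fun x => exists k, t < x < t + INR k)); last first.
  by apply: borel_cunion => k; apply: borel_open.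
move=> x; split=> [[k []]//|tx]; have [k kx] := exists_nat_gt (x - t); exists k; lra.
Qed.

Lemma borel_lt t : borel (fun x => x < t).
Proof.
apply: (@borel_ext (fun x => exists k, t - INR k < x < t)); last first.
  by apply: borel_cunion => k; apply: borel_open.
move=> x; split=> [[k []]//|tx]; have [k kx] := exists_nat_gt (t - x); exists k; lra.
Qed.

Lemma borel_ge t : borel (fun x => t <= x).
Proof.
by apply: borel_ext (borel_compl (borel_lt t)) => x; split=> [/Rnot_lt_le|]//; lra.
Qed.

Lemma borel_itv s t : borel (fun x => s < x <= t).
Proof.
apply: borel_and; first exact: borel_gt.
by apply: borel_ext (borel_compl (borel_gt t)) => x; split=> [/Rnot_lt_le|]//; lra.
Qed.

Lemma borel_scale eps A : 0 < eps -> borel A -> borel (fun y => A (eps * y)).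
Proof.
move=> e0; elim=> {A} [a b|A _ IH|A _ IH|A B AB _ IH].
- apply: borel_ext (borel_open (a / eps) (b / eps)) => x.
  have E c : c = eps * (c / eps) by field; lra.
  rewrite {2}(E a) {2}(E b); split=> -[H1 H2]; split.
  + exact: Rmult_lt_compat_l.
  + exact: Rmult_lt_compat_l.
  + exact: Rmult_lt_reg_l H1.
  + exact: Rmult_lt_reg_l H2.
- exact: borel_compl.
- exact: borel_cunion.
by apply: borel_ext IH => x; apply: AB.
Qed.

Lemma prob_measure_pushT eps nu : 0 < eps -> prob_measure nu -> prob_measure (pushT eps nu).
Proof.
move=> e0 [nu0 [nu1 nuS]]; split; first by move=> A bA; apply/nu0/borel_scale.
split=> // A bA dA; apply: (nuS (fun k y => A k (eps * y))) => [k|i j x ij Ai Aj].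
  exact: borel_scale.
exact: dA ij Ai Aj.
Qed.

Section ProbMeasure.
Variable mu : (R -> Prop) -> R.
Hypothesis mup : prob_measure mu.

Lemma mu_ge0 A : borel A -> 0 <= mu A.
Proof. by case: mup => H _; apply: H. Qed.

Lemma mu_false : mu (fun=> False) = 0.
Proof.
have [_ [_ muS]] := mup.
have := muS (fun=> (fun=> False)) (fun=> borel_false) (fun i j x _ H _ => H).
have -> : (fun x : R => exists _ : nat, False) = (fun=> False).
  by apply: eq_set => x; split=> [[]|].
set m := mu _ => H; apply: cond_eq => e e0.
have [N HN] := H (e / 2) ltac:(lra).
have := HN N (le_n _); have := HN N.+1 (le_S _ _ (le_n _)); rewrite /Rdist /=.
move: (sum_f_R0 _ _) => s /Rabs_def2 H1 /Rabs_def2 H2.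
by apply: Rabs_def1; lra.
Qed.

Lemma mu_or A B : borel A -> borel B -> (forall x, A x -> B x -> False) ->
  mu (fun x => A x \/ B x) = mu A + mu B.
Proof.
move=> bA bB dAB; have [_ [_ muS]] := mup.
pose X k := if k is 0%N then A else if k is 1%N then B else fun=> False.
have := muS X _ _; move=> /(_ _)/(_ _); rewrite (_ : (fun x => exists k, X k x) = (fun x => A x \/ B x)); last first.
  apply: eq_set => x; split=> [[[|[|k]]]|[]] //; try by [left|right].
    by exists 0%N.
  by exists 1%N.
move=> H; have {}H := H (fun k => match k with 0%N => bA | 1%N => bB | _ => borel_false end) _.
have {}H : infinite_sum (fun k => mu (X k)) (mu (fun x => A x \/ B x)).
  apply: H => -[|[|i]] [|[|j]] x //= _ Hi Hj; try by [].
    exact: dAB Hi Hj.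
  exact: dAB Hj Hi.
have S n : sum_f_R0 (fun k => mu (X k)) n.+1 = mu A + mu B.
  by elim: n => [|n IHn] //=; rewrite -[sum_f_R0 _ _ + _]/(sum_f_R0 (fun k => mu (X k)) n.+1) IHn mu_false; ring.
apply: cond_eq => e e0; have [N HN] := H e e0.
by have := HN N.+1 (le_S _ _ (le_n _)); rewrite S /Rdist Rabs_minus_sym.
Qed.

Lemma mu_leq A B : borel A -> borel B -> (forall x, A x -> B x) -> mu A <= mu B.
Proof.
move=> bA bB AB; have bD : borel (fun x => B x /\ ~ A x) by apply: borel_and => //; apply: borel_compl.
have -> : B = (fun x => A x \/ (B x /\ ~ A x)).
  by apply: eq_set => x; split=> [Bx|[/AB|[]]//]; have [Ax|] := pselect (A x); [left|right].
rewrite mu_or //; last by move=> x Ax [].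
by have := mu_ge0 bD; lra.
Qed.

Lemma mu_le1 A : borel A -> mu A <= 1.
Proof.
have [_ [<- _]] := mup => bA; apply: mu_leq => //.
by apply: borel_ext (borel_compl borel_false) => x; split=> // _ [].
Qed.

Definition upper t := mu (fun x => t < x).

Lemma mu_itv s t : s <= t -> mu (fun x => s < x <= t) = upper s - upper t.
Proof.
move=> st; have : upper s = mu (fun x => s < x <= t) + upper t; last by lra.
rewrite /upper (_ : (fun x => s < x) = (fun x => s < x <= t \/ t < x)).
  by apply: mu_or; [exact: borel_itv|exact: borel_gt|move=> x; lra].
by apply: eq_set => x; split=> [sx|]; [case: (Rle_lt_dec x t); [left|right]|lra].
Qed.

Definition simple_on (l : seq (R * (R -> Prop))) (E : R -> Prop) :=
  foldr (fun p acc => p.1 * mu (fun x => p.2 x /\ E x) + acc) 0 l.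

Definition borel_list (l : seq (R * (R -> Prop))) :=
  forall i, (i < size l)%N -> 0 <= (nth (0, fun _ => False) l i).1 /\ borel (nth (0, fun _ => False) l i).2.

Lemma simple_on_or l E E' : borel_list l -> borel E -> borel E' -> (forall x, E x -> E' x -> False) ->
  simple_on l (fun x => E x \/ E' x) = simple_on l E + simple_on l E'.
Proof.
move=> bl bE bE' dE; elim: l bl => [|[a A] l IHl] bl /=; first by ring.
rewrite IHl => [|i il]; last exact: (bl i.+1).
have [_ /= bA] := bl 0%N isT.
have -> : (fun x => A x /\ (E x \/ E' x)) = (fun x => (A x /\ E x) \/ (A x /\ E' x)).
  by apply: eq_set => x; tauto.
rewrite mu_or; [ring|exact: borel_and|exact: borel_and|].
by move=> x [_ Ex] [_ E'x]; apply: dE Ex E'x.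
Qed.

Lemma simple_on_le l E c : borel_list l -> borel E -> 0 <= c ->
  (forall i j x, (i < j)%N -> (j < size l)%N ->
        (nth (0, fun _ => False) l i).2 x -> (nth (0, fun _ => False) l j).2 x -> False) ->
  (forall i x, (i < size l)%N -> (nth (0, fun _ => False) l i).2 x -> E x ->
     (nth (0, fun _ => False) l i).1 <= c) ->
  simple_on l E <= c * mu E.
Proof.
move=> bl bE c0 dl lc; elim: l E bE bl dl lc => [|[a A] l IHl] E bE bl dl lc /=.
  by apply: Rmult_le_pos => //; apply: mu_ge0.
have [/= a0 bA] := bl 0%N isT.
have bAE : borel (fun x => A x /\ E x) by apply: borel_and.
have bDE : borel (fun x => E x /\ ~ A x) by apply: borel_and => //; apply: borel_compl.
have EE : mu E = mu (fun x => A x /\ E x) + mu (fun x => E x /\ ~ A x).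
  rewrite -mu_or //; last by move=> x [Ax _] [].
  congr mu; apply: eq_set => x; split=> [Ex|[[]|[]]//].
  by have [Ax|nAx] := pselect (A x); [left|right].
have lE : simple_on l E = simple_on l (fun x => E x /\ ~ A x).
  have : forall i x, (i < size l)%N -> (nth (0, fun _ => False) l i).2 x -> ~ A x.
    by move=> i x il lx Ax; apply: (dl 0%N i.+1 x).
  elim: {IHl bl dl lc} l => [|[a' A'] l IHl] //= dA; rewrite IHl => [|i x il]; last exact: (dA i.+1).
  congr (_ * mu _ + _); apply: eq_set => x; split=> [[A'x Ex]|[A'x []]//]; split=> //.
  by split=> //; apply: (dA 0%N).
rewrite lE EE Rmult_plus_distr_l; apply: Rplus_le_compat.
  have [[x [Ax Ex]]|nAE] := pselect (exists x, A x /\ E x).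
    by apply: Rmult_le_compat_r; [exact: mu_ge0|apply: (lc 0%N x)].
  have -> : (fun x => A x /\ E x) = (fun=> False).
    by apply: eq_set => x; split=> // H; apply: nAE; exists x.
  by rewrite mu_false; lra.
apply: IHl => //.
- by move=> i il; apply: (bl i.+1).
- by move=> i j x ij jl; apply: (dl i.+1 j.+1 x).
by move=> i x il lx [Ex _]; apply: (lc i.+1 x).
Qed.

Lemma simple_value_le l g i x : borel_list l ->
  foldr (fun p acc => p.1 * indic p.2 x + acc) 0 l <= g ->
  (i < size l)%N -> (nth (0, fun _ => False) l i).2 x -> (nth (0, fun _ => False) l i).1 <= g.
Proof.
move=> bl lg il lx; apply: Rle_trans lg.
have ge0 l' : borel_list l' -> 0 <= foldr (fun p acc => p.1 * indic p.2 x + acc) 0 l'.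
  elim: l' => [|p l' IH] bl' /=; first by lra.
  have [p0 _] := bl' 0%N isT; apply: Rplus_le_le_0_compat; last by apply: IH => j; apply: (bl' j.+1).
  by apply: Rmult_le_pos => //; exact: indic_ge0.
elim: l i bl il lx => [|p l IHl] // [|i] bl il lx /=.
  rewrite indicT //.
  by have := ge0 l (fun j => bl j.+1); lra.
have [p0 _] := bl 0%N isT.
have := IHl i (fun j => bl j.+1) il lx.
have : 0 <= p.1 * indic p.2 x.
  by apply: Rmult_le_pos => //; exact: indic_ge0.
by lra.
Qed.

Fixpoint sumR (F : nat -> R) k := if k is k'.+1 then F k' + sumR F k' else 0.

Variables (g : R -> R) (grid : nat -> R) (k : nat).
Hypotheses (g0 : forall x, 0 <= g x) (gridS : forall i, grid i < grid i.+1).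
Hypothesis gout : forall x, ~ (grid 0%N < x <= grid k) -> g x = 0.

Lemma grid_leq i j : (i <= j)%N -> grid i <= grid j.
Proof.
elim: j => [|j IHj]; first by rewrite leqn0 => /eqP->; lra.
by rewrite leq_eqVlt => /orP[/eqP->|/IHj H]; [lra|have := gridS j; lra].
Qed.

Definition piece i x := grid i < x <= grid i.+1.

Lemma simple_below_le (c : nat -> R) v : (forall i, (i < k)%N -> 0 <= c i) ->
  (forall i x, (i < k)%N -> piece i x -> g x <= c i) ->
  simple_below mu g v -> v <= sumR (fun i => c i * mu (piece i)) k.
Proof.
move=> c0 gc [l [bl [dl [lg ->]]]].
have lx i x : (i < size l)%N -> (nth (0, fun _ => False) l i).2 x -> (nth (0, fun _ => False) l i).1 <= g x.
  by move=> il; apply: simple_value_le.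
have bT : borel (fun=> True) by apply: borel_ext (borel_compl borel_false) => x; split=> // _ [].
have bE i j : borel (fun x => grid i < x <= grid j) by apply: borel_itv.
have -> : foldr (fun p acc => p.1 * mu p.2 + acc) 0 l = simple_on l (fun=> True).
  elim: {bl dl lg lx} l => [|p l IHl] //=; rewrite IHl; congr (_ * mu _ + _).
  by apply: eq_set => x; tauto.
have -> : (fun=> True) = (fun x => (grid 0%N < x <= grid k) \/ ~ (grid 0%N < x <= grid k)).
  by apply: eq_set => x; split=> // _; apply: EM.
rewrite simple_on_or //; last exact: borel_compl.
have : simple_on l (fun x => ~ (grid 0%N < x <= grid k)) <= 0 * mu (fun x => ~ (grid 0%N < x <= grid k)).
  apply: simple_on_le => //; [exact: borel_compl|lra|move=> i x il ilx nx].
  by have := lx i x il ilx; rewrite gout.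
suff : forall n, (n <= k)%N -> simple_on l (fun x => grid 0%N < x <= grid n) <= sumR (fun i => c i * mu (piece i)) n.
  by move=> /(_ k (leqnn _)); lra.
elim=> [|n IHn] nk.
  apply: Rle_trans (_ : 0 * mu (fun x => grid 0%N < x <= grid 0%N) <= _); last by rewrite /=; lra.
  apply: simple_on_le => //; first by lra.
  by move=> i x _ _; lra.
have -> : (fun x => grid 0%N < x <= grid n.+1) = (fun x => grid 0%N < x <= grid n \/ piece n x).
  have := grid_leq (leq0n n); have := gridS n; rewrite /piece => H1 H2.
  by apply: eq_set => x; split=> [H|]; [case: (Rle_lt_dec x (grid n)); [left|right]|]; lra.
rewrite simple_on_or //; [|exact: bE|by rewrite /piece => x; lra].
rewrite /= Rplus_comm; apply: Rplus_le_compat; last exact/IHn/ltnW.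
by apply: simple_on_le => //; [exact: bE|exact: c0|move=> i x il ilx nx; apply: Rle_trans (lx i x il ilx) _; apply: gc].
Qed.

Fixpoint step_list (c : nat -> R) n : seq (R * (R -> Prop)) :=
  if n is n'.+1 then (c n', piece n') :: step_list c n' else [::].

Lemma simple_below_step (c : nat -> R) : (forall i, (i < k)%N -> 0 <= c i) ->
  (forall i x, (i < k)%N -> piece i x -> c i <= g x) ->
  simple_below mu g (sumR (fun i => c i * mu (piece i)) k).
Proof.
move=> c0 gc; exists (step_list c k).
have sz n : size (step_list c n) = n by elim: n => //= n ->.
have nthE n i : (i < n)%N -> nth (0, fun _ => False) (step_list c n) i = (c (n.-1 - i)%N, piece (n.-1 - i)%N).
  elim: n i => // n IHn [|i] ni /=; first by rewrite subn0.
  by rewrite IHn //; congr (c _, piece _); case: n ni {IHn} => //= n _; rewrite subSS.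
have lt n i : (i < n)%N -> (n.-1 - i < n)%N by case: n => //= n _; rewrite ltnS leq_subr.
split.
  move=> i; rewrite sz => ik; rewrite nthE //=; split; first exact/c0/lt.
  exact: borel_itv.
split.
  move=> i j x ij; rewrite sz => jk; rewrite !nthE ?(ltn_trans ij) //= /piece => H1 H2.
  have : grid (k.-1 - j).+1 <= grid (k.-1 - i)%N by apply: grid_leq; lia.
  by lra.
split; last by elim: (k) => //= n ->.
move=> x.
have out n : (forall i, (i < n)%N -> ~ piece i x) ->
    foldr (fun p acc => p.1 * indic p.2 x + acc) 0 (step_list c n) = 0.
  elim: n => //= n IHn H; rewrite IHn => [|i im]; last by apply: H; apply: ltnW.
  by rewrite indicF; [lra|exact: H].
suff : forall n, (n <= k)%N -> foldr (fun p acc => p.1 * indic p.2 x + acc) 0 (step_list c n) <= g x by apply.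
elim=> [|n IHn] nk /=; first exact: g0.
have [px|npx] := pselect (piece n x); last by rewrite indicF //; have := IHn (ltnW nk); lra.
rewrite indicT // out => [|i im]; first by have := gc n x nk px; lra.
move: px; rewrite /piece => H1 H2.
by have := grid_leq im; lra.
Qed.

Lemma sumR_ge0 F n : (forall i, (i < n)%N -> 0 <= F i) -> 0 <= sumR F n.
Proof.
elim: n => [|n IHn] H /=; first by lra.
by have := H n (ltnSn n); have := IHn (fun i im => H i (ltnW im)); lra.
Qed.

Lemma sumR_le F F' n : (forall i, (i < n)%N -> F i <= F' i) -> sumR F n <= sumR F' n.
Proof.
elim: n => [|n IHn] H /=; first by lra.
by have := H n (ltnSn n); have := IHn (fun i im => H i (ltnW im)); lra.
Qed.

Lemma sumRD F F' n : sumR (fun i => F i + F' i) n = sumR F n + sumR F' n.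
Proof. by elim: n => [|n IHn] /=; [lra|rewrite IHn; lra]. Qed.

Lemma sumR_mulr a F n : sumR (fun i => a * F i) n = a * sumR F n.
Proof. by elim: n => [|n IHn] /=; [lra|rewrite IHn; lra]. Qed.

Lemma sumR_piece_le1 : sumR (fun i => mu (piece i)) k <= 1.
Proof.
have -> : sumR (fun i => mu (piece i)) k = upper (grid 0%N) - upper (grid k).
  elim: (k) => [|n IHn] /=; first by lra.
  by rewrite IHn mu_itv; have := gridS n; lra.
by have := mu_le1 (borel_gt (grid 0%N)); have := mu_ge0 (borel_gt (grid k)); rewrite /upper; lra.
Qed.

Lemma integral_approx eps I : 0 < eps ->
  (forall i x, (i < k)%N -> piece i x -> Rabs (g x - g (grid i.+1)) <= eps) ->
  integral_nonneg mu g I ->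
  Rabs (I - sumR (fun i => g (grid i.+1) * mu (piece i)) k) <= eps.
Proof.
move=> e0 ge [ub lb].
have S1 := sumR_piece_le1.
have p0 i : 0 <= mu (piece i) by apply/mu_ge0/borel_itv.
have up : I <= sumR (fun i => (g (grid i.+1) + eps) * mu (piece i)) k.
  apply: lb => v; apply: simple_below_le => [i _|i x ik px]; first by have := g0 (grid i.+1); lra.
  by have := ge i x ik px => /Rabs_le_inv; lra.
have lo : sumR (fun i => Rmax (g (grid i.+1) - eps) 0 * mu (piece i)) k <= I.
  apply: ub; apply: simple_below_step => [i _|i x ik px]; first exact: Rmax_r.
  by apply: Rmax_lub => //; have := ge i x ik px => /Rabs_le_inv; lra.
have lo' : sumR (fun i => (g (grid i.+1) - eps) * mu (piece i)) k <= I.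
  apply: Rle_trans lo; apply: sumR_le => i _; apply: Rmult_le_compat_r => //; exact: Rmax_l.
have E s : sumR (fun i => (g (grid i.+1) + s) * mu (piece i)) k =
    sumR (fun i => g (grid i.+1) * mu (piece i)) k + s * sumR (fun i => mu (piece i)) k.
  rewrite -sumR_mulr -sumRD; elim: (k) => //= n ->; ring.
rewrite E in up; rewrite (E (- eps)) in lo'.
have := sumR_ge0 (fun i (_ : (i < k)%N) => p0 i).
by move=> H; apply: Rabs_le; nra.
Qed.

Lemma integral_nonneg_exists G : (forall x, g x <= G) -> exists I, integral_nonneg mu g I.
Proof.
move=> gG; have [||I HI] := completeness (simple_below mu g); last by exists I.
  exists (sumR (fun i => G * mu (piece i)) k) => v; apply: simple_below_le => // i _.
  by apply: Rle_trans (gG 0); apply: g0.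
by exists 0, [::].
Qed.
End ProbMeasure.

Lemma uniformly_continuous_of_support (h : R -> R) M : 0 <= M -> continuity h ->
  (forall x, M < Rabs x -> h x = 0) -> forall eps, 0 < eps -> exists delta, 0 < delta /\
  forall x y, Rabs (x - y) < delta -> Rabs (h x - h y) <= eps.
Proof.
move=> M0 hc hM eps e0.
have [[dl d0] /= Hd] := Heine_cor2 (f := h) (a := - M - 1) (b := M + 1) (fun x _ => hc x) (mkposreal eps e0).
exists (Rmin dl 1); split; first by apply: Rmin_glb_lt; lra.
have W x y : Rabs (x - y) < Rmin dl 1 -> M + 1 < Rabs x -> Rabs (h x - h y) <= eps.
  move=> xy xM; rewrite (hM x) ?(hM y) ?Rminus_diag ?Rabs_R0; try lra.
  have := Rabs_triang (x - y) y; rewrite (_ : x - y + y = x); last by ring.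
  by have := Rmin_r dl 1; lra.
move=> x y xy; case: (Rle_lt_dec (Rabs x) (M + 1)) => [/Rabs_le_inv xM|]; last exact: W.
case: (Rle_lt_dec (Rabs y) (M + 1)) => [/Rabs_le_inv yM|yM].
  by apply/Rlt_le/Hd; try lra; have := Rmin_l dl 1; lra.
by rewrite Rabs_minus_sym; apply: W => //; rewrite Rabs_minus_sym.
Qed.

Lemma continuous_bounded_of_support (h : R -> R) M : 0 <= M -> continuity h ->
  (forall x, M < Rabs x -> h x = 0) -> exists G, 0 <= G /\ forall x, h x <= G.
Proof.
move=> M0 hc hM; have [|z [Hz _]] := continuity_ab_maj h (- M) M _ (fun x _ => hc x); first by lra.
exists (Rmax (h z) 0); split; first exact: Rmax_r.
move=> x; case: (Rle_lt_dec (Rabs x) M) => [/Rabs_le_inv xM|/hM->]; last exact: Rmax_r.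
by apply: Rle_trans (Rmax_l _ _); apply: Hz.
Qed.

Lemma antitone_small_jump (D : R -> R) a b eta : (forall x y, x <= y -> D y <= D x) ->
  (forall x, 0 <= D x <= 1) -> a < b -> 0 < eta ->
  exists x t, [/\ a < x, x < t, t < b & D x - D t <= eta].
Proof.
move=> Da D01 ab e0; have [K HK] := exists_nat_gt (1 / eta).
have K0 : 0 < INR K by apply: Rlt_trans HK; apply: Rdiv_lt_0_compat; lra.
pose w := (b - a) / (INR K + 2).
have w0 : 0 < w by apply: Rdiv_lt_0_compat; lra.
have wE : w * (INR K + 2) = b - a by rewrite /w; field; lra.
pose X i := a + (INR i + 1) * w.
apply: contrapT => nH.
suff H i : (i <= K)%N -> INR i * eta <= D (X 0%N) - D (X i).
  have := H K (leqnn _); have [H0 _] := D01 (X K); have [_ H1] := D01 (X 0%N).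
  have : 1 < INR K * eta; last by lra.
  have -> : 1 = 1 / eta * eta by field; lra.
  by apply: Rmult_lt_compat_r.
elim: i => [|i IHi] iK; first by rewrite /=; lra.
have := IHi (ltnW iK); rewrite S_INR.
suff : ~ (D (X i) - D (X i.+1) <= eta) by lra.
move=> jump; apply: nH; exists (X i), (X i.+1); split=> //; rewrite /X ?S_INR.
- by have := pos_INR i; nra.
- by lra.
have iK' : INR i + 1 <= INR K by rewrite -S_INR; apply: leq_INR.
by have := Rmult_le_compat_r w _ _ (Rlt_le _ _ w0) iK'; lra.
Qed.

Lemma finite_eventually (P : nat -> nat -> Prop) k :
  (forall i, exists n0, forall n, (n0 <= n)%N -> P i n) ->
  exists n0, forall n, (n0 <= n)%N -> forall i, (i < k)%N -> P i n.
Proof.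
move=> H; elim: k => [|k [n0 Hn0]]; first by exists 0%N.
have [n1 Hn1] := H k; exists (maxn n0 n1) => n; rewrite geq_max => /andP[n0n n1n] i.
by rewrite ltnS leq_eqVlt => /orP[/eqP->|]; [exact: Hn1|exact: Hn0].
Qed.

Section VagueConvergence.
Variables (nu : nat -> (R -> Prop) -> R) (mu : (R -> Prop) -> R).
Hypotheses (nup : forall n, (1 <= n)%N -> prob_measure (nu n)) (mup : prob_measure mu).
Hypothesis lower : forall t eps, 0 < eps -> exists n0, forall n, (n0 <= n)%N -> (1 <= n)%N ->
  upper mu t - eps <= upper (nu n) t.
Hypothesis upper_left : forall x t eps, 0 < eps -> x < t -> exists n0, forall n, (n0 <= n)%N -> (1 <= n)%N ->
  upper (nu n) t <= upper mu x + eps.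

Lemma exists_convergence_point a b eta : a < b -> 0 < eta -> exists t, [/\ a < t, t < b &
  exists n0, forall n, (n0 <= n)%N -> (1 <= n)%N -> Rabs (upper (nu n) t - upper mu t) <= eta].
Proof.
move=> ab e0; have [|||x [t [ax xt tb Dxt]]] := @antitone_small_jump (upper mu) a b (eta / 2) _ _ ab _.
- by move=> x y xy; apply: mu_leq => // [||z]; [exact: borel_gt|exact: borel_gt|lra].
- by move=> x; split; [apply: mu_ge0|apply: mu_le1] => //; apply: borel_gt.
- by lra.
have e2 : 0 < eta / 2 by lra.
have [m1 H1] := lower t e2; have [m2 H2] := upper_left e2 xt.
exists t; split; [lra|lra|exists (maxn m1 m2)] => n; rewrite geq_max => /andP[nm1 nm2] n1.
by have := H1 n nm1 n1; have := H2 n nm2 n1; move=> *; apply: Rabs_le; lra.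
Qed.

Lemma integral_nonneg_cv (h : R -> R) M : 0 <= M -> continuity h -> (forall x, 0 <= h x) ->
  (forall x, M < Rabs x -> h x = 0) -> exists (In : nat -> R) (I : R),
    [/\ forall n, (1 <= n)%N -> integral_nonneg (nu n) h (In n), integral_nonneg mu h I & Un_cv In I].
Proof.
move=> M0 hc h0 hM; have [G [G0 hG]] := continuous_bounded_of_support M0 hc hM.
have out x (t : nat -> R) k : t 0%N < - M -> M < t k -> ~ (t 0%N < x <= t k) -> h x = 0.
  move=> t0 tk nx; apply: hM; apply: Rnot_le_lt => /Rabs_le_inv xM; apply: nx; lra.
have ex m : prob_measure m -> exists I, integral_nonneg m h I.
  move=> mp; pose t i := if i is 0%N then - M - 1 else M + INR i.
  apply: (@integral_nonneg_exists m mp h t 1 h0 _ _ G hG) => [[|i]|x].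
  - by rewrite /t; have : 0 < INR 1 := Rlt_0_1; lra.
  - by rewrite /t !S_INR; lra.
  by apply: out; rewrite /t ?S_INR; have := pos_INR 0; lra.
have /choice[In InP] : forall n, exists I, (1 <= n)%N -> integral_nonneg (nu n) h I.
  move=> n; have [n1|] := boolP (1 <= n)%N; last by exists 0.
  by have [I HI] := ex _ (nup n1); exists I.
have [I HI] := ex _ mup; exists In, I; split=> //.
apply: eventually_cv => eps e0.
have e3 : 0 < eps / 3 by lra.
have [dl [d0 Hd]] := uniformly_continuous_of_support M0 hc hM e3.
pose w := Rmin (dl / 3) (1 / 2).
have w0 : 0 < w by apply: Rmin_glb_lt; lra.
have wd : w <= dl / 3 := Rmin_l _ _; have w1 : w <= 1 / 2 := Rmin_r _ _.
pose X i := - M - 1 + INR i * w.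
have [k Hk] := exists_nat_gt ((2 * M + 2) / w).
have kM : 2 * M + 2 < INR k * w.
  have -> : 2 * M + 2 = (2 * M + 2) / w * w by field; lra.
  exact: Rmult_lt_compat_r.
have k0 := pos_INR k.
pose eta := eps / 3 / (2 * (INR k * G + 1)).
have kG : 0 <= INR k * G by apply: Rmult_le_pos.
have eta0 : 0 < eta by apply: Rdiv_lt_0_compat; lra.
have /choice[t tP] : forall i, exists t, [/\ X i < t, t < X i.+1 &
    exists n0, forall n, (n0 <= n)%N -> (1 <= n)%N -> Rabs (upper (nu n) t - upper mu t) <= eta].
  by move=> i; apply: exists_convergence_point => //; rewrite /X S_INR; lra.
have tX i : X i < t i < X i.+1 by have [] := tP i.
have tS i : t i < t i.+1 by have := tX i; have := tX i.+1; lra.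
have touch x : ~ (t 0%N < x <= t k) -> h x = 0.
  apply: out; first by have := tX 0%N; rewrite /X /=; lra.
  by have := tX k; rewrite /X; lra.
have ge i x : (i < k)%N -> piece t i x -> Rabs (h x - h (t i.+1)) <= eps / 3.
  rewrite /piece => _ px; apply: Hd.
  have := tX i; have := tX i.+1; rewrite /X !S_INR => H1 H2.
  by apply: Rabs_def1; lra.
have appr m J : prob_measure m -> integral_nonneg m h J ->
    Rabs (J - sumR (fun i => h (t i.+1) * m (piece t i)) k) <= eps / 3.
  by move=> mp; apply: (integral_approx mp h0 tS touch e3 ge).
have [n0 Hn0] := @finite_eventually (fun i n => (1 <= n)%N -> Rabs (upper (nu n) (t i) - upper mu (t i)) <= eta) k.+1
  (fun i => let: And3 _ _ H := tP i in H).
exists (maxn n0 1) => n; rewrite geq_max => /andP[nn0 n1].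
have A1 := appr _ _ (nup n1) (InP n n1); have A2 := appr _ _ mup HI.
have A3 : Rabs (sumR (fun i => h (t i.+1) * nu n (piece t i)) k -
    sumR (fun i => h (t i.+1) * mu (piece t i)) k) <= INR k * (G * (2 * eta)).
  have : (k <= k)%N by []; elim: {-2}(k) => [_|j IHj jk] /=; first by rewrite Rminus_diag Rabs_R0; lra.
  have := IHj (ltnW jk).
  rewrite /piece (mu_itv (nup n1)) ?(mu_itv mup); try by apply: Rlt_le.
  have := Hn0 n nn0 j (leqW jk) n1; have := Hn0 n nn0 j.+1 jk n1.
  move=> /Rabs_le_inv B1 /Rabs_le_inv B2 /Rabs_le_inv B3.
  have hb := hG (t j.+1); have hp := h0 (t j.+1).
  have -> : INR j.+1 * (G * (2 * eta)) = INR j * (G * (2 * eta)) + G * (2 * eta) by rewrite S_INR; ring.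
  have B4 : h (t j.+1) * (2 * eta) <= G * (2 * eta) by apply: Rmult_le_compat_r; lra.
  apply: Rabs_le.
  move: (sumR _ j) (sumR _ j) B3 => s1 s2 B3.
  split; nra.
have A4 : INR k * (G * (2 * eta)) <= eps / 3.
  have E : eps / 3 = eta * (2 * (INR k * G + 1)) by rewrite /eta; field; lra.
  by rewrite {1}E; lra.
by move: A1 A2 A3 => /Rabs_le_inv ? /Rabs_le_inv ? /Rabs_le_inv ?; lra.
Qed.

Lemma continuity_Rmax0 (g : R -> R) : continuity g -> continuity (fun x => Rmax (g x) 0).
Proof.
move=> gc; have -> : (fun x => Rmax (g x) 0) = ((fun x => (g x + Rabs (g x)) * / 2)).
  apply/funext => x; rewrite /Rmax; case: Rle_dec => H.
    by rewrite Rabs_left1 //; lra.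
  by rewrite Rabs_right; lra.
apply: continuity_mult; last by apply: continuity_const.
apply: continuity_plus => //; apply: (continuity_comp g Rabs gc); exact: Rcontinuity_abs.
Qed.

Lemma vague_cv_of_upper : vague_cv nu mu.
Proof.
move=> g gc [M0 gM0]; pose M := Rmax M0 0.
have M_ge0 : 0 <= M := Rmax_r _ _.
have gM x : M < Rabs x -> g x = 0 by move=> H; apply: gM0; have := Rmax_l M0 0; rewrite -/M; lra.
have [||I1 [J1 [H1 K1 C1]]] := @integral_nonneg_cv (fun x => Rmax (g x) 0) M M_ge0 (continuity_Rmax0 gc).
- by move=> x; apply: Rmax_r.
- by move=> x /gM ->; rewrite Rmax_left //; lra.
have [||I2 [J2 [H2 K2 C2]]] := @integral_nonneg_cv (fun x => Rmax (- g x) 0) M M_ge0 (continuity_Rmax0 (continuity_opp _ gc)).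
- by move=> x; apply: Rmax_r.
- by move=> x /gM ->; rewrite Ropp_0 Rmax_left //; lra.
exists (fun n => I1 n - I2 n), (J1 - J2); split; first by move=> n n1; exists (I1 n), (I2 n); split; [apply: H1|split=> //; apply: H2].
split; first by exists J1, J2.
exact: CV_minus.
Qed.
End VagueConvergence.
End Measures.

(** * The measure with a given tail function *)

Section LebesgueStieltjes.
Local Open Scope classical_set_scope.
Local Open Scope ring_scope.
Variables (Q : realType) (D : Q -> Q) (C : Q).
Hypotheses (Danti : forall x y, x <= y -> D y <= D x).
Hypotheses (D1 : forall x, x < - C -> D x = 1) (D0 : forall x, C <= x -> D x = 0).
Hypothesis Drc : forall x eps, 0 < eps -> exists2 delta, 0 < delta & D x - eps <= D (x + delta).

Definition cdf : Q -> Q := fun x => 1 - D x.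

Lemma cdf_nd : nondecreasing cdf.
Proof. by move=> x y xy; rewrite lerD2l lerN2; apply: Danti. Qed.

Lemma cdf_rc : right_continuous cdf.
Proof.
move=> x; apply/(@cvgrPdist_le _ Q^o) => /= e e0; have [d d0 Dd] := Drc x e0.
near=> t.
have xt : x <= t by apply: ltW; near: t; apply: nbhs_right_gt.
have td : t <= x + d by near: t; apply: nbhs_right_le; rewrite ltrDl.
rewrite ler0_norm ?subr_le0; last exact: cdf_nd.
rewrite opprB /cdf opprD opprK addrACA subrr add0r addrC lerBlDr -lerBlDl.
by apply: le_trans Dd _; apply: Danti.
Unshelve. all: by end_near. Qed.

HB.instance Definition _ := @isCumulative.Build Q _ Q cdf cdf_nd cdf_rc.

Let ls := lebesgue_stieltjes_measure (cdf : cumulative Q Q).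
Let a := Num.min (- C - 1) C.
Let J := `]a, C]%classic : set (measurableTypeR Q).

Lemma ls_itv x y : x <= y -> ls `]x, y] = (cdf y - cdf x)%:E.
Proof.
move=> xy; rewrite /ls /lebesgue_stieltjes_measure.
rewrite /measure_extension measurable_mu_extE/=; last exact: is_ocitv.
by rewrite wlength_itv_bnd.
Qed.

Definition tail_measure (A : set Q) : Q := fine (ls ((A : set (measurableTypeR Q)) `&` J)).

Lemma measurable_J : measurable J.
Proof. exact: measurable_itv. Qed.

Lemma cdf_a : cdf a = 0.
Proof.
rewrite /cdf D1 ?subrr // /a gt_min; apply/orP; left.
by rewrite ltrBlDr ltrDl.
Qed.

Lemma ls_J : ls J = 1%E.
Proof.
rewrite ls_itv; first by rewrite cdf_a /cdf D0 // !subr0.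
by rewrite /a ge_min lexx orbT.
Qed.

Lemma ls_fin A : measurable (A : set (measurableTypeR Q)) -> ls (A `&` J) \is a fin_num.
Proof.
move=> mA; rewrite ge0_fin_numE ?measure_ge0 //.
apply: (@le_lt_trans _ _ (ls J)); last by rewrite ls_J ltry.
by apply: le_measure; rewrite ?inE //; [apply: measurableI => //; exact: measurable_J|exact: measurable_J].
Qed.

Lemma tail_measure_ge0 A : 0 <= tail_measure A.
Proof. by rewrite fine_ge0 ?measure_ge0. Qed.

Lemma tail_measureT : tail_measure setT = 1.
Proof. by rewrite /tail_measure setTI ls_J. Qed.

Lemma tail_measure_gt t : tail_measure (fun x => t < x) = D t.
Proof.
rewrite /tail_measure.
have -> : (fun x => t < x : Prop) `&` J = `]Num.max t a, C]%classic.
  apply/seteqP; split=> x; rewrite /J /setI /= !in_itv /= gt_max.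
    by move=> [-> /andP[-> ->]].
  by move=> /andP[/andP[-> ->] ->].
have [tC|Ct] := leP t C; last first.
  have ls0 : ls (set0 : set Q) = 0%E by exact: (measure0 ls).
  rewrite set_itv_ge; first by rewrite ls0 D0 // ltW.
  by rewrite ltBSide /= -leNgt le_max ltW.
rewrite ls_itv /=; last by rewrite ge_max tC /a ge_min lexx orbT.
rewrite {1}/cdf D0 // subr0 /cdf opprB addrCA subrr addr0.
have [//|ta] := leP a t.
have aC : a < - C by have := cdf_a; rewrite /a gt_min => _; rewrite ltrBlDr ltrDl ltr01.
by rewrite !D1 //; apply: lt_trans ta _.
Qed.

Lemma tail_measure_sigma (A : nat -> set Q) : (forall k, measurable (A k : set (measurableTypeR Q))) ->
  trivIset setT A -> forall e, 0 < e ->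
  exists N, forall n, (N <= n)%N -> `|\sum_(0 <= k < n) tail_measure (A k) - tail_measure (\bigcup_k A k)| < e.
Proof.
move=> mA tA e e0; pose A' k := (A k : set (measurableTypeR Q)) `&` J.
have mA' k : measurable (A' k) by apply: measurableI => //; exact: measurable_J.
have tA' : trivIset setT A' by apply: trivIset_setIr.
have mU : measurable (\bigcup_k A k : set (measurableTypeR Q)) by apply: bigcupT_measurable.
have mUA' : measurable (\bigcup_k A' k) by apply: bigcupT_measurable.
have := @measure_semi_sigma_additive _ _ _ ls A' mA' tA' mUA'.
have UE : \bigcup_k A' k = (\bigcup_k A k : set (measurableTypeR Q)) `&` J by rewrite setI_bigcupl.
have E : ls (\bigcup_k A' k) = (tail_measure (\bigcup_k A k))%:E.
  by rewrite UE; apply/esym/fineK/ls_fin.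
move=> H; have {}H : (fun n => (\sum_(0 <= i < n) ls (A' i))%E) @ \oo --> (tail_measure (\bigcup_k A k))%:E.
  by rewrite -E; exact: H.
move: H => /fine_cvg /=.
move=> /cvgrPdist_lt/(_ e e0) [N _ HN]; exists N => n Nn.
rewrite distrC; have := HN n Nn; rewrite /= /tail_measure.
suff -> : fine (\sum_(0 <= i < n) ls (A' i))%E = \sum_(0 <= k < n) fine (ls (A k `&` J)) by [].
rewrite -sum_fine // => k _; exact: ls_fin.
Qed.
End LebesgueStieltjes.

Section TailMeasure.
Local Open Scope ring_scope.
Variables (D : R -> R) (C : R).
Hypotheses (Danti : forall x y, Rle x y -> Rle (D y) (D x)).
Hypotheses (D1 : forall x, Rlt x (Ropp C) -> D x = R1) (D0 : forall x, Rle C x -> D x = R0).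
Hypothesis Drc : forall x eps, Rlt R0 eps -> exists2 delta, Rlt R0 delta & Rle (Rminus (D x) eps) (D (Rplus x delta)).

Lemma borel_measurable (A : R -> Prop) : borel A -> measurable (A : set (measurableTypeR R)).
Proof.
elim=> {A} [x y|A _ IH|A _ IH|A B AB _ IH].
- rewrite (_ : (fun _ => _) = [set` `]x, y[%O]%classic); first exact: measurable_itv.
  apply/seteqP; split=> z /=; rewrite in_itv /=.
    by move=> [/RltP -> /RltP ->].
  by move=> /andP[/RltP ? /RltP ?].
- exact: measurableC.
- rewrite (_ : (fun _ => _) = (\bigcup_k (A k : set (measurableTypeR R)))%classic); first exact: bigcupT_measurable.
  by apply/seteqP; split=> [z [k Ak]|z [k _ Ak]]; exists k.
by rewrite (_ : B = A) //; apply/seteqP; split=> z /AB.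
Qed.

Lemma exists_measure_of_tail : exists mu, prob_measure mu /\ forall t, upper mu t = D t.
Proof.
have Da (x y : R) : x <= y -> D y <= D x by move=> /RleP/Danti/RleP.
have D1' (x : R) : x < - C -> D x = 1 by move=> /RltP/D1.
have D0' (x : R) : C <= x -> D x = 0 by move=> /RleP/D0.
have Drc' (x eps : R) : 0 < eps -> exists2 delta : R, 0 < delta & D x - eps <= D (x + delta).
  by move=> /RltP/(Drc x)[d /RltP d0 /RleP Dd]; exists d.
exists (tail_measure C Da Drc'); split; last first.
  move=> t; rewrite -[RHS](tail_measure_gt Da D1' D0' Drc'); congr tail_measure.
  by apply/funext => x; apply/propext; split=> /RltP.
split; first by move=> A _; apply/RleP/tail_measure_ge0.
split; first exact: tail_measureT.
move=> A bA dA e /RltP e0.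
have tA : trivIset setT (A : nat -> set R).
  apply/trivIsetP => i j _ _ /eqP ij; apply/seteqP; split=> // x [Ai Aj].
  exact: dA ij Ai Aj.
have [N HN] := tail_measure_sigma Da D1' D0' Drc' (fun k => borel_measurable (bA k)) tA e0.
exists N => n /ssrnat.leP Nn; apply/RltP; rewrite RdistE sum_f_R0E.
have := HN n.+1 (leq_trans Nn (leqnSn n)).
congr (`|_ - tail_measure C Da Drc' _| < e).
by apply/seteqP; split=> [x [k _ Ak]|x [k Ak]]; exists k.
Qed.
End TailMeasure.

Section Assembly.
Local Open Scope R_scope.

Lemma cv_slope_bounded (w : nat -> R) l : Un_cv (fun n => w n / INR n) l ->
  exists C, 0 <= C /\ forall n, (1 <= n)%N -> Rabs (w n) <= C * INR n.
Proof.
move=> wl; have [N HN] := cv_eventually wl Rlt_0_1.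
have [E [E0 HE]] := finite_seq_bounded (fun n => w n / INR n) N.
exists (Rmax E (Rabs l + 1)); split; first exact: Rle_trans E0 (Rmax_l _ _).
move=> n n1; have n0 := INR_gt0 n1.
have -> : w n = w n / INR n * INR n by field; lra.
rewrite Rabs_mult (Rabs_right (INR n)); last by lra.
apply: Rmult_le_compat_r; first by lra.
case: (ltnP n N) => [/HE H|/HN H]; first exact: Rle_trans H (Rmax_l _ _).
apply: Rle_trans (Rmax_r _ _); apply: Rabs_le.
by have := Rle_abs l; have := Rle_abs (- l); rewrite Rabs_Ropp; lra.
Qed.

Lemma pushT_ge n (nuB : (R -> Prop) -> R) t : (1 <= n)%N ->
  pushT (/ INR n) nuB (fun x => t <= x) = nuB (fun y => INR n * t <= y).
Proof.
move=> n1; have n0 := INR_gt0 n1; rewrite /pushT; congr nuB; apply: eq_set => y.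
have iv : 0 < / INR n by apply: Rinv_0_lt_compat.
have E : / INR n * (INR n * t) = t by field; lra.
by rewrite -{1}E; split=> [/(Rmult_le_reg_l _ _ _ iv)|H] //; apply: Rmult_le_compat_l; lra.
Qed.
End Assembly.

Local Open Scope R_scope.

Theorem mainTheorem8 (K : fieldType) (B : comAlgType K) (f : nat -> R)
  (Bn : nat -> B -> Prop) (F : nat -> R -> B -> Prop)
  (nuB : nat -> (R -> Prop) -> R) :
  (forall n, Rle 0 (f n)) ->
  Un_cv (fun n => Rdiv (f n) (INR n)) 0 ->
  integral_domain B -> graded Bn -> finite_type B -> generated_by (Bn 1%N) ->
  krull_dim_pos B ->
  (forall n, (1 <= n)%N -> filtration_on (Bn n) (F n)) ->
  quasi_filtered f F ->
  limsup_lambda_finite Bn F ->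
  (forall n, (1 <= n)%N -> is_nu_W (Bn n) (F n) (nuB n)) ->
  let nu := fun n => pushT (Rinv (INR n)) (nuB n) in
  (exists u : nat -> R, (forall n, (1 <= n)%N -> is_min_lambda Bn F n (u n)) /\
     exists L : R, Un_cv (fun n => Rdiv (u n) (INR n)) L) /\
  (exists a b : R, forall n, (1 <= n)%N -> forall x, in_support (nu n) x ->
     Rle a x /\ Rle x b) /\
  (exists mu, prob_measure mu /\ vague_cv nu mu).
Proof.
move=> _ fn Bdom Bgr ft g1 kd Ffil Fqf Flim nuW nu.
have [u [b [h de]]] := exists_dimension_estimates Bdom Bgr ft g1 kd Ffil Fqf Flim.
have [Cz hz] := de_zero de.
have [n1 [d [M [N [n10 N0 bM usup key]]]]] := de_growth de.
have uCz n : (1 <= n)%N -> u n <= Cz * INR n.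
  move=> n_gt0; apply: Rnot_lt_le => /(hz n _ n_gt0).
  rewrite (de_full de n_gt0 (Rle_refl _)) => b0.
  by have := de_gt0 de n; rewrite b0.
have [l ul] := fekete_cv fn n10 uCz usup.
have [Cu [Cu0 uC]] := cv_slope_bounded ul.
have [Cf [Cf0 fC]] := cv_slope_bounded fn.
pose C := Rmax Cz 0 + Cu + Cf + 1.
have Cz0 : 0 <= Rmax Cz 0 := Rmax_r _ _; have Cz1 : Cz <= Rmax Cz 0 := Rmax_l _ _.
have C0 : 0 < C by rewrite /C; lra.
have scale x n : (1 <= n)%N -> x <= C -> x * INR n <= C * INR n.
  by move=> n_gt0 xC; apply: Rmult_le_compat_r => //; apply: pos_INR.
have fC' n : (1 <= n)%N -> f n <= C * INR n.
  move=> n_gt0; apply: Rle_trans (scale Cf n n_gt0 _); last by rewrite /C; lra.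
  by have := fC n n_gt0; have := Rle_abs (f n); lra.
have uC' n : (1 <= n)%N -> - C * INR n <= u n.
  move=> n_gt0; have := scale Cu n n_gt0 ltac:(rewrite /C; lra).
  by have := Rabs_le_inv (uC n n_gt0); lra.
have hfull n r : (1 <= n)%N -> r <= - C * INR n -> h n r = b n.
  by move=> n_gt0 rC; apply: (de_full de) => //; have := uC' n n_gt0; lra.
have hzero n r : (1 <= n)%N -> C * INR n < r -> h n r = 0%N.
  by move=> n_gt0 rC; apply: hz => //; have := scale Cz n n_gt0 ltac:(rewrite /C; lra); lra.
have [D [[Da D01] [D1 D0] Drc Dlow Dup]] :=
  exists_limit_tail fC' fn n10 N0 C0 (de_gt0 de) bM uC' (de_anti de) hfull hzero key.
have [mu [mup muD]] := exists_measure_of_tail Da D1 D0 Drc.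
have nup n : (1 <= n)%N -> prob_measure (nu n).
  move=> n_gt0; apply: prob_measure_pushT; first exact/Rinv_0_lt_compat/INR_gt0.
  by have [] := nuW n n_gt0.
have nu_ge n t : (1 <= n)%N -> nu n (fun x => t <= x) = level b h n t.
  move=> n_gt0; rewrite /nu pushT_ge //; have [_ H] := nuW n n_gt0.
  exact: H (de_dimF de _ n_gt0) (de_dimB de n).
split; first by exists u; split; [exact: de_min de|exists l].
split.
  exists (- C), C => n n_gt0 x xs; have np := nup n n_gt0.
  have bo a c : borel (fun y => a < y < c) by apply: borel_open.
  split; apply: Rnot_lt_le => xC.
    have := xs (- C - x) ltac:(lra).
    have := mu_or np (bo (x - (- C - x)) (x + (- C - x))) (borel_ge (- C)) ltac:(by move=> y; lra).
    rewrite nu_ge // (level_full (de_gt0 de) hfull) //; last by lra.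
    have := mu_le1 np (borel_or (bo (x - (- C - x)) (x + (- C - x))) (borel_ge (- C))).
    by lra.
  have := xs ((x - C) / 2) ltac:(lra).
  have := mu_leq np (bo (x - (x - C) / 2) (x + (x - C) / 2)) (borel_ge (x - (x - C) / 2)) ltac:(by move=> y; lra).
  by rewrite nu_ge // (level_zero _ hzero) //; lra.
exists mu; split=> //; apply: (vague_cv_of_upper nup mup) => [t eps e0|x t eps e0 xt].
  have [s [n0 [ts Hn0]]] := Dlow t eps e0; exists n0 => n nn0 n_gt0.
  rewrite muD; apply: Rle_trans (Hn0 n nn0 n_gt0) _; rewrite -nu_ge //.
  by apply: (mu_leq (nup n n_gt0)) (borel_ge _) (borel_gt _) _ => y; lra.
have [n0 Hn0] := Dup x t eps e0 xt; exists n0 => n nn0 n_gt0.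
rewrite muD; apply: Rle_trans (Hn0 n nn0 n_gt0); rewrite -nu_ge //.
by apply: (mu_leq (nup n n_gt0)) (borel_gt _) (borel_ge _) _ => y; lra.
Qed.
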